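(* Let $Q$ be a quiver of (simply laced) Dynkin type with vertices $1,\dots,n$. For every indecomposable rigid object $V$ of the cluster category $\mathcal{C}_Q$, the cluster character with coefficients $X_V$ is a cluster variable of the cluster algebra with coefficients associated to the biframed quiver $\widehat{Q}$ (with initial seed $(\widehat{Q},\{x_1,\dots,x_n,y_1,\dots,y_n,z_1,\dots,z_n\})$).
   Context: Let $k$ be an algebraically closed field. **Ice quivers, seeds, cluster algebras.** A cluster quiver is a finite quiver without loops and 2-cycles. An ice quiver of type $(n,m)$ is a cluster quiver with vertex set $\{1,\dots,m\}$ whose vertices $n+1,\dots,m$ are called frozen. The mutation $\mu_r$ at a non-frozen vertex $r$: (i) for each path $i\to r\to j$ add an arrow $i\to j$; (ii) reverse all arrows with source or target $r$; (iii) delete all 2-cycles created. (Arrows between two frozen vertices play no role and are disregarded.) A seed is a pair $(Q',u)$ with $Q'$ an ice quiver of type $(n,m)$ and $u=\{u_1,\dots,u_m\}$ algebraically independent over $\mathbb{Q}$. Its mutation at $r$ is $(\mu_r(Q'),u\setminus\{u_r\}\cup\{u_r'\})$ with $u_ru_r'=\prod_{v\to r}u_v+\prod_{r\to v}u_v$ (products over arrows of $Q'$). Cluster variables are the elements attached to non-frozen vertices in seeds obtained from the initial seed by finite sequences of mutations; the coefficients are the variables attached to the frozen vertices. The cluster algebra is generated by the cluster variables over the polynomial ring in the coefficients. **Biframed quiver.** $\widehat{Q}$ is the ice quiver of type $(n,3n)$ whose arrows are those of $Q$ together with arrows $2n+i\to i$ and $i\to n+i$ for $i=1,\dots,n$.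 The initial variables are $x_i$ at vertex $i$, $y_i$ at vertex $n+i$, $z_i$ at vertex $2n+i$. **Cluster category.** $\mathcal{C}_Q$ is the orbit category of $\mathcal{D}^b(\mathrm{mod}\,kQ)$ by $\tau^{-1}[1]$. An object $T$ is rigid if $\mathrm{Ext}^1_{\mathcal{C}_Q}(T,T)=0$. $P_i$ is the indecomposable projective module at vertex $i$. The indecomposable objects of $\mathcal{C}_Q$ are the indecomposable $kQ$-modules and the shifts $P_i[1]$. **Cluster character with coefficients.** $X_?:\mathrm{obj}\,\mathcal{C}_Q\to\mathbb{Q}(x_1,\dots,x_n,y_1,\dots,y_n,z_1,\dots,z_n)$ is the map with $X_{M\oplus N}=X_MX_N$, $X_{P_i[1]}=x_i$, and for an indecomposable $kQ$-module $V$ with dimension vector $d=(d_1,\dots,d_n)$, $$X_V=\sum_{0\le e\le d}\chi(\mathrm{Gr}_e(V))\prod_{r=1}^n x_r^{-\langle e,\alpha_r\rangle-\langle\alpha_r,d-e\rangle}\,y_r^{e_r}z_r^{d_r-e_r},$$ where $\mathrm{Gr}_e(V)$ is the Grassmannian of submodules of $V$ of dimension vector $e$, $\chi$ the Euler characteristic, $\alpha_r$ the dimension vector of the simple $S_r$, and $\langle\ ,\ \rangle$ the Euler form; $\langle\alpha_i,\alpha_j\rangle=\delta_{ij}-\#\{\text{arrows } i\to j\}$. *)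

(* Defs.v *)
From HB Require Import structures.
From mathcomp Require Import all_boot all_order all_algebra.
From mathcomp Require Import mpoly.
Set Implicit Arguments.
Unset Strict Implicit.
Unset Printing Implicit Defensive.
Import GRing.Theory Num.Theory.
Local Open Scope ring_scope.

(** * Quivers and Dynkin type *)

(* [Q i j] is the number of arrows [i -> j]. *)
Definition quiver (n : nat) : Type := 'I_n -> 'I_n -> nat.

Definition chain_adj (m i j : nat) : bool :=
  [&& (i < m)%N, (j < m)%N & (j == i.+1) || (i == j.+1)].

Definition leg_adj (v w i j : nat) : bool :=
  ((i == v) && (j == w)) || ((i == w) && (j == v)).

(* The diagrams are numbered from 0.  A_n is a chain; D_n and E_n are the
   chain 0 - 1 - ... - (n-2) together with the vertex n-1, which is attached
   to the vertex n-3 in type D_n and to the vertex 2 in type E_n. *)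
Inductive dynkin_adj (n : nat) : (nat -> nat -> bool) -> Prop :=
| Dynkin_A of (1 <= n)%N : dynkin_adj n (chain_adj n)
| Dynkin_D of (4 <= n)%N :
    dynkin_adj n (fun i j => chain_adj n.-1 i j || leg_adj (n - 3) n.-1 i j)
| Dynkin_E of (6 <= n <= 8)%N :
    dynkin_adj n (fun i j => chain_adj n.-1 i j || leg_adj 2 n.-1 i j).

Definition dynkin (n : nat) (Q : quiver n) : Prop :=
  exists (adj : nat -> nat -> bool) (s : 'I_n -> 'I_n),
    [/\ dynkin_adj n adj, bijective s
      & forall i j, (Q i j + Q j i)%N = adj (s i) (s j)].

(** * Mutation of ice quivers and of seeds *)

Section Mutation.
Variable m : nat.
Implicit Types (B : quiver m) (r i j : 'I_m).

Definition add_paths r B : quiver m := fun i j => (B i j + B i r * B r j)%N.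
Definition reverse_at r B : quiver m :=
  fun i j => if (i == r) || (j == r) then B j i else B i j.
Definition delete_2cycles B : quiver m := fun i j => (B i j - B j i)%N.

(* Arrows between two frozen vertices are not removed; they occur in no
   exchange relation and never affect the other arrows. *)
Definition mutate_quiver r B : quiver m :=
  delete_2cycles (reverse_at r (add_paths r B)).

Variable F : fieldType.

Definition seed : Type := (quiver m * ('I_m -> F))%type.

(* The denominator does not vanish on the seeds reached from algebraically
   independent variables: mutation preserves algebraic independence. *)
Definition mutate_seed (r : 'I_m) (S : seed) : seed :=
  (mutate_quiver r S.1,
   fun i => if i == r then
              (\prod_(v < m) S.2 v ^+ S.1 v r + \prod_(v < m) S.2 v ^+ S.1 r v)
              / S.2 r
            else S.2 i).

(* For ice quivers of type [(n, m)]: the vertices of value [< n] are the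
   non-frozen ones. *)
Definition cluster_variable (n : nat) (S0 : seed) (x : F) : Prop :=
  exists (rs : seq 'I_m) (i : 'I_m),
    [/\ all (fun r : 'I_m => (r < n)%N) rs, (i < n)%N
      & x = (foldl (fun S r => mutate_seed r S) S0 rs).2 i].

End Mutation.

(** * The biframed quiver and its initial seed *)

Section Biframed.
Variable n : nat.

Definition xv (i : 'I_n) : 'I_(n + n + n) := lshift n (lshift n i).
Definition yv (i : 'I_n) : 'I_(n + n + n) := lshift n (rshift n i).
Definition zv (i : 'I_n) : 'I_(n + n + n) := rshift (n + n) i.

Definition biframed (Q : quiver n) : quiver (n + n + n) := fun u v =>
  match split u, split v with
  | inl u', inl v' =>
      match split u', split v' with
      | inl i, inl j => Q i j
      | inl i, inr j => (i == j : nat)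
      | _, _ => 0%N
      end
  | inr i, inl v' => if split v' is inl j then (i == j : nat) else 0%N
  | _, _ => 0%N
  end.

Definition ratfun : fieldType := {fraction {mpoly rat[n + n + n]}}.

Definition init_var (v : 'I_(n + n + n)) : ratfun :=
  tofrac ('X_v : {mpoly rat[n + n + n]}).

Definition biframed_seed (Q : quiver n) : seed (n + n + n) ratfun :=
  (biframed Q, init_var).

End Biframed.

(** * Finite-dimensional representations *)

(* Sets of k-points of the affine space with coordinates indexed by I. *)
Definition kset (k : closedFieldType) (I : finType) : Type :=
  {ffun I -> k} -> Prop.

Section Representations.
Variables (k : closedFieldType) (n : nat) (Q : quiver n).

(* Matrices act on row vectors from the right, so that composites read from
   left to right. *)
Record rep : Type := Rep {
  rdim : 'I_n -> nat;
  act : forall i j : 'I_n, 'I_(Q i j) -> 'M[k]_(rdim i, rdim j) }.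

Definition rmap (M N : rep) : Type := forall i, 'M[k]_(rdim M i, rdim N i).

Definition is_hom (M N : rep) (f : rmap M N) : Prop :=
  forall i j (a : 'I_(Q i j)), act M a *m f j = f i *m act N a.

Definition rep_iso (M N : rep) : Prop :=
  exists (f : rmap M N) (g : rmap N M),
    [/\ is_hom f, is_hom g, forall i, f i *m g i = 1%:M
      & forall i, g i *m f i = 1%:M].

Definition rep_zero : rep := @Rep (fun=> 0%N) (fun _ _ _ => 0).

Definition rep_sum (M N : rep) : rep :=
  @Rep (fun i => (rdim M i + rdim N i)%N)
       (fun i j a => block_mx (act M a) 0 0 (act N a)).

Definition indecomposable (M : rep) : Prop :=
  ~ rep_iso M rep_zero /\
  forall N1 N2, rep_iso M (rep_sum N1 N2) ->
    rep_iso N1 rep_zero \/ rep_iso N2 rep_zero.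

(** ** Sums of indecomposable projectives and injectives *)

Definition arrow : finType := {p : 'I_n * 'I_n & 'I_(Q p.1 p.2)}.
Definition mkarrow (i j : 'I_n) (a : 'I_(Q i j)) : arrow :=
  @Tagged _ (i, j) (fun p : 'I_n * 'I_n => 'I_(Q p.1 p.2)) a.

Fixpoint is_path (i : 'I_n) (w : seq arrow) (j : 'I_n) : bool :=
  if w is a :: w' then ((tag a).1 == i) && is_path (tag a).2 w' j
  else i == j.

(* Contains all the paths when Q has no oriented cycle. *)
Definition word : finType := n.-bseq arrow.

(* [psum v] is the sum of the P_(v s): at the vertex l it has as basis the
   pairs of an index s and a path v s -> l.  [isum v] is the sum of the
   I_(v s): at l it has the basis dual to the paths l -> v s. *)
Definition pbasis r (v : 'I_r -> 'I_n) (l : 'I_n) : {set 'I_r * word} :=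
  [set b : 'I_r * word | is_path (v b.1) b.2 l].
Definition ibasis r (v : 'I_r -> 'I_n) (l : 'I_n) : {set 'I_r * word} :=
  [set b : 'I_r * word | is_path l b.2 (v b.1)].

Definition psum r (v : 'I_r -> 'I_n) : rep :=
  @Rep (fun l => #|pbasis v l|)
       (fun i j a => \matrix_(b < #|pbasis v i|, c < #|pbasis v j|)
          let: (s, p) := enum_val b in let: (t, q) := enum_val c in
          ((s == t) && (q == rcons p (mkarrow a) :> seq arrow))%:R).
Definition isum r (v : 'I_r -> 'I_n) : rep :=
  @Rep (fun l => #|ibasis v l|)
       (fun i j a => \matrix_(b < #|ibasis v i|, c < #|ibasis v j|)
          let: (s, p) := enum_val b in let: (t, q) := enum_val c in
          ((s == t) && (p == mkarrow a :: q :> seq arrow))%:R).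

Definition proj_rep (i : 'I_n) : rep := psum (fun _ : 'I_1 => i).

(* The coefficients c s t w (for w a path v' t -> v s) describe a morphism
   from the sum of the P_(v s) to the sum of the P_(v' t); [inj_map c] is its
   image under the Nakayama functor D Hom(-, kQ). *)
Definition proj_map r r' (v : 'I_r -> 'I_n) (v' : 'I_r' -> 'I_n)
    (c : 'I_r -> 'I_r' -> word -> k) : rmap (psum v) (psum v') :=
  fun l => \matrix_(b < #|pbasis v l|, b' < #|pbasis v' l|)
    let: (s, p) := enum_val b in let: (t, q) := enum_val b' in
    \sum_(w : word | is_path (v' t) w (v s) && (q == w ++ p :> seq arrow)) c s t w.
Definition inj_map r r' (v : 'I_r -> 'I_n) (v' : 'I_r' -> 'I_n)
    (c : 'I_r -> 'I_r' -> word -> k) : rmap (isum v) (isum v') :=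
  fun l => \matrix_(b < #|ibasis v l|, b' < #|ibasis v' l|)
    let: (s, p) := enum_val b in let: (t, q) := enum_val b' in
    \sum_(w : word | is_path (v' t) w (v s) && (p == q ++ w :> seq arrow)) c s t w.

(** ** The bounded derived category *)

Record cpx : Type := Cpx {
  cterm : int -> rep;
  diff : forall m : int, rmap (cterm m) (cterm (m + 1)) }.

Definition is_cpx (X : cpx) : Prop :=
  [/\ forall m, is_hom (diff X m),
      forall m i, diff X m i *m diff X (m + 1) i = 0
    & exists b : nat, forall m i, (b < `|m|)%N -> rdim (cterm X m) i = 0%N].

Definition cshift (X : cpx) : cpx :=
  @Cpx (fun m => cterm X (m + 1)) (fun m i => - diff X (m + 1) i).

Definition stalk (M : rep) : cpx :=
  @Cpx (fun m => if m == 0 then M else rep_zero) (fun m i => 0).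

Definition gmap (X Y : cpx) : Type := forall m, rmap (cterm X m) (cterm Y m).

Definition gcomp (X Y Z : cpx) (f : gmap X Y) (g : gmap Y Z) : gmap X Z :=
  fun m i => f m i *m g m i.

Definition is_chain (X Y : cpx) (f : gmap X Y) : Prop :=
  (forall m, is_hom (f m)) /\
  forall m i, diff X m i *m f (m + 1) i = f m i *m diff Y m i.

Definition null_homotopic (X Y : cpx) (f : gmap X Y) : Prop :=
  exists h : forall m, rmap (cterm X (m + 1)) (cterm Y m),
    (forall m, is_hom (h m)) /\
    forall m i, f (m + 1) i =
      diff X (m + 1) i *m h (m + 1) i + h m i *m diff Y m i.

(* A chain map which is injective and surjective on homology. *)
Definition quasi_iso (X Y : cpx) (f : gmap X Y) : Prop :=
  [/\ is_chain f,
      forall m i (x : 'rV_(rdim (cterm X (m + 1)) i))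
                 (y : 'rV_(rdim (cterm Y m) i)),
        x *m diff X (m + 1) i = 0 -> x *m f (m + 1) i = y *m diff Y m i ->
        exists x', x = x' *m diff X m i
    & forall m i (y : 'rV_(rdim (cterm Y (m + 1)) i)),
        y *m diff Y (m + 1) i = 0 ->
        exists (x : 'rV_(rdim (cterm X (m + 1)) i))
               (y' : 'rV_(rdim (cterm Y m) i)),
          x *m diff X (m + 1) i = 0 /\
          y = x *m f (m + 1) i + y' *m diff Y m i].

(* Morphisms X -> Y in D^b(mod kQ) are the classes of roofs X <- X' -> Y
   whose left leg is a quasi-isomorphism.  A roof vanishes when its right leg
   becomes null-homotopic after a quasi-isomorphism X'' -> X', and it is
   invertible when its right leg is a quasi-isomorphism too. *)
Definition db_hom_zero (X Y : cpx) : Prop :=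
  forall (X' : cpx) (s : gmap X' X) (f : gmap X' Y),
    is_cpx X' -> quasi_iso s -> is_chain f ->
    exists (X'' : cpx) (t : gmap X'' X'),
      [/\ is_cpx X'', quasi_iso t & null_homotopic (gcomp t f)].

Definition db_iso (X Y : cpx) : Prop :=
  [/\ is_cpx X, is_cpx Y
    & exists (X' : cpx) (s : gmap X' X) (f : gmap X' Y),
        [/\ is_cpx X', quasi_iso s & quasi_iso f]].

(* Y is isomorphic to the image of X under the Nakayama functor
   nu = D RHom(-, kQ), computed on a bounded complex of projectives
   quasi-isomorphic to X. *)
Definition nakayama (X Y : cpx) : Prop :=
  exists (r : int -> nat) (v : forall m, 'I_(r m) -> 'I_n)
         (c : forall m, 'I_(r m) -> 'I_(r (m + 1)) -> word -> k),
    db_iso X (@Cpx (fun m => psum (v m))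
                   (fun m => proj_map (v m) (v (m + 1)) (c m))) /\
    db_iso Y (@Cpx (fun m => isum (v m))
                   (fun m => inj_map (v m) (v (m + 1)) (c m))).

(* Y is isomorphic to tau X, where tau = nu [-1]. *)
Definition ar_translate (X Y : cpx) : Prop := nakayama X (cshift Y).

(** ** The cluster category *)

(* Y is isomorphic to F X, where F = tau^{-1}[1]. *)
Definition orbit_functor (X Y : cpx) : Prop :=
  exists W, ar_translate W X /\ db_iso Y (cshift W).

Fixpoint orbit_iter (p : nat) (X Y : cpx) : Prop :=
  if p is p'.+1 then exists W, orbit_iter p' X W /\ orbit_functor W Y
  else db_iso X Y.

(* Hom_C(X, Y) is the direct sum of the Hom_D(X, F^p Y) over all p in Z. *)
Definition cluster_hom_zero (X Y : cpx) : Prop :=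
  forall (p : nat) (Z : cpx),
    orbit_iter p Y Z \/ orbit_iter p Z Y -> db_hom_zero X Z.

Definition cluster_ext1_zero (X Y : cpx) : Prop :=
  cluster_hom_zero X (cshift Y).

(* Every indecomposable object of the cluster category is isomorphic to one of
   these, modules being placed in degree 0 and the P_i[1] in degree -1. *)
Inductive cluster_indec : Type :=
| ModObj (V : rep) of indecomposable V
| ShiftedProj of 'I_n.

Definition cluster_obj (T : cluster_indec) : cpx :=
  match T with
  | ModObj V _ => stalk V
  | ShiftedProj i => cshift (stalk (proj_rep i))
  end.

Definition rigid (T : cluster_indec) : Prop :=
  cluster_ext1_zero (cluster_obj T) (cluster_obj T).

(** ** Quiver Grassmannians *)

(* Reduced row echelon form, with pivot columns c: every e-dimensional
   subspace of k^d is the row space of exactly one such matrix. *)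
Definition rref (e d : nat) (A : 'M[k]_(e, d)) : Prop :=
  exists c : 'I_e -> 'I_d,
    [/\ forall i j : 'I_e, (i < j)%N -> (c i < c j)%N,
        forall i j : 'I_e, A i (c j) = (i == j)%:R
      & forall (i : 'I_e) (j : 'I_d), (j < c i)%N -> A i j = 0].

Definition gr_index (d e : 'I_n -> nat) : finType :=
  {i : 'I_n & ('I_(e i) * 'I_(d i))%type}.

Definition gr_mx (d e : 'I_n -> nat) (x : {ffun gr_index d e -> k})
    (i : 'I_n) : 'M[k]_(e i, d i) :=
  \matrix_(a, b) x (@Tagged _ i
    (fun i => ('I_(e i) * 'I_(d i))%type) (a, b)).

(* The points of Gr_e(V), as a constructible subset of an affine space: this
   is the decomposition of the projective variety into Schubert cells, and is
   in piecewise isomorphic bijection with it. *)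
Definition quiver_gr (V : rep) (e : 'I_n -> nat) :
    kset k (gr_index (rdim V) e) :=
  fun x => (forall i, rref (gr_mx x i)) /\
    forall i j (a : 'I_(Q i j)), (gr_mx x i *m act V a <= gr_mx x j)%MS.

End Representations.

Arguments quiver_gr [k n Q] V e x.

(** * The Euler characteristic *)

Section EulerCharacteristic.
Variable k : closedFieldType.

(* First-order definable with parameters, that is (Chevalley, Tarski),
   constructible in the Zariski topology. *)
Definition constructible (I : finType) (X : kset k I) : Prop :=
  exists f : GRing.formula k, forall x, X x <-> GRing.holds (codom x) f.

Definition pairing (I J : finType) (x : {ffun I -> k}) (y : {ffun J -> k}) :
    {ffun I + J -> k} :=
  [ffun t => match t with inl i => x i | inr j => y j end].

Definition kprod (I J : finType) (X : kset k I) (Y : kset k J) :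
    kset k (I + J)%type :=
  fun z => X [ffun i => z (inl i)] /\ Y [ffun j => z (inr j)].

(* G restricts to the graph of a map X -> Y all of whose fibres have exactly
   d points. *)
Definition covering (d : nat) (I J : finType) (X : kset k I) (Y : kset k J)
    (G : kset k (I + J)%type) : Prop :=
  (forall x, X x -> exists! y, Y y /\ G (pairing x y)) /\
  (forall y, Y y -> exists s : seq {ffun I -> k},
     [/\ uniq s, size s = d & forall x, x \in s <-> X x /\ G (pairing x y)]).

(* The Euler characteristic with compact supports (which is the ordinary one
   on projective varieties), as an additive invariant of constructible sets.
   In characteristic 0 these conditions determine chi: by generic etaleness
   over affine space, additivity and [ec_covering] reduce it to chi(G_m^r),
   which vanishes for r > 0 because of the squaring map.  In characteristic p
   they hold for the l-adic Euler characteristic, for all l <> p; coverings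
   are restricted to degrees with p not dividing d! since wild ones (such as
   x |-> x^p - x) are not multiplicative. *)
Record euler_characteristic (chi : forall I : finType, kset k I -> int) : Prop :=
  EulerCharacteristic {
  ec_point : forall (I : finType) (x0 : {ffun I -> k}),
    chi I (fun x => x = x0) = 1;
  ec_line : chi 'I_1 (fun=> True) = 1;
  ec_additive : forall (I : finType) (X Y : kset k I),
    constructible X -> constructible Y -> (forall x, X x -> ~ Y x) ->
    chi I (fun x => X x \/ Y x) = chi I X + chi I Y;
  ec_product : forall (I J : finType) (X : kset k I) (Y : kset k J),
    constructible X -> constructible Y ->
    chi (I + J)%type (kprod X Y) = chi I X * chi J Y;
  ec_covering : forall (d : nat) (I J : finType) (X : kset k I) (Y : kset k J)
      (G : kset k (I + J)%type),
    constructible X -> constructible Y -> constructible G ->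
    (d`!)%:R != 0 :> k -> covering d X Y G ->
    chi I X = d%:Z * chi J Y }.

End EulerCharacteristic.

(** * The cluster character with coefficients *)

Section ClusterCharacter.
Variables (k : closedFieldType) (n : nat) (Q : quiver n).
Variable chi : forall I : finType, kset k I -> int.

Definition euler_form (d e : 'I_n -> int) : int :=
  \sum_(i < n) d i * e i - \sum_(i < n) \sum_(j < n) (Q i j)%:Z * d i * e j.

Definition alpha (r : 'I_n) : 'I_n -> int := fun i => (i == r)%:Z.

Definition mod_character (V : rep k Q) : ratfun n :=
  let d := rdim V in
  \sum_(e : {dffun forall i : 'I_n, 'I_(d i).+1})
    (chi (quiver_gr V (fun i => e i)))%:~R *
    \prod_(r < n)
      (init_var (xv r) ^
         (- euler_form (fun i => (e i)%:Z) (alpha r)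
          - euler_form (alpha r) (fun i => (d i)%:Z - (e i)%:Z))
       * init_var (yv r) ^+ e r
       * init_var (zv r) ^+ (d r - e r)).

Definition cluster_character (T : cluster_indec k Q) : ratfun n :=
  match T with
  | ModObj V _ => mod_character V
  | ShiftedProj i => init_var (xv i)
  end.

End ClusterCharacter.

(* Main.v *)
Require Import Defs.
From mathcomp Require Import all_boot all_order all_algebra.
From mathcomp Require Import mpoly.
From mathcomp Require Import zify ring.
From Stdlib Require Import FunctionalExtensionality PropExtensionality.

(** The representation [V] is carried to a simple one by Bernstein-Gelfand-
    Ponomarev reflections while the seed is mutated at the same vertices; a
    quantity attached to the pair of the seed and the representation stays
    constant along the way.  It starts as the cluster character of [V] and ends
    as a cluster variable.

    Let u be the variables of a seed and b(s,v) its signed number of arrows from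
    s to v.  For a representation V supported on a set K of non-frozen vertices
    the quantity is u^H F_V(yhat), where F_V(y) is the sum over e of
    chi(Gr_e V) y^e, and yhat_s is the product of the u_v^b(s,v).  The vertices
    outside K count as frozen, even those that can be mutated: the exponent H_v
    of such a vertex is minus the minimum of the sum of the e_s b(s,v) over the
    dimension vectors e of the subrepresentations of V.  On K the exponents are
    those of the Caldero-Chapoton formula ([is_exponent]).  At the biframed seed
    these minima are known because the quiver has no oriented cycle: the
    vertices of small height carry a subrepresentation
    ([initial_is_exponent]), and u^H F_V(yhat) is the cluster character
    ([character_term]).

    Take a vertex i of K without arrows to K.  Since the only idempotent
    endomorphisms of V are 0 and 1, either V is the simple module at i, and
    mutating at i produces u^H F_V(yhat) ([monomial_base], [fpoly_simple]); or
    the map phi from the sum of the V_s, over the arrows s -> i, to V_i is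
    onto ([sink_dichotomy]), and V has a reflection V' with V'_i = ker phi,
    which has no other idempotent endomorphisms either.  Then
    u^H F_V(yhat) does not change when V is replaced by V' and the seed
    is mutated at i ([value_reflect]).  The heart of the matter is
      F_V(y) = (1 + y_i)^d_i F_V'(y'),
      y'_i = 1/y_i,  y'_s = y_s / (1 + 1/y_i) for an arrow s -> i
    ([fpoly_reflect]).  To see it, fix the components W_s, s <> i, of a
    subrepresentation.  In V the component W_i is any subspace of V_i that
    contains phi(W); in V' it is any subspace of the intersection of ker phi
    with the sum of the W_s.  If phi(W) has dimension r and the sum has
    dimension w, summing binomial coefficients gives y_i^r (1+y_i)^(d_i-r) in
    the first case and (1+1/y_i)^(w-r) in the second, and the ratio does not
    depend on r.  The same description of the subrepresentations shows that the
    minima defining H change as the mutation of the variables requires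
    ([is_min_on_reflect], [exponent_reflect]).

    The Euler characteristic is only known through its axioms, so the fibres
    above must be compared with a fixed Grassmannian explicitly.  The space in
    which W_i moves (in V, the space in which its orthogonal moves) has a reduced
    echelon basis, and expressing W_i or its orthogonal in this basis is a
    bijection with a constructible graph from the pairs (W, W_i) to the pairs
    (W, point of a fixed Grassmannian) ([chi_fibred], [chi_sink],
    [chi_reflected]).

    The process stops ([is_seed_value]).  In Dynkin type there is a positive
    vector y on which the Cartan matrix is positive; a reflection at i lowers
    the Euler form <y, d> of the current orientation by at least d_i
    ([pairing_form_reflect]).  It cannot decrease for ever: the Tits form of d
    does not change and, again by the existence of y, it is positive definite
    and bounds d ([tits_bound]).  No exchange relation divides by zero because
    all the variables are quotients of polynomials that are positive at
    (1,...,1). *)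

Set Implicit Arguments.
Unset Strict Implicit.
Unset Printing Implicit Defensive.
Import Order.TTheory GRing.Theory Num.Theory.
Local Open Scope ring_scope.

(** * Constructible sets and definable matrices *)

Section Renaming.
Variable k : unitRingType.
Implicit Types (e : seq k) (s : nat -> nat).

Fixpoint trename s (t : GRing.term k) : GRing.term k :=
  match t with
  | GRing.Var i => GRing.Var k (s i)
  | GRing.Const _ | GRing.NatConst _ => t
  | GRing.Add t1 t2 => GRing.Add (trename s t1) (trename s t2)
  | GRing.Opp t1 => GRing.Opp (trename s t1)
  | GRing.NatMul t1 n => GRing.NatMul (trename s t1) n
  | GRing.Mul t1 t2 => GRing.Mul (trename s t1) (trename s t2)
  | GRing.Inv t1 => GRing.Inv (trename s t1)
  | GRing.Exp t1 n => GRing.Exp (trename s t1) n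
  end.

Fixpoint frename s (f : GRing.formula k) : GRing.formula k :=
  match f with
  | GRing.Bool _ => f
  | GRing.Equal t1 t2 => GRing.Equal (trename s t1) (trename s t2)
  | GRing.Unit t1 => GRing.Unit (trename s t1)
  | GRing.And f1 f2 => GRing.And (frename s f1) (frename s f2)
  | GRing.Or f1 f2 => GRing.Or (frename s f1) (frename s f2)
  | GRing.Implies f1 f2 => GRing.Implies (frename s f1) (frename s f2)
  | GRing.Not f1 => GRing.Not (frename s f1)
  | GRing.Exists i f1 => GRing.Exists (s i) (frename s f1)
  | GRing.Forall i f1 => GRing.Forall (s i) (frename s f1)
  end.

Definition env_along s e' e := forall i, nth 0 e' i = nth 0 e (s i).

Lemma eval_trename s e' e t : env_along s e' e ->
  GRing.eval e (trename s t) = GRing.eval e' t.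
Proof. by move=> he; elim: t => //= [t1 -> t2 ->|t ->|t -> ?|t1 -> t2 ->|t ->|t -> ?]. Qed.

(** Injectivity of [s] keeps a renamed quantifier from capturing another
    variable. *)
Lemma holds_frename s e' e f : injective s -> env_along s e' e ->
  GRing.holds e (frename s f) <-> GRing.holds e' f.
Proof.
move=> s_inj; elim: f e' e => //=.
- by move=> t1 t2 e' e he; rewrite !(eval_trename _ he).
- by move=> t e' e he; rewrite (eval_trename _ he).
- by move=> f1 IH1 f2 IH2 e' e he; have := IH1 _ _ he; have := IH2 _ _ he; tauto.
- by move=> f1 IH1 f2 IH2 e' e he; have := IH1 _ _ he; have := IH2 _ _ he; tauto.
- by move=> f1 IH1 f2 IH2 e' e he; have := IH1 _ _ he; have := IH2 _ _ he; tauto.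
- by move=> f IH e' e he; have := IH _ _ he; tauto.
- move=> i f IH e' e he.
  have he2 x : env_along s (set_nth 0 e' i x) (set_nth 0 e (s i) x).
    by move=> j; rewrite !nth_set_nth /= (inj_eq s_inj) he.
  by split=> -[x /(IH _ _ (he2 x)) hx]; exists x.
- move=> i f IH e' e he.
  have he2 x : env_along s (set_nth 0 e' i x) (set_nth 0 e (s i) x).
    by move=> j; rewrite !nth_set_nth /= (inj_eq s_inj) he.
  by split=> hx x; apply/(IH _ _ (he2 x)); apply: hx.
Qed.

Lemma set_nth_size e x : set_nth 0 e (size e) x = rcons e x.
Proof. by elim: e => //= y e ->. Qed.

(** Fresh variables are numbered from the length of the environment on, so that
    quantifying them one by one appends their values. *)
Lemma holds_foldExists e f m :
  GRing.holds e (foldr GRing.Exists f (iota (size e) m)) <->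
  exists s : seq k, size s = m /\ GRing.holds (e ++ s) f.
Proof.
elim: m e => [|m IH] e /=.
  split=> [h|[s [/size0nil ->]]]; last by rewrite cats0.
  by exists [::]; rewrite cats0.
split=> [[x]|[[|x s] [] // [hs] h]].
  rewrite -[X in set_nth _ _ X]/(size e) set_nth_size -(size_rcons e x).
  by move/IH=> [s [hs h]]; exists (x :: s); rewrite /= hs -cat_rcons.
exists x; rewrite set_nth_size -(size_rcons e x); apply/IH.
by exists s; rewrite hs cat_rcons.
Qed.

End Renaming.

Section Definability.
Variable k : closedFieldType.
Implicit Types I J : finType.

Definition restr I J (p : J -> I) (x : {ffun I -> k}) : {ffun J -> k} :=
  [ffun j => x (p j)].

Lemma nth_codom_rank I (x : {ffun I -> k}) i :
  nth 0 (codom x) (enum_rank i) = x i.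
Proof. by rewrite (nth_map i) ?nth_enum_rank // -cardE. Qed.

(** The indices beyond [#|J|] are sent beyond [#|I|], where environments read 0
    on both sides; this makes the renaming injective on all of [nat]. *)
Definition rename_idx I J (p : J -> I) (i : nat) : nat :=
  if @idP (i < #|J|)%N is ReflectT h then enum_rank (p (enum_val (Ordinal h)))
  else (#|I| + i)%N.

Lemma rename_idx_inj I J (p : J -> I) : injective p -> injective (rename_idx p).
Proof.
move=> p_inj i j; rewrite /rename_idx.
case: {-}_ / idP => hi; case: {-}_ / idP => hj.
- by move/ord_inj/enum_rank_inj/p_inj/enum_val_inj => [].
- move=> h; have := ltn_ord (enum_rank (p (enum_val (Ordinal hi)))).
  by rewrite [X in (X < _)%N]h ltnNge leq_addr.
- move=> h; have := ltn_ord (enum_rank (p (enum_val (Ordinal hj)))).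
  by rewrite [X in (X < _)%N](esym h) ltnNge leq_addr.
by move/addnI.
Qed.

Lemma rename_idx_env I J (p : J -> I) (x : {ffun I -> k}) :
  env_along (rename_idx p) (codom (restr p x)) (codom x).
Proof.
move=> i; rewrite /rename_idx; case: {-}_ / idP => hi.
  rewrite nth_codom_rank -[X in nth _ _ X]/(val (Ordinal hi)).
  by rewrite -{1}[Ordinal hi]enum_valK nth_codom_rank ffunE.
by rewrite !nth_default // size_codom // ?leq_addr // leqNgt; apply/negP.
Qed.

Lemma constructible_ext I (P P' : kset k I) :
  (forall x, P x <-> P' x) -> constructible P -> constructible P'.
Proof. by move=> h [f hf]; exists f => x; rewrite -h. Qed.

Lemma constructible_restr_inj I J (p : J -> I) (P : kset k J) :
  injective p -> constructible P -> constructible (fun x => P (restr p x)).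
Proof.
move=> p_inj [f hf]; exists (frename (rename_idx p) f) => x.
by rewrite hf; split=> /(holds_frename f (rename_idx_inj p_inj) (rename_idx_env p x)).
Qed.

Lemma constructible_and I (P P' : kset k I) :
  constructible P -> constructible P' -> constructible (fun x => P x /\ P' x).
Proof. by move=> [f hf] [g hg]; exists (GRing.And f g) => x; rewrite /= hf hg. Qed.

Lemma constructible_or I (P P' : kset k I) :
  constructible P -> constructible P' -> constructible (fun x => P x \/ P' x).
Proof. by move=> [f hf] [g hg]; exists (GRing.Or f g) => x; rewrite /= hf hg. Qed.

Lemma constructible_const I (P : Prop) :
  decidable P -> constructible (fun _ : {ffun I -> k} => P).
Proof. by case=> h; [exists (GRing.Bool true)|exists (GRing.Bool false)] => x; split. Qed.

Lemma constructible_implies I (b : bool) (P : kset k I) :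
  constructible P -> constructible (fun x => b -> P x).
Proof.
case: b => h; first by apply: constructible_ext h => x; split=> //; apply.
by exists (GRing.Bool true).
Qed.

Lemma constructible_forall I (T : finType) (P : T -> kset k I) :
  (forall t, constructible (P t)) -> constructible (fun x => forall t, P t x).
Proof.
move=> h.
have: constructible (fun x => forall t, t \in enum T -> P t x).
  elim: (enum T) => [|a s IH]; first by exists (GRing.Bool true).
  apply: constructible_ext (constructible_and (h a) IH) => x; split.
    by case=> ha hs t; rewrite inE => /predU1P[->|/hs].
  by move=> hs; split=> [|t ht]; apply: hs; rewrite inE ?eqxx ?ht ?orbT.
by apply: constructible_ext => x; split=> hx t; [apply: hx; rewrite mem_enum|].
Qed.

Lemma constructible_exists I (T : finType) (P : T -> kset k I) :
  (forall t, constructible (P t)) -> constructible (fun x => exists t, P t x).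
Proof.
move=> h.
have: constructible (fun x => exists t, t \in enum T /\ P t x).
  elim: (enum T) => [|a s IH].
    by exists (GRing.Bool false) => x; split=> // -[? []].
  apply: constructible_ext (constructible_or (h a) IH) => x; split.
    by case=> [ha|[t [ht ?]]]; [exists a|exists t]; rewrite inE ?eqxx ?ht ?orbT.
  by case=> t; rewrite inE => -[/predU1P[->|]]; [left|right; exists t].
apply: constructible_ext => x; split=> [[t []]|[t]]; exists t => //.
by rewrite mem_enum.
Qed.

Lemma pairing_inl I J (x : {ffun I -> k}) (y : {ffun J -> k}) :
  restr inl (pairing x y) = x.
Proof. by apply/ffunP=> i; rewrite !ffunE. Qed.

Lemma pairing_inr I J (x : {ffun I -> k}) (y : {ffun J -> k}) :
  restr inr (pairing x y) = y.
Proof. by apply/ffunP=> i; rewrite !ffunE. Qed.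

Lemma pairing_eta I J (z : {ffun I + J -> k}) :
  pairing (restr inl z) (restr inr z) = z.
Proof. by apply/ffunP=> -[i|i]; rewrite !ffunE. Qed.

(** The enumeration of [I + J] need not list [I] before [J]; this is the index
    in the concatenation of an environment on [I] and one on [J]. *)
Definition sum_idx I J (i : nat) : nat :=
  if @idP (i < #|{: I + J}|)%N is ReflectT h then
    match enum_val (Ordinal h) with
    | inl a => enum_rank a
    | inr b => (#|I| + enum_rank b)%N
    end
  else i.

(** Images under projections are constructible for free, since formulas may
    contain quantifiers: no quantifier elimination is involved. *)
Lemma constructible_ex I J (P : kset k (I + J)%type) :
  constructible P ->
  constructible (fun x => exists y : {ffun J -> k}, P (pairing x y)).
Proof.
move=> [f hf].
have s_inj : injective (@sum_idx I J).
  move=> i j; rewrite /sum_idx.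
  have lt (a : I + J) : (match a with inl a => nat_of_ord (enum_rank a)
      | inr b => #|I| + enum_rank b end < #|{: I + J}|)%N.
    rewrite card_sum; case: a => a; last by rewrite ltn_add2l ltn_ord.
    by rewrite ltn_addr // ltn_ord.
  case: {-}_ / idP => hi; case: {-}_ / idP => hj.
  - move=> h; have /enum_val_inj[//] : enum_val (Ordinal hi) = enum_val (Ordinal hj).
    case: (enum_val _) h => a; case: (enum_val _) => b.
    + by move/ord_inj/enum_rank_inj->.
    + by move=> h; have := ltn_ord (enum_rank a); rewrite [X in (X < _)%N]h ltnNge leq_addr.
    + move=> h; have := ltn_ord (enum_rank b).
      by rewrite [X in (X < _)%N](esym h) ltnNge leq_addr.
    + by move/addnI/ord_inj/enum_rank_inj->.
  - by move=> h; have := lt (enum_val (Ordinal hi)); rewrite h => /hj.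
  - by move=> h; have := lt (enum_val (Ordinal hj)); rewrite -h => /hi.
  - by [].
have s_env (x : {ffun I -> k}) (y : {ffun J -> k}) :
    env_along (@sum_idx I J) (codom (pairing x y)) (codom x ++ codom y).
  move=> i; rewrite /sum_idx; case: {-}_ / idP => hi.
    rewrite -[X in nth _ _ X]/(val (Ordinal hi)) -[Ordinal hi]enum_valK.
    rewrite nth_codom_rank enum_valK ffunE.
    case: (enum_val _) => a; rewrite nth_cat size_codom.
      by rewrite ltn_ord nth_codom_rank.
    by rewrite ltnNge leq_addr /= addKn nth_codom_rank.
  have {}hi : (#|{: I + J}| <= i)%N by rewrite leqNgt; apply/negP.
  by rewrite !nth_default // ?size_cat ?size_codom // -card_sum.
exists (foldr GRing.Exists (frename (@sum_idx I J) f) (iota #|I| #|J|)) => x.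
rewrite -{1}(size_codom x) holds_foldExists; split.
  case=> y /hf h; exists (codom y); rewrite size_codom; split=> //.
  exact/(holds_frename _ s_inj (s_env x y)).
case=> s [hs h]; pose y : {ffun J -> k} := [ffun j => nth 0 s (enum_rank j)].
have ys : codom y = s.
  apply: (@eq_from_nth _ 0); rewrite size_codom // => i hi.
  rewrite -[i]/(val (Ordinal hi)) -[Ordinal hi]enum_valK nth_codom_rank ffunE.
  by rewrite enum_valK.
exists y; apply/hf/(holds_frename _ s_inj (s_env x y)); by rewrite ys.
Qed.

Lemma constructible_True I : constructible (fun _ : {ffun I -> k} => True).
Proof. by exists (GRing.Bool true). Qed.

(** A syntactic substitute for polynomial functions: equations between such
    functions are atomic formulas. *)
Definition termable I (f : {ffun I -> k} -> k) : Prop :=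
  exists t : GRing.term k, forall x, f x = GRing.eval (codom x) t.

Lemma termable_var I (i : I) : termable (fun x => x i).
Proof. by exists (GRing.Var k (enum_rank i)) => x /=; rewrite nth_codom_rank. Qed.

Lemma termable_const I (c : k) : termable (fun _ : {ffun I -> k} => c).
Proof. by exists (GRing.Const c). Qed.

Lemma termable_add I (f g : {ffun I -> k} -> k) :
  termable f -> termable g -> termable (fun x => f x + g x).
Proof. by move=> [s hs] [t ht]; exists (GRing.Add s t) => x /=; rewrite hs ht. Qed.

Lemma termable_mul I (f g : {ffun I -> k} -> k) :
  termable f -> termable g -> termable (fun x => f x * g x).
Proof. by move=> [s hs] [t ht]; exists (GRing.Mul s t) => x /=; rewrite hs ht. Qed.

Lemma termable_ext I (f g : {ffun I -> k} -> k) :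
  f =1 g -> termable f -> termable g.
Proof. by move=> h [t ht]; exists t => x; rewrite -h. Qed.

Lemma termable_sum I (T : finType) (P : pred T) (f : T -> {ffun I -> k} -> k) :
  (forall t, termable (f t)) -> termable (fun x => \sum_(t | P t) f t x).
Proof.
move=> h; rewrite /index_enum; elim: (Finite.enum T) => [|a s IH].
  by apply: termable_ext (termable_const _ 0) => x; rewrite big_nil.
case hP: (P a); last first.
  by apply: termable_ext IH => x; rewrite big_cons hP.
by apply: termable_ext (termable_add (h a) IH) => x; rewrite big_cons hP.
Qed.

Lemma termable_restr I J (p : J -> I) (f : {ffun J -> k} -> k) :
  termable f -> termable (fun x => f (restr p x)).
Proof.
move=> [t ht].
exists (trename (rename_idx p) t) => x.
by rewrite ht (eval_trename _ (rename_idx_env p x)).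
Qed.

Lemma constructible_eq I (f g : {ffun I -> k} -> k) :
  termable f -> termable g -> constructible (fun x => f x = g x).
Proof. by move=> [s hs] [t ht]; exists (GRing.Equal s t) => x /=; rewrite hs ht. Qed.

Definition mxtermable I a b (A : {ffun I -> k} -> 'M[k]_(a, b)) : Prop :=
  forall i j, termable (fun x => A x i j).

Lemma mxtermable_const I a b (A : 'M[k]_(a, b)) :
  mxtermable (fun _ : {ffun I -> k} => A).
Proof. by move=> i j; apply: termable_const. Qed.

Lemma mxtermable_mul I a b c (A : {ffun I -> k} -> 'M[k]_(a, b))
    (B : {ffun I -> k} -> 'M[k]_(b, c)) :
  mxtermable A -> mxtermable B -> mxtermable (fun x => A x *m B x).
Proof.
move=> hA hB i j.
have: termable (fun x => \sum_l A x i l * B x l j).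
  by apply: termable_sum => l; apply: termable_mul.
by apply: termable_ext => x; rewrite mxE.
Qed.

Lemma mxtermable_tr I a b (A : {ffun I -> k} -> 'M[k]_(a, b)) :
  mxtermable A -> mxtermable (fun x => (A x)^T).
Proof. by move=> hA i j; apply: termable_ext (hA j i) => x; rewrite mxE. Qed.

Lemma mxtermable_restr I J (p : J -> I) a b (A : {ffun J -> k} -> 'M[k]_(a, b)) :
  mxtermable A -> mxtermable (fun x => A (restr p x)).
Proof. by move=> hA i j; exact: (termable_restr p (hA i j)). Qed.

Lemma constructible_eqmx I a b (A B : {ffun I -> k} -> 'M[k]_(a, b)) :
  mxtermable A -> mxtermable B -> constructible (fun x => A x = B x).
Proof.
move=> hA hB.
have: constructible (fun x => forall i j, A x i j = B x i j).
  by do 2!apply: constructible_forall => ?; apply: constructible_eq.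
by apply: constructible_ext => x; split=> [h|-> //]; apply/matrixP.
Qed.

Definition mx_idx (a b : nat) : finType := ('I_a * 'I_b)%type.
Definition mx_of a b (x : {ffun mx_idx a b -> k}) : 'M[k]_(a, b) :=
  \matrix_(i, j) x (i, j).
Definition of_mx a b (A : 'M[k]_(a, b)) : {ffun mx_idx a b -> k} :=
  [ffun p => A p.1 p.2].

Lemma of_mxK a b (A : 'M[k]_(a, b)) : mx_of (of_mx A) = A.
Proof. by apply/matrixP=> i j; rewrite mxE ffunE. Qed.
Lemma mx_ofK a b (x : {ffun mx_idx a b -> k}) : of_mx (mx_of x) = x.
Proof. by apply/ffunP=> -[i j]; rewrite ffunE mxE. Qed.

Lemma mxtermable_mx_of a b : mxtermable (@mx_of a b).
Proof. by move=> i j; apply: termable_ext (termable_var (i, j)) => x; rewrite mxE. Qed.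

Lemma constructible_exmx I a b (P : {ffun I -> k} -> 'M[k]_(a, b) -> Prop) :
  constructible (fun z : {ffun I + mx_idx a b -> k} =>
    P (restr inl z) (mx_of (restr inr z))) ->
  constructible (fun x => exists A, P x A).
Proof.
move/constructible_ex; apply: constructible_ext => x; split.
  by case=> y; rewrite pairing_inl pairing_inr; exists (mx_of y).
by case=> A h; exists (of_mx A); rewrite pairing_inl pairing_inr of_mxK.
Qed.

Lemma constructible_submx I a b c (A : {ffun I -> k} -> 'M[k]_(a, c))
    (B : {ffun I -> k} -> 'M[k]_(b, c)) :
  mxtermable A -> mxtermable B -> constructible (fun x => (A x <= B x)%MS).
Proof.
move=> hA hB.
have: constructible (fun x => exists D : 'M_(a, b), A x = D *m B x).
  apply: constructible_exmx; apply: constructible_eqmx.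
    exact: (mxtermable_restr inl hA).
  apply: mxtermable_mul; first exact: (mxtermable_restr inr (@mxtermable_mx_of _ _)).
  exact: (mxtermable_restr inl hB).
by apply: constructible_ext => x; split=> /submxP.
Qed.

Lemma constructible_eqMS I a b c (A : {ffun I -> k} -> 'M[k]_(a, c))
    (B : {ffun I -> k} -> 'M[k]_(b, c)) :
  mxtermable A -> mxtermable B -> constructible (fun x => (A x == B x)%MS : Prop).
Proof.
move=> hA hB.
have := constructible_and (constructible_submx hA hB) (constructible_submx hB hA).
by apply: constructible_ext => x; split=> /andP.
Qed.

End Definability.

(** * Reduced row echelon forms *)

Section Rref.
Variable k : closedFieldType.

Definition pivots e d (A : 'M[k]_(e, d)) (c : 'I_e -> 'I_d) : Prop :=
  [/\ forall i j : 'I_e, (i < j)%N -> (c i < c j)%N,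
      forall i j : 'I_e, A i (c j) = (i == j)%:R
    & forall (i : 'I_e) (j : 'I_d), (j < c i)%N -> A i j = 0].

Lemma mul_pivots e d m (A : 'M[k]_(e, d)) c (D : 'M_(m, e)) :
  pivots A c -> forall i j, (D *m A) i (c j) = D i j.
Proof.
move=> [_ hA _] i j; rewrite mxE (bigD1 j) //= hA eqxx mulr1 big1 ?addr0 //.
by move=> l lj; rewrite hA (negPf lj) mulr0.
Qed.

Lemma rref_row_free e d (A : 'M[k]_(e, d)) : rref A -> row_free A.
Proof.
case=> c hc; apply/row_freeP; exists (\matrix_(i, j) (i == c j)%:R).
apply/matrixP=> i j; rewrite !mxE (bigD1 (c j)) //= mxE eqxx mulr1 big1.
  by rewrite addr0 (let: And3 _ h _ := hc in h).
by move=> l lj; rewrite mxE (negPf lj) mulr0.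
Qed.

Lemma rref_rank e d (A : 'M[k]_(e, d)) : rref A -> \rank A = e.
Proof. by move/rref_row_free/eqP. Qed.

Lemma increasing_unique e d (c c' : 'I_e -> 'I_d) :
  (forall i j : 'I_e, (i < j)%N -> (c i < c j)%N) ->
  (forall i j : 'I_e, (i < j)%N -> (c' i < c' j)%N) ->
  (forall i, exists j, c i = c' j) -> c =1 c'.
Proof.
have srt (c0 : 'I_e -> 'I_d) : (forall i j : 'I_e, (i < j)%N -> (c0 i < c0 j)%N) ->
    sorted ltn [seq val (c0 i) | i <- enum 'I_e].
  move=> h; rewrite sorted_map.
  have := iota_ltn_sorted 0 e; rewrite -val_enum_ord sorted_map.
  by apply: sub_sorted => i j /h.
move=> hc hc' hsub.
have sub : {subset [seq val (c i) | i <- enum 'I_e] <= [seq val (c' i) | i <- enum 'I_e]}.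
  move=> _ /mapP[i _ ->]; have [j ->] := hsub i.
  by apply/mapP; exists j; rewrite ?mem_enum.
have uniqs (c0 : 'I_e -> 'I_d) : sorted ltn [seq val (c0 i) | i <- enum 'I_e] ->
    uniq [seq val (c0 i) | i <- enum 'I_e].
  by apply: sorted_uniq; [exact: ltn_trans|exact: ltnn].
have [|_ eqm] := uniq_min_size (uniqs c (srt _ hc)) sub.
  by rewrite !size_map.
have /eq_in_map h : [seq val (c i) | i <- enum 'I_e] = [seq val (c' i) | i <- enum 'I_e].
  by apply: (irr_sorted_eq ltn_trans ltnn) => //; exact: srt.
by move=> i; apply: val_inj; apply: h; rewrite mem_enum.
Qed.

(** The pivots of an echelon form are the positions of the leading entries of the
    vectors of its row space, so nested spaces of the same dimension have the
    same pivots; the coefficients expressing the rows of [A] in those of [B] can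
    then be read in the pivot columns. *)
Lemma rref_unique e d (A B : 'M[k]_(e, d)) :
  rref A -> rref B -> (A <= B)%MS -> A = B.
Proof.
move=> [c hc] [c' hc'] /submxP[D AD].
have [[ic Ac zc] [ic' Bc zc']] := (hc, hc').
have cc' : c =1 c'.
  apply: increasing_unique => // i.
  have /rV0Pn[j0 hj0] : row i D != 0.
    apply/eqP=> D0; have := Ac i i; rewrite AD mxE eqxx big1 ?(eqxx, negPf (oner_neq0 _)) //.
      by move/esym/eqP; rewrite oner_eq0.
    by move=> l _; have /rowP/(_ l) := D0; rewrite !mxE => ->; rewrite mul0r.
  case: (@arg_minnP _ j0 (fun j => D i j != 0) val) => [|j Dj jmin].
    by move: hj0; rewrite mxE.
  exists j; apply: val_inj; apply/eqP; rewrite eqn_leq; apply/andP; split.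
    rewrite leqNgt; apply/negP=> /zc; rewrite AD (mul_pivots _ hc') => /eqP.
    exact/negP.
  rewrite leqNgt; apply/negP=> lt.
  have := Ac i i; rewrite eqxx AD mxE big1 => [/esym/eqP|l _]; first by rewrite oner_eq0.
  have [Dl|Dl] := eqVneq (D i l) 0; first by rewrite Dl mul0r.
  rewrite zc' ?mulr0 // (leq_trans lt) //.
  by move: (jmin _ Dl); rewrite leq_eqVlt => /predU1P[/val_inj ->//|/ic'/ltnW].
rewrite AD; suff -> : D = 1%:M by rewrite mul1mx.
apply/matrixP=> i j; rewrite -(mul_pivots D hc') -AD -cc' Ac mxE.
by [].
Qed.

(** Induction on the columns.  If the first column is not zero, a row [v] with
    leading entry 1 clears it, and the echelon form of the remaining columns
    clears [v] at its own pivots. *)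
Lemma rref_exists_size d m (A : 'M[k]_(m, d)) :
  exists e (R : 'M[k]_(e, d)), rref R /\ (R == A)%MS.
Proof.
elim: d m A => [|d IH] m A.
  exists 0%N, 0; split; first by exists (fun i : 'I_0 => i); split; case.
  by rewrite [A]thinmx0 !sub0mx.
rewrite -[d.+1]/(1 + d)%N in A *.
have [a0|a0] := eqVneq (lsubmx A) 0.
  have [e [R [[c [ic Rc zc]] RA]]] := IH _ (rsubmx A).
  exists e, (row_mx 0 R); split.
    exists (fun i => rshift 1 (c i)); split=> [i j /ic|i j|i j].
    - by rewrite /= ltn_add2l.
    - by rewrite row_mxEr.
    by rewrite mxE; case: splitP => l -> /=; rewrite ?mxE // ltn_add2l => /zc.
  rewrite -[A]hsubmxK a0; case/andP: RA => /submxP[D1 h1] /submxP[D2 h2].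
  apply/andP; split; apply/submxP.
    by exists D1; rewrite mul_mx_row mulmx0 -h1.
  by exists D2; rewrite mul_mx_row mulmx0 -h2.
have [p hp] : exists p, A p 0 != 0.
  case: (pickP (fun p => A p 0 != 0)) => [p hp|h]; first by exists p.
  case/eqP: a0; apply/matrixP=> i j; rewrite !mxE (ord1 j).
  have /negbFE/eqP := h i; rewrite (_ : lshift d 0 = 0) //; exact: val_inj.
(* the new first row, before it is cleared at the other pivots *)
pose v := (A p 0)^-1 *: row p A.
have vA : (v <= A)%MS by rewrite scalemx_sub // row_sub.
have lv : lsubmx v = 1%:M.
  apply/matrixP=> i j; rewrite !ord1 !mxE (_ : lshift d 0 = 0) ?mulVf //; exact: val_inj.
pose A' := A - lsubmx A *m v.
have lA' : lsubmx A' = 0.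
  by rewrite /A' linearB /= -mulmx_lsub lv mulmx1 subrr.
have [e [R [[c hc] RA]]] := IH _ (rsubmx A').
pose w := rsubmx v; pose w' := w - (\row_j w 0 (c j)) *m R.
(* [w'] is the rest of the first row, cleared at the pivots [c] *)
have w'c j : w' 0 (c j) = 0.
  by rewrite [LHS]mxE [X in _ + X]mxE (mul_pivots _ hc) [X in _ - X]mxE subrr.
have [ic Rc zc] := hc.
exists (1 + e)%N, (block_mx 1%:M w' 0 R); split.
  exists (fun i => match split i with inl _ => lshift d 0 | inr i' => rshift 1 (c i') end).
  split=> [i j|i j|i j].
  - case: (splitP i) => i' ->; case: (splitP j) => j' -> //=.
    + by rewrite (ord1 i') (ord1 j').
    + by rewrite (ord1 j').
    + by rewrite !ltn_add2l => /ic.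
  - case: (split_ordP i) => i' ->; case: (split_ordP j) => j' ->.
    + by rewrite block_mxEul !mxE !ord1 !eqxx.
    + by rewrite block_mxEur (ord1 i') w'c eq_lrshift.
    + by rewrite block_mxEdl mxE eq_rlshift.
    + by rewrite block_mxEdr Rc (inj_eq (@rshift_inj _ _)).
  - case: (split_ordP i) => i' -> //.
    case: (split_ordP j) => j' ->; first by rewrite block_mxEdl mxE.
    by rewrite block_mxEdr /= ltn_add2l => /zc.
have eA : (A == col_mx v A')%MS.
  apply/andP; split.
    rewrite -[X in (X <= _)%MS](subrK (lsubmx A *m v)) -/A'.
    by rewrite addmx_sub // ?mulmx_sub // -addsmxE ?addsmxSl ?addsmxSr.
  by rewrite col_mx_sub vA /A' addmx_sub // eqmx_opp mulmx_sub.
case/andP: RA => /submxP[D1 h1] /submxP[D2 h2].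
have eA' : col_mx v A' = block_mx 1%:M w 0 (rsubmx A').
  by rewrite /block_mx -lv hsubmxK -lA' hsubmxK.
apply/andP; split; rewrite (eqmxP eA) eA'; apply/submxP.
  exists (block_mx 1%:M (- (\row_j w 0 (c j)) *m D1) 0 D1).
  rewrite mulmx_block !mul1mx !mul0mx !mulmx0 !addr0 add0r.
  by rewrite -mulmxA -h1 mulNmx.
exists (block_mx 1%:M (\row_j w 0 (c j)) 0 D2).
rewrite mulmx_block !mul1mx !mul0mx !mulmx0 !addr0 add0r.
by rewrite -h2 subrK.
Qed.

Lemma rref_exists e d m (A : 'M[k]_(m, d)) : \rank A = e ->
  exists R : 'M[k]_(e, d), rref R /\ (R == A)%MS.
Proof.
move=> rA; have [e' [R [hR RA]]] := rref_exists_size A.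
have ee : e' = e by rewrite -rA -(eqmxP RA) rref_rank.
by subst e'; exists R.
Qed.

End Rref.

(** * The Euler characteristic of Grassmannians *)

Section Rref.
Variable k : closedFieldType.

Lemma constructible_rref (I : finType) e d (A : {ffun I -> k} -> 'M[k]_(e, d)) :
  mxtermable A -> constructible (fun x => rref (A x)).
Proof.
move=> hA.
have: constructible (fun x => exists c : {ffun 'I_e -> 'I_d},
    (forall i j : 'I_e, (i < j)%N -> (c i < c j)%N) /\
    ((forall i j : 'I_e, A x i (c j) = (i == j)%:R) /\
    (forall (i : 'I_e) (j : 'I_d), (j < c i)%N -> A x i j = 0))).
  apply: constructible_exists => c; apply: constructible_and.
    do 2!apply: constructible_forall => ?; apply: constructible_implies.
    by apply: constructible_const; case: (_ < _)%N; [left|right].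
  apply: constructible_and; do 2!apply: constructible_forall => ?.
    by apply: constructible_eq; [exact: hA|exact: termable_const].
  apply: constructible_implies.
  by apply: constructible_eq; [exact: hA|exact: termable_const].
apply: constructible_ext => x; split.
  by case=> c [h1 [h2 h3]]; exists c.
case=> c [h1 h2 h3]; exists (finfun c).
by split; [|split] => i j; rewrite ?ffunE; [exact: h1|exact: h2|exact: h3].
Qed.

End Rref.

Section Chi.
Variables (k : closedFieldType) (chi : forall I : finType, kset k I -> int).
Hypothesis hchi : euler_characteristic chi.
Implicit Types I J T : finType.

Lemma chi_ext I (X Y : kset k I) : (forall x, X x <-> Y x) -> chi X = chi Y.
Proof.
move=> h; congr chi; apply: functional_extensionality => x.
exact: propositional_extensionality.
Qed.

Lemma chi_empty I (X : kset k I) : (forall x, ~ X x) -> chi X = 0.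
Proof.
move=> h; have cX : constructible X by exists (GRing.Bool false) => x; split=> // /h.
have hd : forall x, X x -> ~ X x by move=> x /h.
have := ec_additive hchi cX cX hd.
rewrite (@chi_ext _ (fun x => X x \/ X x) X) => [|x]; last by tauto.
by move/eqP; rewrite -subr_eq0 opprD addrA subrr add0r oppr_eq0 => /eqP.
Qed.

(** Coverings of degree 1 are exactly the bijections with constructible graph, and
    the restriction on the degree of a covering is void for degree 1. *)
Lemma chi_bij I J (X : kset k I) (Y : kset k J) (G : kset k (I + J)%type) :
  constructible X -> constructible Y -> constructible G ->
  (forall x, X x -> exists! y, Y y /\ G (pairing x y)) ->
  (forall y, Y y -> exists! x, X x /\ G (pairing x y)) ->
  chi X = chi Y.
Proof.
move=> cX cY cG hx hy.
rewrite (ec_covering hchi (d := 1) cX cY cG) ?mul1r ?oner_neq0 //.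
split=> // y Yy; have [x [[Xx Gx] ux]] := hy y Yy.
exists [:: x]; split=> // x'; rewrite inE; split=> [/eqP->//|h].
by apply/eqP; rewrite (ux _ h).
Qed.

Lemma chi_partition I T (P : pred T) (X : T -> kset k I) :
  (forall t, constructible (X t)) ->
  (forall t t' x, P t -> P t' -> X t x -> X t' x -> t = t') ->
  chi (fun x => exists t, P t /\ X t x) = \sum_(t | P t) chi (X t).
Proof.
move=> cX dX.
have [e [ue eP ->]] : exists e, [/\ uniq e, (forall t, (t \in e) = P t) &
    \sum_(t | P t) chi (X t) = \sum_(t <- e) chi (X t)].
  exists [seq t <- index_enum T | P t].
  rewrite filter_uniq ?index_enum_uniq // big_filter; split=> // t.
  by rewrite mem_filter mem_index_enum andbT.
have {}dX t t' x : t \in e -> t' \in e -> X t x -> X t' x -> t = t'.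
  by rewrite !eP; apply: dX.
rewrite (@chi_ext _ _ (fun x => exists t, t \in e /\ X t x)); last first.
  by move=> x; split=> -[t [h ?]]; exists t; split=> //; move: h; rewrite eP.
elim: e {eP} ue dX => [|a s IH] /=.
  by rewrite big_nil => _ _; apply: chi_empty => x [t []].
case/andP=> as_ us dX; rewrite big_cons -IH //; last first.
  by move=> t t' x ht ht'; apply: dX; rewrite inE ?ht ?ht' orbT.
rewrite -(ec_additive hchi) //.
- apply: chi_ext => x; split.
    by case=> t; rewrite inE => -[/predU1P[->|ht] h]; [left|right; exists t].
  by case=> [h|[t [ht h]]]; [exists a|exists t]; rewrite inE ?eqxx ?ht ?orbT.
- have: constructible (fun x => exists t, (t \in s : Prop) /\ X t x).
    apply: constructible_exists => t; apply: constructible_and => //.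
    by apply: constructible_const; case: (t \in s); [left|right].
  exact.
move=> x Xa [t [ts Xt]]; move: as_; rewrite (dX a t x) ?ts ?inE ?eqxx ?ts ?orbT //.
Qed.

Lemma chi_reindex I J (f : I -> J) : bijective f ->
  chi (fun _ : {ffun I -> k} => True) = chi (fun _ : {ffun J -> k} => True).
Proof.
case=> g fK gK.
apply: (@chi_bij _ _ _ _ (fun z => forall i, z (inl i) = z (inr (f i)))).
- exact: constructible_True.
- exact: constructible_True.
- by apply: constructible_forall => i; apply: constructible_eq; apply: termable_var.
- move=> x _; exists [ffun j => x (g j)]; split.
    by split=> // i; rewrite !ffunE fK.
  by move=> y [_ h]; apply/ffunP=> j; have := h (g j); rewrite !ffunE gK.
move=> y _; exists [ffun i => y (f i)]; split.
  by split=> // i; rewrite !ffunE.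
by move=> x [_ h]; apply/ffunP=> i; have := h i; rewrite !ffunE.
Qed.

(** An affine space is a product of lines. *)
Lemma chi_full I : chi (fun _ : {ffun I -> k} => True) = 1.
Proof.
rewrite (@chi_reindex _ 'I_#|I| (@enum_rank I)); last first.
  by exists (@enum_val I predT); [exact: enum_rankK|exact: enum_valK].
elim: #|I| => [|m IH].
  rewrite -(ec_point hchi (I := 'I_0) [ffun i => 0]); apply: chi_ext => x.
  by split=> // _; apply/ffunP; case.
rewrite -(@chi_reindex ('I_1 + 'I_m)%type _ (@unsplit 1 m)); last first.
  by exists (@split 1 m); [exact: unsplitK|exact: splitK].
rewrite -[RHS](mulr1 1) -{1}(ec_line hchi) -IH.
rewrite -(ec_product hchi (constructible_True _ _) (constructible_True _ _)).
by apply: chi_ext => x; split.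
Qed.

Lemma chi_coords I (C : pred I) (w : I -> k) :
  chi (fun x : {ffun I -> k} => forall i, C i -> x i = w i) = 1.
Proof.
rewrite -(chi_full {i : I | ~~ C i}).
apply: (@chi_bij _ _ _ _ (fun z => forall j : {i : I | ~~ C i}, z (inl (val j)) = z (inr j))).
- apply: constructible_forall => i; apply: constructible_implies.
  by apply: constructible_eq; [apply: termable_var|apply: termable_const].
- exact: constructible_True.
- by apply: constructible_forall => i; apply: constructible_eq; apply: termable_var.
- move=> x _; exists [ffun j => x (val j)]; split.
    by split=> // i; rewrite !ffunE.
  by move=> y [_ h]; apply/ffunP=> j; have := h j; rewrite !ffunE.
move=> y _.
exists [ffun i => if insub i is Some j then y j else w i]; split.
  split=> [i Ci|j]; first by rewrite ffunE insubF // Ci.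
  by rewrite !ffunE valK.
move=> x [xC h]; apply/ffunP=> i; rewrite ffunE; case: insubP => [j _ <-|].
  by have := h j; rewrite !ffunE.
by rewrite negbK => /xC.
Qed.

(** The Schubert cells, indexed by the sets of pivots, are affine spaces. *)
Lemma chi_gr e d : chi (fun x : {ffun mx_idx e d -> k} => rref (mx_of x)) = 'C(d, e).
Proof.
rewrite -card_ltn_sorted_tuples -sum1_card.
pose inc (t : e.-tuple 'I_d) := sorted ltn [seq val i | i <- t].
have incP (t : e.-tuple 'I_d) :
    reflect (forall i j : 'I_e, (i < j)%N -> (tnth t i < tnth t j)%N) (inc t).
  apply: (iffP idP) => [h i j ij|h].
    have := sorted_ltn_nth ltn_trans 0%N h i j.
    rewrite !inE size_map size_tuple !ltn_ord => /(_ isT isT ij).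
    by rewrite !(nth_map (tnth t i)) ?size_tuple // -!tnth_nth.
  apply/(sortedP 0%N) => i; rewrite size_map size_tuple => lt.
  have lt' := ltnW lt; have := h (Ordinal lt') (Ordinal lt) (leqnn _).
  move: (tnth t (Ordinal lt)) (tnth_nth (tnth t (Ordinal lt)) t (Ordinal lt))
    (tnth_nth (tnth t (Ordinal lt)) t (Ordinal lt')) => x0 /= ex -> h'.
  by rewrite !(nth_map x0) ?size_tuple // -ex.
(* the entries that are prescribed in the cell of [t] *)
pose C (t : e.-tuple 'I_d) (p : mx_idx e d) :=
  (p.2 < tnth t p.1)%N || [exists j, p.2 == tnth t j].
have pvt (t : e.-tuple 'I_d) (x : {ffun mx_idx e d -> k}) : inc t ->
    (forall p, C t p -> x p = (p.2 == tnth t p.1)%:R) <-> pivots (mx_of x) (tnth t).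
  move/incP => h.
  have inj i j : (tnth t j == tnth t i) = (i == j).
    apply/eqP/eqP=> [|->//] e0; apply: val_inj; apply/eqP => /=.
    by case: (ltngtP i j) => // /h; rewrite e0 ltnn.
  split=> [hx|[_ h1 h2] [i l]].
    split=> // i j => [|lt]; rewrite mxE hx /C /=.
    - by rewrite inj.
    - by apply/orP; right; apply/existsP; exists j.
    - by rewrite -val_eqE /= ltn_eqF.
    by rewrite lt.
  case/orP=> /= [lt|/existsP[j /eqP->]].
    by have := h2 i l lt; rewrite mxE => ->; rewrite -val_eqE /= ltn_eqF.
  by have := h1 i j; rewrite mxE => ->; rewrite inj.
rewrite (@chi_ext _ _ (fun x => exists t, inc t /\
  forall p, C t p -> x p = (p.2 == tnth t p.1)%:R)).
  rewrite chi_partition.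
  - rewrite -[RHS]natz natr_sum; apply: eq_big => [t|t ht]; first by rewrite inE.
    by rewrite chi_coords.
  - move=> t; apply: constructible_forall => p; apply: constructible_implies.
    by apply: constructible_eq; [apply: termable_var|apply: termable_const].
  move=> t t' x ht ht' /(pvt _ _ ht)[a1 a2 a3] /(pvt _ _ ht')[b1 b2 b3].
  apply: eq_from_tnth => i; apply: val_inj; apply/eqP.
  case: ltngtP => // lt.
    by have := b3 _ _ lt; rewrite a2 eqxx => /eqP; rewrite oner_eq0.
  by have := a3 _ _ lt; rewrite b2 eqxx => /eqP; rewrite oner_eq0.
move=> x; split=> [[c hc]|[t [ht /(pvt _ _ ht) h]]]; last by exists (tnth t).
have [c1 c2 c3] := hc.
have h : inc [tuple c i | i < e] by apply/incP => i j; rewrite !tnth_mktuple => /c1.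
exists [tuple c i | i < e]; split=> //; apply/pvt => //.
by split=> i j; rewrite !tnth_mktuple; [exact: c1|exact: c2|exact: c3].
Qed.

End Chi.

(** * Families of Grassmannians *)

Section Subspaces.
Variable k : closedFieldType.

Lemma eqMS_sym m1 m2 d (A : 'M[k]_(m1, d)) (B : 'M_(m2, d)) :
  (A == B)%MS -> (B == A)%MS.
Proof. by rewrite andbC. Qed.

Lemma eqMS_trans m1 m2 m3 d (A : 'M[k]_(m1, d)) (B : 'M_(m2, d)) (C : 'M_(m3, d)) :
  (A == B)%MS -> (B == C)%MS -> (A == C)%MS.
Proof.
by move=> /andP[a b] /andP[c e]; rewrite (submx_trans a c) (submx_trans e b).
Qed.

Lemma eqMS_mulr m1 m2 d d' (A : 'M[k]_(m1, d)) (B : 'M_(m2, d)) (C : 'M_(d, d')) :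
  (A == B)%MS -> (A *m C == B *m C)%MS.
Proof. by move=> /andP[a b]; rewrite !submxMr. Qed.

Lemma orth_sym m1 m2 d (A : 'M[k]_(m1, d)) (B : 'M_(m2, d)) :
  A *m B^T = 0 -> B *m A^T = 0.
Proof. by move=> h; apply: trmx_inj; rewrite trmx_mul trmxK h trmx0. Qed.

Lemma rank_orth m d (A : 'M[k]_(m, d)) : \rank (kermx A^T) = (d - \rank A)%N.
Proof. by rewrite mxrank_ker mxrank_tr. Qed.

Section Above.
Variables (l q a r : nat) (P : 'M[k]_(l, q)).
Hypotheses (rP : \rank P = r) (aq : (a <= q)%N).

(** Spaces [R] containing [P] correspond, by taking orthogonals, to subspaces of
    the orthogonal of [P]; [R1] gives the orthogonal of [R] in coordinates with
    respect to the echelon basis [A] of the orthogonal of [P]. *)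
Definition above_rel (R : 'M[k]_(a, q)) (R1 : 'M[k]_((q - a)%N, (q - r)%N)) : Prop :=
  exists A : 'M[k]_((q - r)%N, q),
    [/\ rref A, P *m A^T = 0 & R *m (R1 *m A)^T = 0].

Lemma above_frame : exists A : 'M[k]_((q - r)%N, q), [/\ rref A, P *m A^T = 0,
  (A == kermx P^T)%MS & forall A', rref A' -> P *m A'^T = 0 -> A' = A].
Proof.
have [|A [hA AP]] := @rref_exists k (q - r)%N _ _ (kermx P^T).
  by rewrite rank_orth rP.
exists A; split=> //.
  by apply: orth_sym; apply/sub_kermxP; case/andP: AP.
move=> A' hA' /orth_sym /sub_kermxP h; apply: rref_unique => //.
by case/andP: AP => _; apply: submx_trans.
Qed.

Lemma above_to R : rref R -> (P <= R)%MS ->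
  exists! R1, rref R1 /\ above_rel R R1.
Proof.
move=> hR PR; have [A [hA PA AP uA]] := above_frame.
have : (kermx R^T <= A)%MS.
  case/andP: AP => _; apply: submx_trans; apply/sub_kermxP.
  case/submxP: PR => D ->; rewrite trmx_mul mulmxA.
  by rewrite (_ : kermx R^T *m R^T = 0) ?mul0mx //; apply/sub_kermxP.
case/submxP=> D hD.
have rD : \rank D = (q - a)%N.
  by rewrite -(mxrankMfree D (rref_row_free hA)) -hD rank_orth (rref_rank hR).
have [R1 [hR1 RD]] := rref_exists rD; case/andP: (RD) => RD1 RD2.
exists R1; split.
  split=> //; exists A; split=> //; apply: orth_sym; apply/sub_kermxP.
  by rewrite hD submxMr.
move=> R' [hR' [A' [/uA hA' /hA' -> /orth_sym/sub_kermxP]]].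
rewrite hD submxMfree ?rref_row_free // => h.
by apply/esym/rref_unique => //; apply: submx_trans h RD2.
Qed.

Lemma above_from R1 : rref R1 ->
  exists! R, (rref R /\ (P <= R)%MS) /\ above_rel R R1.
Proof.
move=> hR1; have [A [hA PA AP uA]] := above_frame.
have [|R [hR RK]] := @rref_exists k a _ _ (kermx (R1 *m A)^T).
  rewrite rank_orth mxrankMfree ?rref_row_free // (rref_rank hR1).
  by rewrite subKn.
case/andP: (RK) => RK1 RK2; exists R; split.
  split; last by exists A; split=> //; apply/sub_kermxP.
  split=> //; apply: submx_trans RK2; apply/sub_kermxP.
  by rewrite trmx_mul mulmxA PA mul0mx.
move=> R' [[hR' _] [A' [/uA hA' /hA' -> /sub_kermxP h]]].
by apply/esym/rref_unique => //; apply: submx_trans h RK2.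
Qed.
End Above.

Section Below.
Variables (q a r : nat) (inU : forall m, 'M[k]_(m, q) -> Prop) (U : 'M[k]_q).
Hypotheses (UP : forall m (y : 'M[k]_(m, q)), inU y <-> (y <= U)%MS) (rU : \rank U = r).

(** [R1] is [R] in coordinates with respect to the echelon basis [A] of [U].  The
    space [U] is only accessible through the predicate [inU], which is what can
    be expressed by a formula when [U] varies. *)
Definition below_rel (R : 'M[k]_(a, q)) (R1 : 'M[k]_(a, r)) : Prop :=
  exists A : 'M[k]_(r, q), [/\ rref A, inU A & (R == R1 *m A)%MS].

Lemma below_frame : exists A : 'M[k]_(r, q), [/\ rref A, inU A,
  (A == U)%MS & forall A', rref A' -> inU A' -> A' = A].
Proof.
have [A [hA AU]] := rref_exists rU; exists A; split=> //.
  by apply/UP; case/andP: AU.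
move=> A' hA' /UP h; apply: rref_unique => //.
by case/andP: AU => _; apply: submx_trans.
Qed.

Lemma below_to R : rref R -> inU R ->
  exists! R1, rref R1 /\ below_rel R R1.
Proof.
move=> hR /UP RU; have [A [hA UA AU uA]] := below_frame.
have : (R <= A)%MS by case/andP: AU => _; apply: submx_trans.
case/submxP=> D hD.
have rD : \rank D = a by rewrite -(mxrankMfree D (rref_row_free hA)) -hD rref_rank.
have [R1 [hR1 RD]] := rref_exists rD.
exists R1; split.
  by split=> //; exists A; split=> //; rewrite hD; apply/eqMS_mulr/eqMS_sym.
move=> R' [hR' [A' [/uA hA' /hA' ->]]].
rewrite hD => /andP[_]; rewrite submxMfree ?rref_row_free // => h.
by apply/esym/rref_unique => //; case/andP: RD => _; apply: submx_trans.
Qed.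

Lemma below_from R1 : rref R1 ->
  exists! R, (rref R /\ inU R) /\ below_rel R R1.
Proof.
move=> hR1; have [A [hA UA AU uA]] := below_frame.
have [|R [hR RK]] := @rref_exists k a _ _ (R1 *m A).
  by rewrite mxrankMfree ?rref_row_free // (rref_rank hR1).
exists R; split.
  split; last by exists A.
  split=> //; apply/UP; case/andP: RK => h _; apply: submx_trans h _.
  by case/andP: AU => h _; apply: submx_trans h; apply: submxMl.
move=> R' [[hR' _] [A' [/uA hA' /hA' -> /andP[h _]]]].
by apply/esym/rref_unique => //; case/andP: RK => _; apply: submx_trans.
Qed.
End Below.

Lemma mxcol_submx a (p : 'I_a -> nat) m q (A : forall s, 'M[k]_(p s, q)) (W : 'M_(m, q)) :
  (\mxcol_s A s <= W)%MS <-> forall s, (A s <= W)%MS.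
Proof.
split=> [/submxP[D hD] s|h].
  by rewrite -[A s](mxcolK A) hD -submxcol_mul submxMl.
have [f hf] := fin_all_exists (fun s => submxP (h s)).
by apply/submxP; exists (\mxcol_s f s); rewrite mxcol_mul; apply: eq_mxcol.
Qed.

(** [U] is the preimage under [kap] of the sum of the [x s]; as [kap] identifies
    its source with the kernel of [phi], this is the intersection of that sum
    with the kernel, and the rank formula is rank-nullity for [phi] restricted
    to the sum. *)
Lemma preimage_rank a (p : 'I_a -> nat) q l (e : 'I_a -> nat)
    (phi : forall s, 'M[k]_(p s, l)) (kap : 'M[k]_(q, \sum_s p s))
    (x : forall s, 'M[k]_(e s, p s)) :
  row_free kap -> (kap == kermx (\mxcol_s phi s))%MS ->
  exists U : 'M[k]_q,
    (forall m (y : 'M[k]_(m, q)),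
       (forall s, (y *m submxrow kap s <= x s)%MS) <-> (y <= U)%MS) /\
    (\rank U + \rank (\mxcol_s (x s *m phi s)) = \sum_s \rank (x s))%N.
Proof.
move=> fk kk; pose D := \mxdiag_s <<x s>>%MS.
have DP m (z : 'M[k]_(m, \sum_s p s)) :
    (z <= D)%MS <-> forall s, (submxrow z s <= x s)%MS.
  split=> [/submxP[C ->] s|h].
    rewrite -[C]submxrowK mul_mxrow_mxdiag mxrowK.
    by rewrite -(genmxE (x s)) submxMl.
  have h' s : (submxrow z s <= <<x s>>)%MS by rewrite genmxE.
  have [f hf] := fin_all_exists (fun s => submxP (h' s)).
  apply/submxP; exists (\mxrow_s f s); rewrite mul_mxrow_mxdiag -[LHS]submxrowK.
  exact: eq_mxrow.
exists (kermx (kap *m cokermx D)); split.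
  move=> m y; rewrite sub_kermx mulmxA -submxE.
  by split=> [h|/DP h s]; [apply/DP => s|have := h s]; rewrite -mul_submxrow.
have e1 : (\mxcol_s (x s *m phi s) == D *m \mxcol_s phi s)%MS.
  rewrite mul_mxdiag_mxcol; apply/andP; split; apply/mxcol_submx => s.
    apply: (@submx_trans _ _ _ _ _ _ (<<x s>>%MS *m phi s)).
      by rewrite submxMr ?genmxE.
    by rewrite -[X in (X <= _)%MS](mxcolK (fun s => <<x s>>%MS *m phi s) s) rowsub_sub.
  apply: (@submx_trans _ _ _ _ _ _ (x s *m phi s)).
    by rewrite submxMr ?genmxE.
  by rewrite -[X in (X <= _)%MS](mxcolK (fun s => x s *m phi s) s) rowsub_sub.
rewrite (eqmxP e1).
have -> : \rank (kermx (kap *m cokermx D)) = \rank (D :&: kermx (\mxcol_s phi s))%MS.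
  rewrite -(mxrankMfree (kermx _) fk); apply/eqmx_rank/andP; split.
    rewrite sub_capmx; apply/andP; split.
      by rewrite submxE -mulmxA -sub_kermx submx_refl.
    by apply: submx_trans (submxMl _ _) _; case/andP: kk.
  have : (D :&: kermx (\mxcol_s phi s) <= kap)%MS.
    by case/andP: kk => _; apply: submx_trans; apply: capmxSr.
  case/submxP=> C hC; rewrite hC; apply: submxMr.
  by rewrite sub_kermx mulmxA -hC -submxE capmxSl.
rewrite addnC mxrank_mul_ker rank_mxdiag.
by apply: eq_bigr => s _; rewrite genmxE.
Qed.

End Subspaces.

Section Fibration.
Variables (k : closedFieldType) (chi : forall I : finType, kset k I -> int).
Hypothesis hchi : euler_characteristic chi.
Variable n : nat.
Implicit Types d e : 'I_n -> nat.

Definition gr_of d e (R : forall v, 'M[k]_(e v, d v)) : {ffun gr_index d e -> k} :=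
  [ffun t => R (tag t) (tagged t).1 (tagged t).2].

Lemma gr_ofK d e (R : forall v, 'M[k]_(e v, d v)) v : gr_mx (gr_of R) v = R v.
Proof. by apply/matrixP=> a b; rewrite mxE ffunE. Qed.

Lemma gr_mx_inj d e (x y : {ffun gr_index d e -> k}) :
  (forall v, gr_mx x v = gr_mx y v) -> x = y.
Proof.
move=> h; apply/ffunP=> -[v [a b]].
by have /matrixP/(_ a b) := h v; rewrite !mxE.
Qed.

Lemma mxtermable_gr_id d e v :
  mxtermable (fun w : {ffun gr_index d e -> k} => gr_mx w v).
Proof.
move=> a b; have h := termable_var k (@Tagged _ v
  (fun v => ('I_(e v) * 'I_(d v))%type) (a, b)).
by apply: termable_ext h => w; rewrite mxE.
Qed.

Lemma mxtermable_gr (I : finType) d e (p : gr_index d e -> I) v :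
  mxtermable (fun w : {ffun I -> k} => gr_mx (restr p w) v).
Proof. exact: (mxtermable_restr p (@mxtermable_gr_id d e v)). Qed.

Lemma restr_id (I : finType) (x : {ffun I -> k}) : restr id x = x.
Proof. by apply/ffunP=> i; rewrite ffunE. Qed.

Lemma restr_inr_inl (I J K : finType) (z : {ffun I -> k}) (y : {ffun J + K -> k}) :
  restr (fun t => inr (inl t)) (pairing z y) = restr inl y.
Proof. by apply/ffunP=> t; rewrite !ffunE. Qed.

Lemma restr_inr_inr (I J K : finType) (z : {ffun I -> k}) (y : {ffun J + K -> k}) :
  restr (fun t => inr (inr t)) (pairing z y) = restr inr y.
Proof. by apply/ffunP=> t; rewrite !ffunE. Qed.

Definition rref_gr d e (x : {ffun gr_index d e -> k}) : Prop :=
  forall v, rref (gr_mx x v).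

Lemma rref_gr_exists d e (m : 'I_n -> nat) (A : forall v, 'M[k]_(m v, d v)) :
  (forall v, \rank (A v) = e v) ->
  exists x : {ffun gr_index d e -> k}, rref_gr x /\ forall v, (gr_mx x v == A v)%MS.
Proof.
move=> h; have [R hR] := fin_all_exists (fun v => rref_exists (h v)).
by exists (gr_of R); split=> v; rewrite gr_ofK; case: (hR v).
Qed.

Lemma rref_gr_unique d e (x y : {ffun gr_index d e -> k}) :
  rref_gr x -> rref_gr y -> (forall v, (gr_mx x v <= gr_mx y v)%MS) -> x = y.
Proof. by move=> hx hy h; apply: gr_mx_inj => v; apply: rref_unique. Qed.

Lemma submx_norows m1 m2 q (A : 'M[k]_(m1, q)) (B : 'M[k]_(m2, q)) :
  m1 = 0%N -> (A <= B)%MS.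
Proof. by move=> m0; subst m1; rewrite flatmx0 sub0mx. Qed.

Section OneVertex.
Variables (i : 'I_n) (d d' e e0 : 'I_n -> nat).
Variables (th : forall v, 'M[k]_(d' v, d v)) (ps : forall v, 'M[k]_(d v, d' v)).
Hypothesis thps : forall v, v != i -> th v *m ps v = 1%:M.
Hypothesis psth : forall v, v != i -> ps v *m th v = 1%:M.
Hypothesis e0i : e0 i = 0%N.
Hypothesis e0e : forall v, v != i -> e0 v = e v.

(** The matrices of [z] and [x] define the same subspaces at the vertices other
    than [i].  The two families have different types there, hence the
    identifications [th] and the comparison of row spaces. *)
Definition away_eq (z : {ffun gr_index d' e -> k}) (x : {ffun gr_index d e0 -> k}) :=
  forall v, v != i -> (gr_mx z v *m th v == gr_mx x v)%MS.

Lemma away_eq_exists z : rref_gr z -> exists x, rref_gr x /\ away_eq z x.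
Proof.
move=> hz; pose A v := if v == i then 0 else gr_mx z v *m th v.
have [|x [hx xA]] := @rref_gr_exists d e0 e A.
  move=> v; rewrite /A; case: eqVneq => [->|vi]; first by rewrite mxrank0 e0i.
  rewrite mxrankMfree ?(rref_rank (hz v)) ?e0e //.
  by apply/row_freeP; exists (ps v); apply: thps.
exists x; split=> // v vi; apply: eqMS_sym.
by have := xA v; rewrite /A (negPf vi).
Qed.

Lemma away_eq_unique z x x' : rref_gr x -> rref_gr x' ->
  away_eq z x -> away_eq z x' -> x = x'.
Proof.
move=> hx hx' zx zx'; apply: rref_gr_unique => // v.
have [->|vi] := eqVneq v i; first exact: submx_norows.
by have /andP[] := eqMS_trans (eqMS_sym (zx v vi)) (zx' v vi).
Qed.

Variables (X : kset k (gr_index d e0)) (r s : nat).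
Variable Good : {ffun gr_index d e0 -> k} -> 'M[k]_(e i, d' i) -> Prop.
Variable T : {ffun gr_index d e0 -> k} -> 'M[k]_(e i, d' i) -> 'M[k]_(r, s) -> Prop.
Hypothesis cX : constructible X.
Hypothesis Xrref : forall x, X x -> rref_gr x.
Hypothesis cGood : forall (I : finType) (p : gr_index d e0 -> I) A, mxtermable A ->
  constructible (fun w : {ffun I -> k} => Good (restr p w) (A w)).
Hypothesis cT : forall (I : finType) (p : gr_index d e0 -> I) A B, mxtermable A ->
  mxtermable B -> constructible (fun w : {ffun I -> k} => T (restr p w) (A w) (B w)).
Hypothesis Tto : forall x R, X x -> rref R -> Good x R ->
  exists! R1, rref R1 /\ T x R R1.
Hypothesis Tfrom : forall x R1, X x -> rref R1 ->
  exists! R, (rref R /\ Good x R) /\ T x R R1.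

(** The points with components away from [i] in [X] and with component at [i] in
    the fibre [Good] over them. *)
Definition fibred : kset k (gr_index d' e) := fun z => rref_gr z /\
  exists x, X x /\ away_eq z x /\ Good x (gr_mx z i).

Lemma constructible_rref_gr (I : finType) f g (p : gr_index f g -> I) :
  constructible (fun w : {ffun I -> k} => rref_gr (restr p w)).
Proof. by apply: constructible_forall => v; apply/constructible_rref/mxtermable_gr. Qed.

Lemma constructible_away (I : finType) (p : gr_index d' e -> I) (p' : gr_index d e0 -> I) :
  constructible (fun w : {ffun I -> k} => away_eq (restr p w) (restr p' w)).
Proof.
apply: constructible_forall => v; apply: constructible_implies.
apply: constructible_eqMS; last exact: mxtermable_gr.
by apply: mxtermable_mul; [exact: mxtermable_gr|exact: mxtermable_const].
Qed.

Lemma constructible_fibred : constructible fibred.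
Proof.
apply: constructible_and.
  by apply: constructible_ext (constructible_rref_gr id) => x; rewrite restr_id.
have: constructible (fun z => exists x, X (restr inr (pairing z x)) /\
    away_eq (restr inl (pairing z x)) (restr inr (pairing z x)) /\
    Good (restr inr (pairing z x)) (gr_mx (restr inl (pairing z x)) i)).
  apply: (constructible_ex (P := fun w => X (restr inr w) /\
    away_eq (restr inl w) (restr inr w) /\ Good (restr inr w) (gr_mx (restr inl w) i))).
  apply: constructible_and; first by apply: constructible_restr_inj => // ? ? [].
  apply: constructible_and; first exact: constructible_away.
  by apply: cGood; apply: mxtermable_gr.
by apply: constructible_ext => z; split=> -[x h]; exists x; move: h;
  rewrite pairing_inl pairing_inr.
Qed.

(** [T] identifies all the fibres with one Grassmannian, and its graph is
    constructible; so the fibration has the Euler characteristic of a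
    product. *)
Lemma chi_fibred : chi fibred = chi X * 'C(s, r)%:Z.
Proof.
rewrite -(chi_gr hchi r s).
have cR : constructible (fun y : {ffun mx_idx r s -> k} => rref (mx_of y)).
  by apply/constructible_rref/mxtermable_mx_of.
rewrite -(ec_product hchi cX cR).
pose px : gr_index d e0 -> gr_index d' e + (gr_index d e0 + mx_idx r s) :=
  fun t => inr (inl t).
pose pr : mx_idx r s -> gr_index d' e + (gr_index d e0 + mx_idx r s) := fun t => inr (inr t).
apply: (@chi_bij _ _ hchi _ _ _ _ (fun w => away_eq (restr inl w) (restr px w) /\
  T (restr px w) (gr_mx (restr inl w) i) (mx_of (restr pr w)))).
- exact: constructible_fibred.
- apply: constructible_and; first by apply: (constructible_restr_inj (p := inl)) => // ? ? [].
  apply: (constructible_restr_inj (p := inr) (P := fun y => rref (mx_of y))) => //.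
  by move=> ? ? [].
- apply: constructible_and; first exact: constructible_away.
  apply: cT; first exact: mxtermable_gr.
  exact: (mxtermable_restr pr (@mxtermable_mx_of k _ _)).
- move=> z [hz [x [Xx [zx gx]]]].
  have [R1 [[hR1 TR1] uR1]] := Tto Xx (hz i) gx.
  exists (pairing x (of_mx R1)); split.
    split.
      change (X (restr inl (pairing x (of_mx R1))) /\
        rref (mx_of (restr inr (pairing x (of_mx R1))))).
      by rewrite pairing_inl pairing_inr of_mxK.
    by rewrite pairing_inl restr_inr_inl restr_inr_inr pairing_inl pairing_inr of_mxK.
  move=> y [[]]; rewrite -/(restr inl y) -/(restr inr y) pairing_inl.
  rewrite /px /pr restr_inr_inl restr_inr_inr.
  move=> Xy hy [zy Ty]; have xy := away_eq_unique (Xrref Xx) (Xrref Xy) zx zy.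
  rewrite -[RHS]pairing_eta -xy; congr pairing.
  by rewrite -[RHS]mx_ofK; congr of_mx; apply: uR1; split=> //; rewrite xy.
move=> y [Xx hR1]; rewrite -/(restr inl y) -/(restr inr y) in Xx hR1.
set x := restr inl y in Xx; set R1 := mx_of _ in hR1.
have [R [[[hR gR] TR] uR]] := Tfrom Xx hR1.
(* the component at [i] is prescribed, which an equality [v = i] has to
   carry to the type at [v] *)
have /fin_all_exists[Z hZ] : forall v, exists A : 'M[k]_(e v, d' v),
    [/\ rref A, v != i -> (A *m th v == gr_mx x v)%MS &
      forall vi : v = i, eq_rect v (fun v => 'M[k]_(e v, d' v)) A i vi = R].
  move=> v; have [vi|vi] := eqVneq v i.
    by subst v; exists R; split=> // vi; rewrite (eq_irrelevance vi (erefl i)).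
  have [|A [hA AE]] := @rref_exists k (e v) _ _ (gr_mx x v *m ps v).
    rewrite mxrankMfree ?(rref_rank (Xrref Xx v)) ?e0e //.
    by apply/row_freeP; exists (th v); apply: psth.
  exists A; split=> // [_|ev]; last by rewrite ev eqxx in vi.
  by have := eqMS_mulr (th v) AE; rewrite -mulmxA psth // mulmx1.
have Zi : Z i = R by have [_ _ /(_ (erefl i))] := hZ i.
have zx : away_eq (gr_of Z) x by move=> v vi; rewrite gr_ofK; case: (hZ v) => _ /(_ vi).
exists (gr_of Z); split.
  split.
    split; first by move=> v; rewrite gr_ofK; case: (hZ v).
    by exists x; split=> //; split=> //; rewrite gr_ofK Zi.
  rewrite pairing_inl restr_inr_inl restr_inr_inr.
  by split=> //; rewrite gr_ofK Zi.
move=> z [[hz [x' [Xx' [zx' gx']]]]]; rewrite pairing_inl.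
rewrite restr_inr_inl restr_inr_inr.
case=> zx0 Tz; have xx' := away_eq_unique (Xrref Xx) (Xrref Xx') zx0 zx'.
apply: gr_mx_inj => v; rewrite gr_ofK; have [->|vi] := eqVneq v i.
  by rewrite Zi; apply: uR; split=> //; split=> //; rewrite xx'.
have [hZv /(_ vi) h _] := hZ v; apply: rref_unique => //.
have /andP[+ _] := eqMS_mulr (ps v) (eqMS_trans h (eqMS_sym (zx0 v vi))).
by rewrite -!mulmxA thps // !mulmx1.
Qed.

End OneVertex.
End Fibration.

(** * Quiver Grassmannians under a reflection *)

Section SubGr.
Variables (k : closedFieldType) (n : nat).
Implicit Types d e : 'I_n -> nat.

Definition sub_gr d (M : forall u v, 'M[k]_(d u, d v)) e : kset k (gr_index d e) :=
  fun x => rref_gr x /\ forall u v, (gr_mx x u *m M u v <= gr_mx x v)%MS.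

Lemma rref_gr_le d e (x : {ffun gr_index d e -> k}) v :
  rref_gr x -> (e v <= d v)%N.
Proof. by move=> hx; rewrite -(rref_rank (hx v)) rank_leq_col. Qed.

End SubGr.

Section Strata.
Variables (k : closedFieldType) (chi : forall I : finType, kset k I -> int).
Hypothesis hchi : euler_characteristic chi.
Variables (n : nat) (i : 'I_n) (a : nat) (us : 'I_a -> 'I_n).
Variables (d : 'I_n -> nat) (M : forall u v, 'M[k]_(d u, d v)).
Hypothesis us_i : forall s, us s != i.
Hypothesis M_in : forall u, (forall s, us s != u) -> M u i = 0.
Hypothesis M_out : forall v, M i v = 0.
Implicit Types e : 'I_n -> nat.

Definition inflow e (x : {ffun gr_index d e -> k}) :
    'M[k]_((\sum_s e (us s))%N, d i) :=
  \mxcol_s (gr_mx x (us s) *m M (us s) i).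

(** The components away from [i] of subrepresentations, sorted by the dimension
    of the subspace that they force into the component at [i].  The dimension
    vector [e] is meant to vanish at [i]. *)
Definition stratum e (r : nat) : kset k (gr_index d e) := fun x =>
  [/\ rref_gr x,
      forall u v, u != i -> v != i -> (gr_mx x u *m M u v <= gr_mx x v)%MS
    & \rank (inflow x) = r].

Lemma mxtermable_inflow (I : finType) e (p : gr_index d e -> I) :
  mxtermable (fun w : {ffun I -> k} => inflow (restr p w)).
Proof.
move=> s t; rewrite /inflow.
have h := mxtermable_mul (@mxtermable_gr k n I d e p (us (tagnat.sig1 s)))
  (@mxtermable_const k I _ _ (M (us (tagnat.sig1 s)) i)) (tagnat.sig2 s) t.
by apply: termable_ext h => x; rewrite [RHS]mxE.
Qed.

Lemma constructible_stratum e r : constructible (@stratum e r).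
Proof.
have: constructible (fun x : {ffun gr_index d e -> k} => rref_gr (restr id x) /\
    ((forall u v, u != i -> v != i ->
       (gr_mx (restr id x) u *m M u v <= gr_mx (restr id x) v)%MS) /\
     (exists A : 'M[k]_(r, d i), rref A /\ (A == inflow (restr id x))%MS))).
  apply: constructible_and; first exact: constructible_rref_gr.
  apply: constructible_and.
    do 2!apply: constructible_forall => ?; do 2!apply: constructible_implies.
    apply: constructible_submx; last exact: mxtermable_gr.
    by apply: mxtermable_mul; [exact: mxtermable_gr|exact: mxtermable_const].
  apply: constructible_exmx; apply: constructible_and.
    by apply/constructible_rref/mxtermable_restr/mxtermable_mx_of.
  apply: constructible_eqMS; first by apply/mxtermable_restr/mxtermable_mx_of.
  apply: (mxtermable_restr inl (A := fun w => inflow (restr id w))).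
  exact: mxtermable_inflow.
apply: constructible_ext => x; rewrite restr_id; split.
  by case=> h1 [h2 [A [hA /eqmx_rank rA]]]; split=> //; rewrite -rA rref_rank.
case=> h1 h2 h3; split=> //; split=> //.
by have [A [hA AE]] := rref_exists h3; exists A.
Qed.

Lemma inflow_transport e e0 (z : {ffun gr_index d e -> k}) (x : {ffun gr_index d e0 -> k})
    m (W : 'M[k]_(m, d i)) :
  (forall v, v != i -> (gr_mx x v <= gr_mx z v)%MS) ->
  (forall s, (gr_mx z (us s) *m M (us s) i <= W)%MS) -> (inflow x <= W)%MS.
Proof.
move=> h hz; apply/mxcol_submx => s; apply: submx_trans (hz s).
by rewrite submxMr // h.
Qed.

Section Source.
Variables (e e0 : 'I_n -> nat).
Hypothesis e0i : e0 i = 0%N.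
Hypothesis e0e : forall v, v != i -> e0 v = e v.
Hypothesis edi : (e i <= d i)%N.

(** Over the stratum [r], the component at [i] runs over the subspaces of
    dimension [e i] containing a given one of dimension [r]. *)
Lemma chi_sink : chi (sub_gr M (e := e)) =
  \sum_(r < (d i).+1) chi (@stratum e0 r) * 'C(d i - r, d i - e i)%:Z.
Proof.
pose one v : 'M[k]_(d v, d v) := 1%:M.
have one1 v : v != i -> one v *m one v = 1%:M by move=> _; rewrite mul1mx.
pose Good (x : {ffun gr_index d e0 -> k}) (R : 'M[k]_(e i, d i)) : Prop := (inflow x <= R)%MS.
pose Z r := @fibred k n i d d e e0 one (@stratum e0 r) Good.
pose T r (x : {ffun gr_index d e0 -> k}) (R : 'M_(e i, d i)) R1 :=
  @above_rel k _ (d i) (e i) r (inflow x) R R1.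
have cGood (I : finType) (p : gr_index d e0 -> I) A : mxtermable A ->
    constructible (fun w : {ffun I -> k} => Good (restr p w) (A w)).
  by move=> hA; apply: constructible_submx => //; apply: mxtermable_inflow.
have Xr r x : @stratum e0 r x -> rref_gr x by case.
have eZ z : sub_gr M z <-> exists r : 'I_(d i).+1, true /\ Z r z.
  split.
    case=> hz sz; have [x [hx zx]] := away_eq_exists one1 e0i e0e hz.
    have zx' v : v != i -> (gr_mx x v == gr_mx z v)%MS.
      by move=> vi; have := zx v vi; rewrite /one mulmx1 andbC.
    have lt : (\rank (inflow x) < (d i).+1)%N by rewrite ltnS rank_leq_col.
    exists (Ordinal lt); split=> //; split=> //; exists x; split; [split|split] => //.
      move=> u v ui vi; have /andP[h _] := zx' u ui; have /andP[_ h'] := zx' v vi.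
      by apply: submx_trans h'; apply: submx_trans (sz u v); rewrite submxMr.
    apply: (inflow_transport (z := z)) => [v vi|s]; last exact: sz.
    by case/andP: (zx' v vi).
  case=> r [_ [hz [x [[hx sx rx] [zx Gx]]]]]; split=> // u v.
  have [->|ui] := eqVneq u i; first by rewrite M_out mulmx0 sub0mx.
  have zx' w : w != i -> (gr_mx z w == gr_mx x w)%MS.
    by move=> wi; have := zx w wi; rewrite /one mulmx1.
  have /andP[h _] := zx' u ui.
  have [->|vi] := eqVneq v i.
    case: (pickP (fun s => us s == u)) => [s /eqP su|hu].
      apply: submx_trans Gx; apply: submx_trans (submxMr _ h) _; rewrite -su.
      rewrite -[X in (X <= _)%MS](mxcolK (fun s => gr_mx x (us s) *m M (us s) i)).
      exact: rowsub_sub.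
    by rewrite M_in ?mulmx0 ?sub0mx // => s; have /negbT := hu s.
  have /andP[_ h'] := zx' v vi.
  by apply: submx_trans h'; apply: submx_trans (sx u v ui vi); rewrite submxMr.
rewrite (chi_ext chi eZ) (chi_partition hchi) //.
- apply: eq_bigr => r _; rewrite (@chi_fibred _ _ hchi _ _ _ _ _ _ one one one1 one1 e0i e0e
    (@stratum e0 r) _ _ Good (T r)) //.
  + exact: constructible_stratum.
  + exact: Xr.
  + move=> I p A B hA hB; apply: constructible_exmx.
    have: constructible (fun z : {ffun I + mx_idx (d i - r) (d i) -> k} =>
        rref (mx_of (restr inr z)) /\
        (inflow (restr p (restr inl z)) *m (mx_of (restr inr z))^T = 0 /\
        A (restr inl z) *m (B (restr inl z) *m mx_of (restr inr z))^T = 0)).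
      have tA : mxtermable (fun z : {ffun I + mx_idx (d i - r) (d i) -> k} =>
        mx_of (restr inr z)) by apply/mxtermable_restr/mxtermable_mx_of.
      apply: constructible_and; first exact: constructible_rref.
      apply: constructible_and; apply: constructible_eqmx; try exact: mxtermable_const.
        apply: mxtermable_mul; last exact: mxtermable_tr.
        apply: (mxtermable_restr inl (A := fun w => inflow (restr p w))).
        exact: mxtermable_inflow.
      apply: mxtermable_mul; first exact: (mxtermable_restr inl hA).
      apply/mxtermable_tr/mxtermable_mul => //; exact: (mxtermable_restr inl hB).
    by apply: constructible_ext => z; split=> [[? []]|[]].
  + by move=> x R [_ _ rx] hR gR; apply: above_to.
  by move=> x R1 [_ _ rx] hR; apply: above_from.
- move=> r; apply: constructible_fibred => //; exact: constructible_stratum.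
move=> r r' z _ _ [hz [x [Xx [zx _]]]] [_ [x' [Xx' [zx' _]]]].
apply: ord_inj; have := away_eq_unique e0i (Xr _ _ Xx) (Xr _ _ Xx') zx zx'.
by move=> xx; case: Xx Xx'; rewrite xx => _ _ <- [_ _ <-].
Qed.

End Source.

Section Reflected.
Variables (d' : 'I_n -> nat) (M' : forall u v, 'M[k]_(d' u, d' v)).
Variables (th : forall v, 'M[k]_(d' v, d v)) (ps : forall v, 'M[k]_(d v, d' v)).
Variable kap : 'M[k]_(d' i, (\sum_s d (us s))%N).
Hypothesis thps : forall v, v != i -> th v *m ps v = 1%:M.
Hypothesis psth : forall v, v != i -> ps v *m th v = 1%:M.
Hypothesis M'_away : forall u v, u != i -> v != i -> M' u v *m th v = th u *m M u v.
Hypothesis M'_out : forall s, M' i (us s) *m th (us s) = submxrow kap s.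
Hypothesis M'_out0 : forall v, (forall s, us s != v) -> M' i v = 0.
Hypothesis M'_in : forall u, M' u i = 0.
Hypothesis kap_free : row_free kap.
Hypothesis kap_ker : (kap == kermx (\mxcol_s M (us s) i))%MS.

Lemma stratum_bounds e0 r x : @stratum e0 r x ->
  [/\ forall v, (e0 v <= d v)%N, (r <= \sum_s e0 (us s))%N &
      (\sum_s e0 (us s) - r <= d' i)%N].
Proof.
case=> hx _ rx; have [U [_ ]] := preimage_rank (fun s => gr_mx x (us s)) kap_free kap_ker.
rewrite -/(inflow x) rx (eq_bigr (fun s => e0 (us s))) => [rU|s _]; last exact: rref_rank.
split; first by move=> v; apply: rref_gr_le hx.
  by rewrite -rU leq_addl.
by rewrite -rU addnK rank_leq_row.
Qed.

Variables (e e0 : 'I_n -> nat).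
Hypothesis e0i : e0 i = 0%N.
Hypothesis e0e : forall v, v != i -> e0 v = e v.

(** Over the stratum [r], the component at [i] runs over the subspaces of
    dimension [e i] of the kernel of the inflow of the components away from
    [i]. *)
Lemma chi_reflected : chi (sub_gr M' (e := e)) =
  \sum_(r < (d i).+1) chi (@stratum e0 r) * 'C(\sum_s e0 (us s) - r, e i)%:Z.
Proof.
pose inU (x : {ffun gr_index d e0 -> k}) m (R : 'M[k]_(m, d' i)) : Prop :=
  forall s, (R *m submxrow kap s <= gr_mx x (us s))%MS.
pose Good x (R : 'M[k]_(e i, d' i)) := inU x _ R.
pose Z r := @fibred k n i d d' e e0 th (@stratum e0 r) Good.
pose T r (x : {ffun gr_index d e0 -> k}) (R : 'M_(e i, d' i)) R1 :=
  @below_rel k (d' i) (e i) (\sum_s e0 (us s) - r)%N (inU x) R R1.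
have cU (I : finType) (p : gr_index d e0 -> I) m (A : _ -> 'M_(m, _)) : mxtermable A ->
    constructible (fun w : {ffun I -> k} => inU (restr p w) _ (A w)).
  move=> hA; apply: constructible_forall => s; apply: constructible_submx.
    by apply: mxtermable_mul => //; apply: mxtermable_const.
  exact: mxtermable_gr.
have Xr r x : @stratum e0 r x -> rref_gr x by case.
have XU r x : @stratum e0 r x -> exists U : 'M[k]_(d' i),
    (forall m (y : 'M[k]_(m, d' i)), inU x _ y <-> (y <= U)%MS) /\
    \rank U = (\sum_s e0 (us s) - r)%N.
  case=> hx _ rx; have [U [UP]] := preimage_rank (fun s => gr_mx x (us s)) kap_free kap_ker.
  rewrite -/(inflow x) rx (eq_bigr (fun s => e0 (us s))) => [rU|s _]; last exact: rref_rank.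
  by exists U; split=> //; rewrite -rU addnK.
have inv v : v != i -> forall m1 m2 (A : 'M_(m1, d' v)) (B : 'M_(m2, d' v)),
    (A *m th v <= B *m th v)%MS -> (A <= B)%MS.
  move=> vi m1 m2 A B h; have := submxMr (ps v) h.
  by rewrite -!mulmxA thps // !mulmx1.
have eZ z : sub_gr M' z <-> exists r : 'I_(d i).+1, true /\ Z r z.
  split.
    case=> hz sz; have [x [hx zx]] := away_eq_exists thps e0i e0e hz.
    have lt : (\rank (inflow x) < (d i).+1)%N by rewrite ltnS rank_leq_col.
    exists (Ordinal lt); split=> //; split=> //; exists x; split; [split|split] => //.
      move=> u v ui vi; have /andP[_ h] := zx u ui; have /andP[h' _] := zx v vi.
      apply: submx_trans h'; apply: submx_trans (submxMr _ h) _.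
      by rewrite -mulmxA -M'_away // mulmxA submxMr.
    move=> s; have /andP[h _] := zx _ (us_i s); apply: submx_trans h.
    by rewrite -M'_out mulmxA submxMr.
  case=> r [_ [hz [x [[hx sx rx] [zx Gx]]]]]; split=> // u v.
  have [->|vi] := eqVneq v i; first by rewrite M'_in mulmx0 sub0mx.
  have [->|ui] := eqVneq u i.
    case: (pickP (fun s => us s == v)) => [s /eqP su|hu]; last first.
      by rewrite M'_out0 ?mulmx0 ?sub0mx // => s; have /negbT := hu s.
    subst v; apply: (inv _ vi); rewrite -mulmxA M'_out.
    by have /andP[_ h] := zx _ vi; apply: submx_trans h.
  apply: (inv _ vi); rewrite -mulmxA M'_away // mulmxA.
  have /andP[h _] := zx u ui; have /andP[_ h'] := zx v vi.
  by apply: submx_trans h'; apply: submx_trans (sx u v ui vi); rewrite submxMr.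
rewrite (chi_ext chi eZ) (chi_partition hchi) //.
- apply: eq_bigr => r _; rewrite (@chi_fibred _ _ hchi _ _ _ _ _ _ th ps thps psth e0i e0e
    (@stratum e0 r) _ _ Good (T r)) //.
  + exact: constructible_stratum.
  + exact: Xr.
  + by move=> I p A hA; apply: cU.
  + move=> I p A B hA hB; apply: constructible_exmx.
    set w := (\sum_s e0 (us s) - r)%N.
    have: constructible (fun z : {ffun I + mx_idx w (d' i) -> k} =>
        rref (mx_of (restr inr z)) /\
        (inU (restr (fun t => inl (p t)) z) _ (mx_of (restr inr z)) /\
        (A (restr inl z) == (B (restr inl z) *m mx_of (restr inr z)))%MS)).
      have tA : mxtermable (fun z : {ffun I + mx_idx w (d' i) -> k} =>
        mx_of (restr inr z)) by apply/mxtermable_restr/mxtermable_mx_of.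
      apply: constructible_and; first exact: constructible_rref.
      apply: constructible_and; first exact: (@cU _ (fun t => inl (p t))).
      apply: constructible_eqMS; first exact: (mxtermable_restr inl hA).
      apply: mxtermable_mul => //; exact: (mxtermable_restr inl hB).
    apply: constructible_ext => z.
    rewrite (_ : restr (fun t => inl (p t)) z = restr p (restr inl z)).
      by split=> [[? []]|[]].
    by apply/ffunP=> t; rewrite !ffunE.
  + by move=> x R /XU[U [UP rU]] hR gR; apply: (below_to UP rU).
  by move=> x R1 /XU[U [UP rU]] hR; apply: (below_from UP rU).
- move=> r; apply: constructible_fibred => //; first exact: constructible_stratum.
  by move=> I p A hA; apply: cU.
move=> r r' z _ _ [hz [x [Xx [zx _]]]] [_ [x' [Xx' [zx' _]]]].
apply: ord_inj; have := away_eq_unique e0i (Xr _ _ Xx) (Xr _ _ Xx') zx zx'.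
by move=> xx; case: Xx Xx'; rewrite xx => _ _ <- [_ _ <-].
Qed.

End Reflected.
End Strata.

(** * F-polynomials *)

Section FPoly.
Variables (k : closedFieldType) (chi : forall I : finType, kset k I -> int).
Hypothesis hchi : euler_characteristic chi.
Variables (n : nat) (F : fieldType).

Definition fpoly (d : 'I_n -> nat) (M : forall u v, 'M[k]_(d u, d v)) (y : 'I_n -> F) : F :=
  \sum_(e : {dffun forall v, 'I_(d v).+1})
    (chi (sub_gr M (e := fun v => e v)))%:~R * \prod_v y v ^+ e v.

Lemma chi_sub_gr0 (d : 'I_n -> nat) (M : forall u v, 'M[k]_(d u, d v)) e v :
  (d v < e v)%N -> chi (sub_gr M (e := e)) = 0.
Proof.
move=> lt; apply: (chi_empty hchi) => x [hx _].
by have := rref_gr_le v hx; rewrite leqNgt lt.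
Qed.

(** A common range for the dimension vectors of two representations, so that
    their F-polynomials can be compared term by term. *)
Lemma fpoly_bound N d (M : forall u v, 'M[k]_(d u, d v)) y :
  (forall v, d v <= N)%N ->
  fpoly M y = \sum_(e : {ffun 'I_n -> 'I_N.+1})
    (chi (sub_gr M (e := fun v => e v)))%:~R * \prod_v y v ^+ e v.
Proof.
move=> dN.
rewrite [RHS](bigID (fun e : {ffun 'I_n -> 'I_N.+1} => [forall v, e v <= d v]%N)) /=.
rewrite [X in _ = _ + X]big1 ?addr0; last first.
  move=> e; rewrite negb_forall => /existsP[v]; rewrite -ltnNge => lt.
  by rewrite (chi_sub_gr0 M (e := fun v => e v) lt) mul0r.
pose h (e : {dffun forall v, 'I_(d v).+1}) : {ffun 'I_n -> 'I_N.+1} :=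
  [ffun v => inord (e v)].
pose g (e : {ffun 'I_n -> 'I_N.+1}) : {dffun forall v, 'I_(d v).+1} :=
  [ffun v => inord (e v) : 'I_(d v).+1].
have hE e v : h e v = e v :> nat.
  by rewrite ffunE inordK // ltnS (leq_trans _ (dN v)) // -ltnS.
have gE (e : {ffun 'I_n -> 'I_N.+1}) v : (e v <= d v)%N -> g e v = e v :> nat.
  by move=> le; rewrite ffunE inordK.
rewrite (reindex_onto h g) => [|e /forallP le]; last first.
  by apply/ffunP=> v; apply: val_inj; rewrite /= hE gE.
apply: eq_big => [e|e _].
  apply/esym/andP; split; first by apply/forallP => v; rewrite hE -ltnS.
  by apply/eqP/ffunP=> v; apply: val_inj; rewrite /= gE hE // -ltnS.
have -> : (fun v => nat_of_ord (h e v)) = (fun v => nat_of_ord (e v)).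
  by apply: functional_extensionality => v; rewrite hE.
by congr (_ * _); apply: eq_bigr => v _; rewrite hE.
Qed.

Definition upd N (e : {ffun 'I_n -> 'I_N.+1}) i (a : 'I_N.+1) : {ffun 'I_n -> 'I_N.+1} :=
  [ffun v => if v == i then a else e v].

Lemma sum_upd N i (G : {ffun 'I_n -> 'I_N.+1} -> F) :
  \sum_e G e = \sum_(e0 : {ffun 'I_n -> 'I_N.+1} | e0 i == ord0) \sum_a G (upd e0 i a).
Proof.
rewrite (partition_big (fun e => upd e i ord0)
  (fun e0 : {ffun 'I_n -> 'I_N.+1} => e0 i == ord0)) /=; last first.
  by move=> e _; rewrite ffunE eqxx.
apply: eq_bigr => e0 /eqP e00.
rewrite (reindex_onto (upd e0 i) (fun e : {ffun 'I_n -> 'I_N.+1} => e i)) /= => [|e /eqP <-].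
  apply: eq_bigl => a; rewrite ffunE eqxx eqxx andbT; apply/eqP/ffunP=> v.
  by rewrite !ffunE; case: eqP => // ->.
by apply/ffunP=> v; rewrite !ffunE; case: eqP => // ->.
Qed.

Lemma binom_source (y : F) r d : (r <= d)%N ->
  \sum_(a < d.+1) 'C(d - r, d - a)%:R * y ^+ a = y ^+ r * (1 + y) ^+ (d - r).
Proof.
move=> rd; rewrite (reindex_inj rev_ord_inj) /=.
rewrite [1 + y]addrC exprDn mulr_sumr.
rewrite -(big_mkord predT (fun b => 'C(d - r, d - (d.+1 - b.+1))%:R * y ^+ (d.+1 - b.+1))).
rewrite (big_cat_nat (n := (d - r).+1)) ?ltnS ?leq_subr //= [X in _ + X]big_nat_cond.
rewrite [X in _ + X]big1 ?addr0; last first.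
  move=> b /andP[/andP[h1 h2] _]; rewrite subSS subKn // bin_small ?mul0r //.
rewrite big_mkord; apply: eq_bigr => b _.
have bd : (b <= d)%N by apply: leq_trans (leq_subr r d); rewrite -ltnS.
have bd' : (b <= d - r)%N by rewrite -ltnS.
rewrite subSS subKn // expr1n mulr1 mulr_natl mulrnAr -exprD; congr (_ ^+ _ *+ _).
by lia.
Qed.

Lemma binom_trunc (y : F) w N : (w <= N)%N ->
  \sum_(a < N.+1) 'C(w, a)%:R * y ^+ a = (1 + y) ^+ w.
Proof.
move=> wN; rewrite -(big_mkord predT (fun a => 'C(w, a)%:R * y ^+ a)).
rewrite (big_cat_nat (n := w.+1)) ?ltnS //= [X in _ + X]big_nat_cond.
rewrite [X in _ + X]big1 ?addr0; last first.
  by move=> b /andP[/andP[h1 h2] _]; rewrite bin_small ?mul0r.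
rewrite big_mkord exprDn; apply: eq_bigr => b _.
by rewrite expr1n mul1r mulr_natl.
Qed.

Section Reflect.
Variables (i : 'I_n) (a : nat) (us : 'I_a -> 'I_n).
Variables (d : 'I_n -> nat) (M : forall u v, 'M[k]_(d u, d v)).
Hypothesis us_i : forall s, us s != i.
Hypothesis M_in : forall u, (forall s, us s != u) -> M u i = 0.
Hypothesis M_out : forall v, M i v = 0.
Variables (d' : 'I_n -> nat) (M' : forall u v, 'M[k]_(d' u, d' v)).
Variables (th : forall v, 'M[k]_(d' v, d v)) (ps : forall v, 'M[k]_(d v, d' v)).
Variable kap : 'M[k]_(d' i, (\sum_s d (us s))%N).
Hypothesis thps : forall v, v != i -> th v *m ps v = 1%:M.
Hypothesis psth : forall v, v != i -> ps v *m th v = 1%:M.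
Hypothesis M'_away : forall u v, u != i -> v != i -> M' u v *m th v = th u *m M u v.
Hypothesis M'_out : forall s, M' i (us s) *m th (us s) = submxrow kap s.
Hypothesis M'_out0 : forall v, (forall s, us s != v) -> M' i v = 0.
Hypothesis M'_in : forall u, M' u i = 0.
Hypothesis kap_free : row_free kap.
Hypothesis kap_ker : (kap == kermx (\mxcol_s M (us s) i))%MS.
Variable c : 'I_n -> nat.
Hypothesis c_us : forall f : 'I_n -> nat, (\sum_s f (us s) = \sum_v c v * f v)%N.
Variables (y y' : 'I_n -> F).
Hypothesis yi0 : y i != 0.
Hypothesis yi1 : 1 + y i != 0.
Hypothesis y'i : y' i = (y i)^-1.
Hypothesis y'v : forall v, v != i -> (0 < d v)%N -> y' v = y v / (1 + (y i)^-1) ^+ c v.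

(** Both sides split over the dimensions away from [i] and the strata [r].  The
    sum over the dimension at [i] is [y i ^+ r * (1 + y i) ^+ (d i - r)] on the
    left and [(1 + (y i)^-1) ^+ (w - r)] on the right, where [w] is the total
    dimension of the components at the sources of the arrows into [i]; the
    powers of [1 + (y i)^-1] in the denominators of the [y' v] multiply to the
    power [w], and [r] drops out of the quotient. *)
Lemma fpoly_reflect : fpoly M y = (1 + y i) ^+ d i * fpoly M' y'.
Proof.
pose N := (\max_v (d v + d' v))%N.
have dN v : (d v <= N)%N by apply: leq_trans (leq_bigmax v); rewrite leq_addr.
have d'N v : (d' v <= N)%N by apply: leq_trans (leq_bigmax v); rewrite leq_addl.
rewrite (fpoly_bound M y dN) (fpoly_bound M' y' d'N) !(sum_upd i) mulr_sumr.
apply: eq_bigr => e0 /eqP e00.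
pose E0 v := nat_of_ord (e0 v).
have E0i : E0 i = 0%N by rewrite /E0 e00.
have E0e (b : 'I_N.+1) v : v != i -> E0 v = upd e0 i b v.
  by move=> vi; rewrite ffunE (negPf vi).
have prodE (z : 'I_n -> F) (b : 'I_N.+1) :
    \prod_v z v ^+ upd e0 i b v = (\prod_(v | v != i) z v ^+ E0 v) * z i ^+ b.
  rewrite (bigD1 i) //= mulrC ffunE eqxx; congr (_ * _).
  by apply: eq_bigr => v vi; rewrite -(E0e b).
pose x r := chi (@stratum k n i a us d M E0 r).
have updi (b : 'I_N.+1) : nat_of_ord (upd e0 i b i) = b by rewrite ffunE eqxx.
pose w := (\sum_s E0 (us s))%N.
transitivity (\sum_(r < (d i).+1) (x r)%:~R * ((\prod_(v | v != i) y v ^+ E0 v)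
    * (y i ^+ r * (1 + y i) ^+ (d i - r)))).
  transitivity (\sum_(b < (d i).+1) \sum_(r < (d i).+1) (x r)%:~R *
     ((\prod_(v | v != i) y v ^+ E0 v) * ('C(d i - r, d i - b)%:R * y i ^+ b))).
    have ext (G : nat -> F) : (forall b, (d i < b <= N)%N -> G b = 0) ->
        \sum_(b < N.+1) G b = \sum_(b < (d i).+1) G b.
      move=> G0; rewrite -!(big_mkord predT) (big_cat_nat (n := (d i).+1)) ?ltnS //=.
      rewrite [X in _ + X]big_nat_cond [X in _ + X]big1 ?addr0 // => b.
      by rewrite andbT ltnS => /G0.
    pose G b := (if (b <= d i)%N then \sum_(r < (d i).+1) (x r)%:~R *
       ((\prod_(v | v != i) y v ^+ E0 v) * ('C(d i - r, d i - b)%:R * y i ^+ b)) else 0).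
    transitivity (\sum_(b < N.+1) G b).
      apply: eq_bigr => b _; rewrite prodE /G; case: leqP => [le|lt]; last first.
        by rewrite (chi_sub_gr0 M (e := fun v => upd e0 i b v) (v := i)) ?mul0r ?updi.
      rewrite (chi_sink hchi us_i M_in M_out
        (e := fun v => upd e0 i b v) E0i (E0e b)) ?updi //.
      rewrite rmorph_sum mulr_suml; apply: eq_bigr => r _; rewrite rmorphM /=.
      by rewrite -pmulrn -/(x r); ring.
    rewrite ext => [|b /andP[lt _]]; last by rewrite /G leqNgt lt.
    by apply: eq_bigr => b _; rewrite /G -ltnS ltn_ord.
  rewrite exchange_big; apply: eq_bigr => r _ /=; rewrite -mulr_sumr; congr (_ * _).
  by rewrite -mulr_sumr binom_source // -ltnS.
transitivity (\sum_(r < (d i).+1) (x r)%:~R * ((1 + y i) ^+ d i *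
    ((\prod_(v | v != i) y' v ^+ E0 v) * (1 + y' i) ^+ (w - r)))).
  (* an empty stratum contributes nothing, and a nonempty one bounds the
     dimensions *)
  apply: eq_bigr => r _; have [->|xr] := eqVneq (x r) 0; first by rewrite !mul0r.
  have [Ed rw ww] : [/\ forall v, (E0 v <= d v)%N, (r <= w)%N & (w - r <= d' i)%N].
    have [/and3P[/forallP h1 h2 h3]|nh] := boolP
        [&& [forall v, (E0 v <= d v)%N], (r <= w)%N & (w - r <= d' i)%N].
      by [].
    case/eqP: xr; apply: (chi_empty hchi) => z /(stratum_bounds kap_free kap_ker)[h1 h2 h3].
    by move: nh; rewrite h2 h3 !andbT; case/negP; apply/forallP.
  have rd : (r <= d i)%N by rewrite -ltnS.
  congr (_ * _); pose q := 1 + (y i)^-1.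
  have q0 : q != 0.
    have -> : q = (1 + y i) / y i by rewrite /q; field.
    by rewrite mulf_neq0 ?invr_eq0.
  have yq : 1 + y i = y i * q by rewrite /q; field.
  have -> : \prod_(v | v != i) y' v ^+ E0 v = (\prod_(v | v != i) y v ^+ E0 v) / q ^+ w.
    have wE : w = (\sum_(v | v != i) c v * E0 v)%N.
      by rewrite /w (c_us E0) (bigD1 i) //= E0i muln0.
    rewrite wE expr_sum -prodfV -big_split /=.
    apply: eq_bigr => v vi; case: (posnP (d v)) => dv.
      by have := Ed v; rewrite dv leqn0 => /eqP->; rewrite muln0 !expr0 invr1 mulr1.
    by rewrite y'v // expr_div_n exprM.
  rewrite y'i -/q yq !exprMn.
  have -> : q ^+ d i = q ^+ (d i - r) * q ^+ r by rewrite -exprD subnK.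
  have -> : y i ^+ d i = y i ^+ (d i - r) * y i ^+ r by rewrite -exprD subnK.
  have -> : q ^+ w = q ^+ (w - r) * q ^+ r by rewrite -exprD subnK.
  have qt : q ^+ (w - r) != 0 by rewrite expf_neq0.
  have qr : q ^+ r != 0 by rewrite expf_neq0.
  by field; rewrite qt qr.
rewrite mulr_sumr; transitivity (\sum_(b < N.+1) \sum_(r < (d i).+1) (x r)%:~R *
    ((1 + y i) ^+ d i * ((\prod_(v | v != i) y' v ^+ E0 v) * ('C(w - r, b)%:R * y' i ^+ b)))).
  rewrite exchange_big; apply: eq_bigr => r _ /=; rewrite -mulr_sumr.
  have [->|xr] := eqVneq (x r) 0; first by rewrite !mul0r.
  congr (_ * _); rewrite -mulr_sumr -mulr_sumr binom_trunc //.
  case: (leqP (w - r) N) => // lt; case/eqP: xr; apply: (chi_empty hchi) => z.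
  case/(stratum_bounds kap_free kap_ker) => _ _ h.
  by move: lt; rewrite ltnNge (leq_trans h).
apply: eq_bigr => b _; rewrite prodE.
rewrite (chi_reflected hchi us_i thps psth M'_away M'_out M'_out0 M'_in kap_free kap_ker
  (e := fun v => upd e0 i b v) E0i (E0e b)) updi.
rewrite rmorph_sum mulr_suml mulr_sumr; apply: eq_bigr => r _; rewrite rmorphM /=.
by rewrite -pmulrn -/(x r) -/w; ring.
Qed.

End Reflect.

Lemma fpoly_simple i d (M : forall u v, 'M[k]_(d u, d v)) y :
  (forall v, M i v = 0) -> (forall v, d v = (v == i)) -> fpoly M y = 1 + y i.
Proof.
move=> M0 di; have dN v : (d v <= 1)%N by rewrite di leq_b1.
have Mz u v : M u v = 0.
  have [->|ui] := eqVneq u i; first exact: M0.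
  suff h m (A : 'M[k]_(m, d v)) : m = 0%N -> A = 0 by apply: h; rewrite di (negPf ui).
  by move=> m0; subst m; rewrite flatmx0.
rewrite (fpoly_bound M y dN) (sum_upd i) (bigD1 [ffun => ord0]) ?ffunE //=.
rewrite [X in _ + X]big1 ?addr0; last first.
  move=> e /andP[/eqP ei en]; apply: big1 => b _.
  have [v vi ev] : exists2 v, v != i & (0 < e v)%N.
    case: (pickP (fun v => (v != i) && (0 < e v)%N)) => [v /andP[]|h]; first by exists v.
    case/eqP: en; apply/ffunP=> v; rewrite ffunE; apply: val_inj => /=.
    have [->|vi] := eqVneq v i; first by rewrite ei.
    by have := h v; rewrite vi /=; case: (nat_of_ord (e v)).
  rewrite (chi_sub_gr0 M (e := fun v => upd e i b v) (v := v)) ?mul0r //.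
  by rewrite di (negPf vi) ffunE (negPf vi).
rewrite big_ord_recl big_ord1.
have prodE (b : 'I_2) : \prod_v y v ^+ upd [ffun => ord0] i b v = y i ^+ b.
  rewrite (bigD1 i) //= ffunE eqxx big1 ?mulr1 // => v vi.
  by rewrite !ffunE (negPf vi).
have one (b : 'I_2) : chi (sub_gr M (e := fun v => upd [ffun => ord0] i b v)) = 1.
  pose e v := nat_of_ord (upd [ffun => ord0] i b v).
  have ei : e i = b by rewrite /e ffunE eqxx.
  have ev v : v != i -> e v = 0%N by move=> vi; rewrite /e !ffunE (negPf vi).
  have [|x [hx _]] := @rref_gr_exists k n d e d (fun v => diag_mx (const_mx (e v != 0%N)%:R)).
    move=> v; have [->|vi] := eqVneq v i; last first.
      rewrite ev //.
      have := rank_leq_row (diag_mx (const_mx (0 != 0 :> nat)%:R) : 'M[k]_(d v)).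
      by rewrite di (negPf vi) leqn0 => /eqP.
    rewrite ei diag_const_mx; case: b @e ei ev => -[|[|//]] lt e ei ev /=.
      by rewrite raddf0 mxrank0.
    by rewrite mxrank1 di eqxx.
  rewrite -(ec_point hchi x); apply: (chi_ext chi) => z; split=> [[hz _]|->].
    apply: rref_gr_unique => // v.
    have [->|vi] := eqVneq v i; last by apply: submx_norows; exact: ev.
    case/boolP: (b == ord0) => [/eqP b0|b1].
      by apply: submx_norows; rewrite b0 in ei; exact: ei.
    have eb : e i = 1%N by rewrite ei; case: (b) b1 => -[|[]].
    apply: submx_full; apply/row_fullP.
    have /eqP rx := rref_rank (hx i).
    have : row_full (gr_mx x i) by rewrite /row_full (rref_rank (hx i)) di eqxx; apply/eqP.
    by move/row_fullP.
  by split=> // u v; rewrite Mz mulmx0 sub0mx.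
rewrite !prodE /= !one !mul1r expr0; congr (_ + _).
Qed.

End FPoly.

(** * Reflections of representations *)

Section Reflection.
Variables (k : closedFieldType) (n : nat).
Implicit Types d : 'I_n -> nat.

(** The identity matrix when [m = p].  It replaces a cast along an equality of
    dimensions by a matrix product. *)
Definition idmx_cast m p : 'M[k]_(m, p) := \matrix_(a, b) (a == b :> nat)%:R.

Lemma idmx_castE m : idmx_cast m m = 1%:M.
Proof. by apply/matrixP=> a b; rewrite !mxE. Qed.

Lemma idmx_castK m p : m = p -> idmx_cast m p *m idmx_cast p m = 1%:M.
Proof. by move=> mp; subst p; rewrite idmx_castE mul1mx. Qed.

(** For a representation of finite dimension this amounts to indecomposability;
    in this form it passes to reflections at once, because these have the same
    endomorphism ring. *)
Definition trivial_idempotents d (M : forall u v, 'M[k]_(d u, d v)) : Prop :=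
  (exists v, 0 < d v)%N /\
  forall f : forall v, 'M[k]_(d v),
    (forall u v, M u v *m f v = f u *m M u v) -> (forall v, f v *m f v = f v) ->
    (forall v, f v = 0) \/ (forall v, f v = 1%:M).

(** A projection of [V_i] onto a complement of the image of the incoming maps
    extends by 0 to an idempotent endomorphism.  If it is not 0 it is 1, so the
    representation lives at [i], where every idempotent matrix is an
    endomorphism. *)
Lemma sink_dichotomy i a (us : 'I_a -> 'I_n) d (M : forall u v, 'M[k]_(d u, d v)) :
  (forall s, us s != i) -> (forall u, (forall s, us s != u) -> M u i = 0) ->
  (forall v, M i v = 0) -> trivial_idempotents M -> (0 < d i)%N ->
  (forall v, d v = (v == i)) \/ row_full (\mxcol_s M (us s) i).
Proof.
move=> us_i M_in M_out [_ hM] di; have [|nfull] := boolP (row_full _); [by right|left].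
pose ext (P : 'M[k]_(d i)) v : 'M[k]_(d v) :=
  (v == i)%:R *: (idmx_cast (d v) (d i) *m P *m idmx_cast (d i) (d v)).
have exti P : ext P i = P by rewrite /ext eqxx scale1r !idmx_castE mulmx1 mul1mx.
have ext0 P v : v != i -> ext P v = 0 by move=> vi; rewrite /ext (negPf vi) scale0r.
have extP P : (forall u, M u i *m P = 0) -> P *m P = P -> P != 0 ->
    forall v, ext P v = 1%:M.
  move=> MP PP P0; case: (hM (ext P)) => //.
  - move=> u v; have [->|ui] := eqVneq u i; first by rewrite M_out mul0mx mulmx0.
    rewrite (ext0 _ _ ui) mul0mx; have [->|vi] := eqVneq v i; first by rewrite exti.
    by rewrite ext0 ?mulmx0.
  - move=> v; have [->|vi] := eqVneq v i; first by rewrite exti.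
    by rewrite ext0 ?mulmx0.
  by move/(_ i); rewrite exti => /eqP; rewrite (negPf P0).
set phi := \mxcol_s M (us s) i in nfull.
(* [Q] projects onto the row space of [phi] *)
pose Q := pinvmx phi *m phi.
have phiQ : phi *m Q = phi by rewrite /Q mulmxA mulmxKpV.
have QQ : Q *m Q = Q by rewrite /Q -mulmxA phiQ.
have P0 : 1%:M - Q != 0.
  by apply: contra nfull; rewrite subr_eq0 => /eqP hQ; apply/row_fullP; exists (pinvmx phi).
have Mphi u : (M u i <= phi)%MS.
  case: (pickP (fun s => us s == u)) => [s /eqP <-|h].
    by rewrite -[X in (X <= _)%MS](mxcolK (fun s => M (us s) i)) rowsub_sub.
  by rewrite M_in ?sub0mx // => s; have /negbT := h s.
have eP : forall v, ext (1%:M - Q) v = 1%:M.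
  apply: extP => //.
    move=> u; have /submxP[D ->] := Mphi u.
    by rewrite mulmxBr mulmx1 -mulmxA phiQ subrr.
  by rewrite mulmxBl mul1mx mulmxBr mulmx1 QQ subrr subr0.
have dv0 v : v != i -> d v = 0%N.
  move=> vi; have := eP v; rewrite ext0 //; case: (d v) => // m /matrixP/(_ 0 0).
  by rewrite !mxE => /eqP; rewrite eq_sym oner_eq0.
have Mz u : M u i = 0.
  have [->|ui] := eqVneq u i; first exact: M_out.
  suff h m (A : 'M[k]_(m, d i)) : m = 0%N -> A = 0 by apply: h; apply: dv0.
  by move=> m0; subst m; rewrite flatmx0.
pose o := Ordinal di.
have : forall v, ext (delta_mx o o) v = 1%:M.
  apply: extP => [u||]; first by rewrite Mz mul0mx.
    by rewrite mul_delta_mx.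
  by apply/eqP=> /matrixP/(_ o o); rewrite !mxE !eqxx => /eqP; rewrite oner_eq0.
move/(_ i); rewrite exti => /matrixP delta1 v.
have [->|/dv0->//] := eqVneq v i; apply/eqP; rewrite eqn_leq di andbT leqNgt.
apply/negP=> lt; have := delta1 (Ordinal lt) (Ordinal lt).
by rewrite !mxE eqxx -val_eqE /= => /eqP; rewrite eq_sym oner_eq0.
Qed.

(** [M'] is the reflection of [M] at the vertex [i], whose incoming arrows start at
    the [us s]: [kap] identifies its space at [i] with the kernel of the incoming maps, and
    [th], [ps] identify the spaces at the other vertices. *)
Record reflection (i : 'I_n) a (us : 'I_a -> 'I_n)
    d (M : forall u v, 'M[k]_(d u, d v)) d' (M' : forall u v, 'M[k]_(d' u, d' v))
    (th : forall v, 'M[k]_(d' v, d v)) (ps : forall v, 'M[k]_(d v, d' v))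
    (kap : 'M[k]_(d' i, (\sum_s d (us s))%N)) : Prop := Reflection {
  rf_thps : forall v, v != i -> th v *m ps v = 1%:M;
  rf_psth : forall v, v != i -> ps v *m th v = 1%:M;
  rf_away : forall u v, u != i -> v != i -> M' u v *m th v = th u *m M u v;
  rf_out : forall s, M' i (us s) *m th (us s) = submxrow kap s;
  rf_out0 : forall v, (forall s, us s != v) -> M' i v = 0;
  rf_in : forall u, M' u i = 0;
  rf_free : row_free kap;
  rf_ker : (kap == kermx (\mxcol_s M (us s) i))%MS }.

Section Reflect.
Variables (i : 'I_n) (a : nat) (us : 'I_a -> 'I_n).
Variables (d : 'I_n -> nat) (M : forall u v, 'M[k]_(d u, d v)).
Hypothesis us_inj : injective us.
Hypothesis us_i : forall s, us s != i.
Hypothesis M_in : forall u, (forall s, us s != u) -> M u i = 0.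
Hypothesis M_out : forall v, M i v = 0.
Local Notation phi := (\mxcol_s M (us s) i).
Hypothesis phi_full : row_full phi.

Lemma reflection_exists : exists d' (M' : forall u v, 'M[k]_(d' u, d' v)) th ps kap,
  [/\ @reflection i a us d M d' M' th ps kap,
      forall v, v != i -> d' v = d v
    & (d' i + d i = \sum_s d (us s))%N].
Proof.
pose q := \rank (kermx phi).
pose d' v := if v == i then q else d v.
have d'i : d' i = q by rewrite /d' eqxx.
have d'v v : v != i -> d' v = d v by rewrite /d' => /negPf->.
pose th v := idmx_cast (d' v) (d v); pose ps v := idmx_cast (d v) (d' v).
pose kap := idmx_cast (d' i) q *m row_base (kermx phi).
have kapE : row_base (kermx phi) = idmx_cast q (d' i) *m kap.
  by rewrite /kap mulmxA idmx_castK ?mul1mx.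
pose M' u v : 'M[k]_(d' u, d' v) := if v == i then 0 else
  if u == i then
    if [pick s | us s == v] is Some s
    then idmx_cast (d' u) (d' i) *m submxrow kap s *m idmx_cast (d (us s)) (d' v) else 0
  else th u *m M u v *m ps v.
exists d', M', th, ps, kap; split=> //; last first.
  have rphi : \rank phi = d i by apply/eqP.
  rewrite d'i /q mxrank_ker rphi subnK // -[X in (X <= _)%N]rphi rank_leq_row //.
have thps v : v != i -> th v *m ps v = 1%:M by move=> vi; apply: idmx_castK; apply: d'v.
have psth v : v != i -> ps v *m th v = 1%:M.
  by move=> vi; apply: idmx_castK; rewrite d'v.
split=> //.
- move=> u v ui vi; rewrite /M' (negPf vi) (negPf ui).
  by rewrite -mulmxA psth // mulmx1.
- move=> s; rewrite /M' (negPf (us_i s)) eqxx; case: pickP => [s' /eqP/us_inj->|/(_ s)].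
    by rewrite idmx_castE mul1mx -mulmxA psth // mulmx1.
  by rewrite eqxx.
- move=> v hv; rewrite /M' eqxx; case: eqP => // _; case: pickP => // s.
  by rewrite (negPf (hv s)).
- by move=> u; rewrite /M' eqxx.
- rewrite /row_free; apply/eqP.
  have := eq_row_base (kermx phi); have := row_base_free (kermx phi).
  rewrite kapE /row_free -/q => /eqP rk _.
  apply/eqP; rewrite eqn_leq rank_leq_row /= {1}d'i -{1}rk mxrankM_maxr //.
apply/andP; split.
  by rewrite /kap; apply: submx_trans (submxMl _ _) _; rewrite eq_row_base.
by rewrite -(eq_row_base (kermx phi)) kapE submxMl.
Qed.

Variables (d' : 'I_n -> nat) (M' : forall u v, 'M[k]_(d' u, d' v)).
Variables (th : forall v, 'M[k]_(d' v, d v)) (ps : forall v, 'M[k]_(d v, d' v)).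
Variable kap : 'M[k]_(d' i, (\sum_s d (us s))%N).
Hypothesis R : reflection M M' th ps kap.
Hypothesis d'_away : forall v, v != i -> d' v = d v.

(** An idempotent endomorphism [f'] of the reflection acts on the sources of the
    arrows into [i] compatibly with the kernel of the incoming map [phi]; hence
    it induces an endomorphism of the target [V_i] of [phi], which is idempotent
    and completes [f'] away from [i] to an endomorphism of the original
    representation. *)
Lemma trivial_idempotents_reflection :
  (0 < d i)%N -> trivial_idempotents M -> trivial_idempotents M'.
Proof.
move=> di [_ hM]; case: R => thps psth Ma Mo Mo0 Mi kf kk; split.
  have : (0 < \sum_s d (us s))%N.
    by apply: leq_trans di _; move/eqP: phi_full => <-; rewrite rank_leq_row.
  case: (pickP (fun s => 0 < d (us s))%N) => [s hs _|h].
    by exists (us s); rewrite d'_away.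
  by rewrite big1 // => s _; have := h s; case: (d (us s)).
move=> f' hf' ff'.
pose g v := ps v *m f' v *m th v.
pose F := \mxdiag_s g (us s).
have gg v : v != i -> g v *m g v = g v.
  move=> vi; rewrite /g !mulmxA -(mulmxA _ (th v)) thps // mulmx1.
  by rewrite -(mulmxA (ps v)) ff'.
have gf v : v != i -> f' v = th v *m g v *m ps v.
  move=> vi; rewrite /g !mulmxA thps // mul1mx -!mulmxA thps // mulmx1 //.
pose fi := pinvmx phi *m F *m phi.
(* [f'] preserves the kernel of [phi] *)
have kF : kap *m F = f' i *m kap.
  rewrite -[kap]submxrowK mul_mxrow_mxdiag mul_mxrow; apply: eq_mxrow => s.
  rewrite -!Mo /g !mulmxA -(mulmxA (M' _ _)) thps // mulmx1.
  by rewrite hf'.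
have kphi : kap *m phi = 0 by apply/sub_kermxP; case/andP: kk.
have phifi : phi *m fi = F *m phi.
  have e : phi *m fi - F *m phi = (phi *m pinvmx phi - 1%:M) *m (F *m phi).
    by rewrite mulmxBl mul1mx /fi; congr (_ - _); rewrite -!(mulmxA phi) -(mulmxA _ F).
  apply/eqP; rewrite -subr_eq0 e.
  have /submxP[C ->] : (phi *m pinvmx phi - 1%:M <= kap)%MS.
    case/andP: kk => _; apply: submx_trans; apply/sub_kermxP.
    by rewrite mulmxBl mul1mx mulmxKpV // subrr.
  by rewrite -(mulmxA C) (mulmxA kap) kF -(mulmxA _ kap) kphi !mulmx0.
have cancel_phi m (A B : 'M[k]_(d i, m)) : phi *m A = phi *m B -> A = B.
  move=> h; rewrite -[A]mul1mx -[B]mul1mx -(mulVpmx phi_full) -!mulmxA h //.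
pose f v : 'M[k]_(d v) := if v == i then idmx_cast (d v) (d i) *m fi *m idmx_cast (d i) (d v)
  else g v.
have fE : f i = fi by rewrite /f eqxx !idmx_castE mul1mx mulmx1.
have fv v : v != i -> f v = g v by rewrite /f => /negPf->.
have Fphi : F *m phi = \mxcol_s (g (us s) *m M (us s) i) by rewrite mul_mxdiag_mxcol.
have hom u v : M u v *m f v = f u *m M u v.
  have [->|ui] := eqVneq u i; first by rewrite M_out mul0mx mulmx0.
  have [->|vi] := eqVneq v i.
    rewrite fE fv //; case: (pickP (fun s => us s == u)) => [s /eqP su|h]; last first.
      by rewrite M_in ?mul0mx ?mulmx0 // => s; have /negbT := h s.
    have := congr1 (fun B => submxcol B s) phifi.
    by rewrite Fphi mxcolK mxcol_mul mxcolK su.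
  rewrite !fv //.
  have e1 : M u v = ps u *m M' u v *m th v by rewrite -mulmxA Ma // mulmxA psth // mul1mx.
  rewrite /g !mulmxA {1}e1 -!mulmxA (mulmxA (th v)) thps // mul1mx.
  by rewrite (mulmxA (M' u v)) hf' -Ma // !mulmxA.
case: (hM f hom).
- move=> v; have [->|vi] := eqVneq v i; last by rewrite fv ?gg.
  rewrite fE; apply: cancel_phi; rewrite mulmxA phifi -mulmxA phifi.
  rewrite Fphi mul_mxdiag_mxcol; apply: eq_mxcol => s.
  by rewrite mulmxA gg.
- move=> f0; left; have f'0 v : v != i -> f' v = 0.
    by move=> vi; rewrite gf // -fv // f0 mulmx0 mul0mx.
  move=> v; have [->|/f'0//] := eqVneq v i.
  apply: (row_free_inj kf); rewrite mul0mx -kF -[kap]submxrowK mul_mxrow_mxdiag.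
  rewrite -mxrow0; apply: eq_mxrow => s; by rewrite -fv // f0 mulmx0.
move=> f1; right; have f'1 v : v != i -> f' v = 1%:M.
  by move=> vi; rewrite gf // -fv // f1 mulmx1 thps.
move=> v; have [->|/f'1//] := eqVneq v i.
apply: (row_free_inj kf); rewrite mul1mx -kF -[in LHS](submxrowK kap) mul_mxrow_mxdiag.
rewrite -[RHS]submxrowK; apply: eq_mxrow => s; by rewrite -fv // f1 mulmx1.
Qed.

End Reflect.
End Reflection.

(** * The Tits form and the Euler form *)

Section Forms.
Variable n : nat.
Implicit Types (E : 'I_n -> 'I_n -> bool) (d : 'I_n -> nat).

(** The arrows out of [i] are dropped.  In the application the representation
    vanishes at their targets, and without them [i] becomes a source. *)
Definition reflect_rel (i : 'I_n) E : 'I_n -> 'I_n -> bool := fun u v =>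
  if v == i then false else if u == i then E v i else E u v.

Definition tits E d : int :=
  \sum_v (d v)%:Z ^+ 2 - \sum_u \sum_v (E u v)%:Z * (d u)%:Z * (d v)%:Z.

(** The Euler form of the quiver [E] at [y] and [d]. *)
Definition pairing_form E (y d : 'I_n -> nat) : int :=
  \sum_v (y v)%:Z * (d v)%:Z - \sum_u \sum_v (E u v)%:Z * (y u)%:Z * (d v)%:Z.

(** The Cartan matrix of the underlying graph takes positive values at [y]. *)
Definition dominant E (y : 'I_n -> nat) : Prop :=
  (forall v, 0 < y v)%N /\
  forall i, (\sum_v (E v i + E i v) * y v < 2 * y i)%N.

Definition acyclic E : Prop :=
  exists h : 'I_n -> nat, forall u v, E u v -> (h v < h u)%N.

Lemma acyclic_irr E : acyclic E -> forall v, E v v = false.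
Proof. by case=> h hE v; apply/negP=> /hE; rewrite ltnn. Qed.

Lemma acyclic_reflect i E : acyclic E -> acyclic (reflect_rel i E).
Proof.
case=> h hE; exists (fun v => if v == i then (\sum_v h v).+1 else h v) => u v.
rewrite /reflect_rel; case: eqP => // vi; case: eqP => [_ _|_ /hE//].
by rewrite ltnS (bigD1 v) //= leq_addr.
Qed.

Lemma dominant_reflect i E y : dominant E y -> dominant (reflect_rel i E) y.
Proof.
case=> y0 yd; split=> // j; apply: leq_ltn_trans (yd j); apply: leq_sum => v _.
rewrite leq_mul2r; apply/orP; right; rewrite /reflect_rel.
by case: (eqVneq j i) => [->|ji]; case: (eqVneq v i) => [->|vi]; case: (E _ _); case: (E _ _).
Qed.

Lemma sum_split i (X : 'I_n -> 'I_n -> int) :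
  \sum_u \sum_v X u v = X i i + \sum_(v | v != i) X i v + \sum_(u | u != i) X u i
    + \sum_(u | u != i) \sum_(v | v != i) X u v.
Proof.
rewrite (bigD1 i) //= (bigD1 i) //= -!addrA; congr (_ + (_ + _)).
by rewrite -big_split; apply: eq_bigr => u ui /=; rewrite (bigD1 i).
Qed.

Lemma Posz_sum (P : pred 'I_n) (G : 'I_n -> nat) :
  (\sum_(v | P v) G v)%N%:Z = \sum_(v | P v) (G v)%:Z.
Proof. by rewrite -natz natr_sum; apply: eq_bigr => v _; rewrite natz. Qed.

Section OneReflection.
Variables (i : 'I_n) (E : 'I_n -> 'I_n -> bool) (d d' : 'I_n -> nat).
Hypothesis Eii : E i i = false.
Hypothesis Eout : forall v, (0 < d v)%N -> E i v = false.
Hypothesis d'v : forall v, v != i -> d' v = d v.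
Hypothesis d'i : (d' i + d i = \sum_v E v i * d v)%N.

Let Eout' v : (E i v)%:Z * (d v)%:Z = 0.
Proof. by case: (posnP (d v)) => [->|/Eout->]; rewrite ?mulr0 ?mul0r. Qed.

Let sumE : \sum_(v | v != i) (E v i)%:Z * (d v)%:Z = (d' i)%:Z + (d i)%:Z.
Proof.
rewrite -PoszD d'i [in RHS](bigD1 i) //= Eii mul0n add0n Posz_sum.
by apply: eq_bigr => v _; rewrite PoszM.
Qed.

Lemma tits_reflect : tits (reflect_rel i E) d' = tits E d.
Proof.
rewrite /tits (sum_split i (fun u v => (reflect_rel i E u v)%:Z * (d' u)%:Z * (d' v)%:Z)).
rewrite (sum_split i (fun u v => (E u v)%:Z * (d u)%:Z * (d v)%:Z)).
rewrite /reflect_rel eqxx Eii.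
rewrite (bigD1 i) //= [in RHS](bigD1 i) //=.
rewrite (eq_bigr (fun v => (d v)%:Z ^+ 2)) => [|v vi]; last by rewrite d'v.
set s2 := \sum_(v | v != i) _ ^+ 2.
have -> : \sum_(v | v != i) (if v == i then false else E v i)%:Z * (d' i)%:Z * (d' v)%:Z
   = (d' i)%:Z * ((d' i)%:Z + (d i)%:Z).
  rewrite -sumE mulr_sumr; apply: eq_bigr => v vi; rewrite (negPf vi) (d'v vi); ring.
have -> : \sum_(v | v != i) (E i v)%:Z * (d i)%:Z * (d v)%:Z = 0.
  by apply: big1 => v vi; rewrite mulrAC Eout' mul0r.
have -> : \sum_(u | u != i) (false)%:Z * (d' u)%:Z * (d' i)%:Z = 0.
  by apply: big1 => u _; rewrite !mul0r.
have -> : \sum_(v | v != i) (E v i)%:Z * (d v)%:Z * (d i)%:Z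
   = (d i)%:Z * ((d' i)%:Z + (d i)%:Z).
  by rewrite -sumE mulr_sumr; apply: eq_bigr => v vi; ring.
have -> : \sum_(u | u != i) \sum_(v | v != i)
    (if v == i then false else if u == i then E v i else E u v)%:Z * (d' u)%:Z * (d' v)%:Z
  = \sum_(u | u != i) \sum_(v | v != i) (E u v)%:Z * (d u)%:Z * (d v)%:Z.
  by do 2!apply: eq_bigr => ? ?; rewrite !ifN // ?d'v.
by ring.
Qed.

(** The reflection is an isometry from the Euler form of [E] to that of the
    reflected quiver, up to the dropped arrows, which only help; so reflecting
    [d] alone lowers the form by at least the product of [d i] and the
    coordinate at [i] of the image of [y] under the Cartan matrix. *)
Lemma pairing_form_reflect y : dominant E y -> (0 < d i)%N ->
  (pairing_form (reflect_rel i E) y d' < pairing_form E y d)%R.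
Proof.
case=> _ /(_ i) yd di.
rewrite /pairing_form.
rewrite (sum_split i (fun u v => (reflect_rel i E u v)%:Z * (y u)%:Z * (d' v)%:Z)).
rewrite (sum_split i (fun u v => (E u v)%:Z * (y u)%:Z * (d v)%:Z)).
rewrite /reflect_rel eqxx Eii.
rewrite (bigD1 i) //= [X in _ < X - _](bigD1 i) //=.
rewrite (eq_bigr (fun v => (y v)%:Z * (d v)%:Z)) => [|v vi]; last by rewrite d'v.
set s2 := \sum_(v | v != i) _ * _.
have -> : \sum_(v | v != i) (if v == i then false else E v i)%:Z * (y i)%:Z * (d' v)%:Z
   = (y i)%:Z * ((d' i)%:Z + (d i)%:Z).
  rewrite -sumE mulr_sumr; apply: eq_bigr => v vi; rewrite (negPf vi) (d'v vi); ring.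
have -> : \sum_(v | v != i) (E i v)%:Z * (y i)%:Z * (d v)%:Z = 0.
  by apply: big1 => v vi; rewrite mulrAC Eout' mul0r.
have -> : \sum_(u | u != i) (false)%:Z * (y u)%:Z * (d' i)%:Z = 0.
  by apply: big1 => u _; rewrite !mul0r.
have -> : \sum_(u | u != i) \sum_(v | v != i)
    (if v == i then false else if u == i then E v i else E u v)%:Z * (y u)%:Z * (d' v)%:Z
  = \sum_(u | u != i) \sum_(v | v != i) (E u v)%:Z * (y u)%:Z * (d v)%:Z.
  by do 2!apply: eq_bigr => ? ?; rewrite !ifN // ?d'v.
set s3 := \sum_(u | _) \sum_(v | _) _.
have le : \sum_(u | u != i) (E u i)%:Z * (y u)%:Z * (d i)%:Z
    <= (d i)%:Z * (2 * (y i)%:Z - 1).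
  have le1 : (\sum_(u | u != i) E u i * y u <= 2 * y i - 1)%N.
    have: (\sum_(u | u != i) E u i * y u <= \sum_v (E v i + E i v) * y v)%N.
      rewrite [X in (_ <= X)%N](bigD1 i) //=; apply: leq_trans (leq_addl _ _).
      by apply: leq_sum => u _; rewrite mulnDl leq_addr.
    by move: yd; lia.
  rewrite (eq_bigr (fun u => (d i)%:Z * (E u i * y u)%N%:Z)) => [|u _]; last first.
    by rewrite PoszM; ring.
  rewrite -mulr_sumr ler_wpM2l //.
  have -> : 2 * (y i)%:Z - 1 = (2 * y i - 1)%N%:Z by move: yd; lia.
  by rewrite -Posz_sum lez_nat.
set s4 := \sum_(u | u != i) _ in le *.
by move: le di; lia.
Qed.
End OneReflection.

(** Twice the Tits form is the sum of the [d v ^ 2 * c v / y v], where [c] is the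
    image of [y] under the Cartan matrix, and of the terms
    [y u * y v * (d u / y u - d v / y v) ^ 2] over the edges.  As [c v] is at
    least 1, one term [d w ^ 2 / y w] bounds [d w]. *)
Lemma tits_bound E y d w : dominant E y -> ((d w)%:Z <= 2 * tits E d * (y w)%:Z).
Proof.
case=> y0 yd.
pose D v : rat := (d v)%:R; pose Y v : rat := (y v)%:R.
have Y0 v : 0 < Y v by rewrite ltr0n.
have Yn v : Y v != 0 by rewrite gt_eqF.
pose a u v : rat := (E u v)%:R + (E v u)%:R.
have a0 u v : 0 <= a u v by rewrite addr_ge0 ?ler0n.
have titsE : (tits E d)%:~R * 2 = \sum_v 2 * D v ^+ 2 - \sum_u \sum_v a u v * D u * D v.
  rewrite /tits rmorphB /= !rmorph_sum /= mulrBl; congr (_ - _).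
    by rewrite mulr_suml; apply: eq_bigr => v _; rewrite rmorphXn /= -pmulrn mulrC.
  rewrite mulr2n mulrDr !mulr1.
  rewrite (eq_bigr (fun u => \sum_v (E u v)%:R * D u * D v)) => [|u _]; last first.
    by rewrite rmorph_sum; apply: eq_bigr => v _; rewrite !rmorphM /= -!pmulrn.
  rewrite [X in X + _]exchange_big /= -big_split; apply: eq_bigr => u _ /=.
  by rewrite -big_split; apply: eq_bigr => v _ /=; rewrite /a; ring.
have amgm u v : 2 * (D u * D v) <= D u ^+ 2 * (Y v / Y u) + D v ^+ 2 * (Y u / Y v).
  rewrite -subr_ge0.
  have -> : D u ^+ 2 * (Y v / Y u) + D v ^+ 2 * (Y u / Y v) - 2 * (D u * D v) =
    Y u * Y v * (D u / Y u - D v / Y v) ^+ 2.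
    by field; rewrite !Yn.
  by rewrite mulr_ge0 ?sqr_ge0 // mulr_ge0 // ltW.
(* the arithmetic-geometric inequality with weights [y] on each edge *)
have cross : \sum_u \sum_v a u v * D u * D v <= \sum_v D v ^+ 2 / Y v * (2 * Y v - 1).
  have h1 : 2 * (\sum_u \sum_v a u v * D u * D v) <=
      2 * \sum_v D v ^+ 2 / Y v * \sum_u a u v * Y u.
    apply: (@le_trans _ _ (\sum_u \sum_v
        a u v * (D u ^+ 2 * (Y v / Y u) + D v ^+ 2 * (Y u / Y v)))).
      rewrite mulr_sumr; apply: ler_sum => u _; rewrite mulr_sumr; apply: ler_sum => v _.
      by rewrite -mulrA mulrCA ler_wpM2l.
    rewrite mulr2n mulrDl !mul1r.
    under eq_bigr do under eq_bigr do rewrite mulrDr.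
    under eq_bigr do rewrite big_split.
    rewrite big_split /= lerD //.
      apply: ler_sum => u _; rewrite mulr_sumr; apply: ler_sum => v _.
      rewrite (_ : a u v = a v u) 1?[a _ _]addrC // le_eqVlt.
      by apply/orP; left; apply/eqP; field; rewrite ?Yn.
    rewrite exchange_big /=; apply: ler_sum => u _; rewrite mulr_sumr; apply: ler_sum => v _.
    by rewrite le_eqVlt; apply/orP; left; apply/eqP; field; rewrite ?Yn.
  move: h1; rewrite ler_pM2l // => h1; apply: le_trans h1 _; apply: ler_sum => v _.
  apply: ler_wpM2l; first by rewrite mulr_ge0 ?sqr_ge0 // invr_ge0 ltW.
  have: (\sum_u (E u v + E v u) * y u)%N%:R <= (2 * y v - 1)%N%:R :> rat.
    by rewrite ler_nat; move: (yd v); lia.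
  rewrite natr_sum natrB ?natrM ?muln_gt0 ?y0 // => h.
  apply: le_trans h; apply: ler_sum => u _; by rewrite natrM natrD lexx.
have main : \sum_v D v ^+ 2 / Y v <= (tits E d)%:~R * 2.
  rewrite titsE lerBrDr; apply: le_trans (lerD (lexx _) cross) _.
  rewrite -big_split /= ler_sum // => v _.
  by rewrite le_eqVlt; apply/orP; left; apply/eqP; field; rewrite ?Yn.
have w1 : D w <= D w ^+ 2.
  by rewrite /D; case: (d w) => [|m]; rewrite ?expr2 ?mul0r // ler_peMr ?ler1n ?ler0n.
have w2 : D w ^+ 2 / Y w <= \sum_v D v ^+ 2 / Y v.
  rewrite (bigD1 w) //= lerDl sumr_ge0 // => v _.
  by rewrite mulr_ge0 ?sqr_ge0 // invr_ge0 ltW.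
have : D w <= (tits E d)%:~R * 2 * Y w.
  by apply: le_trans w1 _; rewrite -ler_pdivrMr //; apply: le_trans w2 main.
by rewrite /D /Y -(ler_int rat) !rmorphM /= -!pmulrn (mulrC 2%:R).
Qed.

Definition form_bound (q : int) (y : 'I_n -> nat) : int :=
  \sum_u \sum_v (y u)%:Z * (2 * q * (y v)%:Z).

Lemma pairing_form_bound E y d : dominant E y ->
  0 <= pairing_form E y d + form_bound (tits E d) y.
Proof.
move=> hy; rewrite /pairing_form.
have le : \sum_u \sum_v (E u v)%:Z * (y u)%:Z * (d v)%:Z <= form_bound (tits E d) y.
  do 2!(apply: ler_sum => ? _).
  apply: le_trans (ler_wpM2l _ (tits_bound d _ hy)) => //.
  by case: (E _ _); rewrite ?mul1r // !mul0r mulr_ge0.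
have ge : 0 <= \sum_v (y v)%:Z * (d v)%:Z by apply: sumr_ge0 => v _; rewrite mulr_ge0.
lia.
Qed.

End Forms.

(** * Minima over dimension vectors of subrepresentations *)

Section SubDim.
Variables (k : closedFieldType) (n : nat).
Implicit Types d e : 'I_n -> nat.

Definition subdim d (M : forall u v, 'M[k]_(d u, d v)) e : Prop :=
  exists W : forall v, 'M[k]_(d v),
    (forall u v, (W u *m M u v <= W v)%MS) /\ (forall v, \rank (W v) = e v).

Lemma subdim_le d (M : forall u v, 'M[k]_(d u, d v)) e v : subdim M e -> (e v <= d v)%N.
Proof. by case=> W [_ <-]; apply: rank_leq_row. Qed.

Lemma subdim0 d (M : forall u v, 'M[k]_(d u, d v)) : subdim M (fun=> 0%N).
Proof. by exists (fun=> 0); split=> [u v|v]; rewrite ?mul0mx ?sub0mx ?mxrank0. Qed.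

Lemma subdim_full d (M : forall u v, 'M[k]_(d u, d v)) : subdim M d.
Proof. by exists (fun=> 1%:M); split=> [u v|v]; rewrite ?submx1 ?mxrank1. Qed.

Definition set_at (i : 'I_n) e (a : nat) : 'I_n -> nat := fun v => if v == i then a else e v.

(** Square matrices make the choice independent of the dimensions of the given
    subspaces. *)
Lemma glue_subspaces i d m (A : forall v, 'M[k]_(m v, d v)) p (B : 'M[k]_(p, d i)) :
  exists W : forall v, 'M[k]_(d v),
    (W i == B)%MS /\ forall v, v != i -> (W v == A v)%MS.
Proof.
exists (fun v => if v == i then idmx_cast k (d v) (d i) *m <<B>>%MS *m idmx_cast k (d i) (d v)
  else <<A v>>%MS); split.
  by rewrite eqxx !idmx_castE mul1mx mulmx1; apply/eqmxP/genmxE.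
by move=> v /negPf->; apply/eqmxP/genmxE.
Qed.

Definition is_min_on d (M : forall u v, 'M[k]_(d u, d v)) (c : 'I_n -> int) (mu : int) :=
  (exists e, subdim M e /\ \sum_v (e v)%:Z * c v = mu) /\
  (forall e, subdim M e -> mu <= \sum_v (e v)%:Z * c v).

Section Reflect.
Variables (i : 'I_n) (a : nat) (us : 'I_a -> 'I_n).
Variables (d : 'I_n -> nat) (M : forall u v, 'M[k]_(d u, d v)).
Hypothesis us_i : forall s, us s != i.
Hypothesis M_in : forall u, (forall s, us s != u) -> M u i = 0.
Hypothesis M_out : forall v, M i v = 0.
Variables (d' : 'I_n -> nat) (M' : forall u v, 'M[k]_(d' u, d' v)).
Variables (th : forall v, 'M[k]_(d' v, d v)) (ps : forall v, 'M[k]_(d v, d' v)).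
Variable kap : 'M[k]_(d' i, (\sum_s d (us s))%N).
Hypothesis R : reflection M M' th ps kap.

(** The two subrepresentations of the reflection have the largest and the
    smallest possible component at [i] for the given components away from
    [i]. *)
Lemma subdim_reflect e : subdim M e -> exists r t,
  [/\ (r <= e i)%N, (t + r = \sum_s e (us s))%N,
      subdim M' (set_at i e t) & subdim M' (set_at i e 0)].
Proof.
case=> W [sW rW]; case: R => thps psth Ma Mo Mo0 Mi kf kk.
have [U [UP rU]] := preimage_rank (fun s => W (us s)) kf kk.
have build m (B : 'M[k]_(m, d' i)) :
    (forall s, (B *m submxrow kap s <= W (us s))%MS) ->
    subdim M' (set_at i e (\rank B)).
  move=> hB; have [W' [Wi Wv]] := glue_subspaces (fun v => W v *m ps v) B.
  exists W'; split=> [u v|v]; last first.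
    rewrite /set_at; have [->|vi] := eqVneq v i; first exact: eqmx_rank.
    rewrite (eqmx_rank (Wv v vi)) mxrankMfree //.
    by apply/row_freeP; exists (th v); apply: psth.
  have [->|vi] := eqVneq v i; first by rewrite Mi mulmx0 sub0mx.
  have /andP[_ h2] := Wv v vi; apply: submx_trans h2.
  have [->|ui] := eqVneq u i.
    have /andP[h _] := Wi; apply: submx_trans (submxMr _ h) _.
    case: (pickP (fun s => us s == v)) => [s /eqP su|hu]; last first.
      by rewrite Mo0 ?mulmx0 ?sub0mx // => s; have /negbT := hu s.
    subst v; have := submxMr (ps (us s)) (hB s); rewrite -Mo mulmxA.
    by rewrite -(mulmxA (B *m _)) thps // mulmx1.
  have /andP[h _] := Wv u ui; apply: submx_trans (submxMr _ h) _.
  have -> : W u *m ps u *m M' u v = W u *m M u v *m ps v.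
    rewrite -[M' u v]mulmx1 -(thps v vi) [M' u v *m _]mulmxA Ma //.
    by rewrite !mulmxA -(mulmxA (W u)) psth // mulmx1.
  by rewrite submxMr.
exists (\rank (\mxcol_s (W (us s) *m M (us s) i))), (\rank U); split.
- by rewrite -rW; apply/mxrankS/mxcol_submx => s.
- by rewrite rU; apply: eq_bigr => s _.
- by apply: build; apply/UP; apply: submx_refl.
rewrite -[X in set_at i e X](mxrank0 k 1 (d' i)); apply: build => s.
by rewrite mul0mx sub0mx.
Qed.

Lemma subdim_unreflect e : subdim M' e -> exists r,
  [/\ (e i + r <= \sum_s e (us s))%N, subdim M (set_at i e r)
    & subdim M (set_at i e (d i))].
Proof.
case=> W [sW rW]; case: R => thps psth Ma Mo Mo0 Mi kf kk.
have [U [UP rU]] := preimage_rank (fun s => W (us s) *m th (us s)) kf kk.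
have rth v : v != i -> \rank (W v *m th v) = e v.
  move=> vi; rewrite mxrankMfree ?rW //.
  by apply/row_freeP; exists (ps v); apply: thps.
have build m (B : 'M[k]_(m, d i)) :
    (forall s, (W (us s) *m th (us s) *m M (us s) i <= B)%MS) ->
    subdim M (set_at i e (\rank B)).
  move=> hB; have [W' [Wi Wv]] := glue_subspaces (fun v => W v *m th v) B.
  exists W'; split=> [u v|v]; last first.
    rewrite /set_at; have [->|vi] := eqVneq v i; first exact: eqmx_rank.
    by rewrite (eqmx_rank (Wv v vi)) rth.
  have [->|ui] := eqVneq u i; first by rewrite M_out mulmx0 sub0mx.
  have /andP[h _] := Wv u ui; apply: submx_trans (submxMr _ h) _.
  have [->|vi] := eqVneq v i.
    have /andP[_ h2] := Wi; apply: submx_trans h2.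
    case: (pickP (fun s => us s == u)) => [s /eqP <-|hu]; first exact: hB.
    by rewrite M_in ?mulmx0 ?sub0mx // => s; have /negbT := hu s.
  have /andP[_ h2] := Wv v vi; apply: submx_trans h2.
  by rewrite -mulmxA -Ma // mulmxA submxMr.
exists (\rank (\mxcol_s (W (us s) *m th (us s) *m M (us s) i))); split.
- have <- : (\sum_s \rank (W (us s) *m th (us s)) = \sum_s e (us s))%N.
    by apply: eq_bigr => s _; rewrite rth.
  rewrite -rU leq_add2r -rW; apply/mxrankS/UP => s.
  by rewrite -Mo mulmxA submxMr.
- apply: build => s.
  rewrite -[X in (X <= _)%MS](mxcolK (fun s => W (us s) *m th (us s) *m M (us s) i)).
  exact: rowsub_sub.
rewrite -[X in set_at i e X](mxrank1 k (d i)); apply: build => s; exact: submx1.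
Qed.

Variables (E : 'I_n -> nat) (c c' : 'I_n -> int) (p q : nat).
Hypothesis E_us : forall f : 'I_n -> nat, (\sum_s f (us s) = \sum_v E v * f v)%N.
Hypothesis Ei : E i = 0%N.
Hypothesis d'_away : forall v, v != i -> d' v = d v.
Hypothesis pq : p = 0%N \/ q = 0%N.
Hypothesis ci : c i = p%:Z - q%:Z.
Hypothesis c'i : c' i = - c i.
Hypothesis c'v : forall v, v != i -> (0 < d v)%N -> c' v = c v + (E v * p)%N%:Z.

(** This is the tropical form of [fpoly_reflect]: a power of [1 + y i] becomes a
    minimum with 0.  For the given components away from [i] the minimum is
    reached at the largest or the smallest component at [i], according to the
    sign of [c i]. *)
Lemma is_min_on_reflect mu :
  is_min_on M c mu -> is_min_on M' c' (mu + (d i * q)%N%:Z).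
Proof.
pose w e := (\sum_s e (us s))%N.
have split_c e : \sum_v (e v)%:Z * c v
    = (e i)%:Z * c i + \sum_(v | v != i) (e v)%:Z * c v by rewrite (bigD1 i).
have split_c' e : (forall v, v != i -> e v <= d v)%N -> \sum_v (e v)%:Z * c' v
    = - (e i)%:Z * c i + \sum_(v | v != i) (e v)%:Z * c v + (w e * p)%N%:Z.
  move=> le; rewrite (bigD1 i) //= c'i mulrN mulNr -addrA; congr (_ + _).
  have -> : (w e * p)%N%:Z = \sum_(v | v != i) (e v)%:Z * (E v * p)%N%:Z.
    rewrite /w E_us (bigD1 i) //= Ei mul0n add0n big_distrl /= Posz_sum.
    by apply: eq_bigr => v _; rewrite !PoszM; ring.
  rewrite -big_split; apply: eq_bigr => v vi /=; rewrite -mulrDr.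
  case: (posnP (d v)) => dv; last by rewrite c'v.
  by have := le v vi; rewrite dv leqn0 => /eqP->; rewrite !mul0r.
have same e r : \sum_(v | v != i) (set_at i e r v)%:Z * c v
    = \sum_(v | v != i) (e v)%:Z * c v.
  by apply: eq_bigr => v vi; rewrite /set_at (negPf vi).
have ati e r : set_at i e r i = r by rewrite /set_at eqxx.
have w_at e r : w (set_at i e r) = w e.
  by apply: eq_bigr => s _; rewrite /set_at (negPf (us_i s)).
have up e : subdim M e -> exists e', subdim M' e' /\
    \sum_v (e' v)%:Z * c' v <= \sum_v (e v)%:Z * c v + (d i * q)%N%:Z.
  move=> he; have [r [t [ri trw h1 h2]]] := subdim_reflect he.
  have ei := subdim_le i he.
  have lev v : v != i -> (e v <= d v)%N by move=> _; exact: subdim_le he.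
  have lev' r' v : v != i -> (set_at i e r' v <= d v)%N.
    by move=> vi; rewrite /set_at (negPf vi) lev.
  case: pq => [p0|q0].
    exists (set_at i e 0); split=> //; rewrite (split_c' _ (lev' _)) ati same w_at split_c.
    rewrite ci p0; set S := \sum_(v | _) _; move: ei; nia.
  exists (set_at i e t); split=> //; rewrite (split_c' _ (lev' _)) ati same w_at split_c.
  rewrite ci q0 /w -trw; set S := \sum_(v | _) _; move: ri; nia.
have down e : subdim M' e -> exists e', subdim M e' /\
    \sum_v (e' v)%:Z * c v + (d i * q)%N%:Z <= \sum_v (e v)%:Z * c' v.
  move=> he; have [r [rw h1 h2]] := subdim_unreflect he.
  have lev v : v != i -> (e v <= d v)%N.
    by move=> vi; rewrite -d'_away //; exact: subdim_le he.
  case: pq => [p0|q0].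
    exists (set_at i e (d i)); split=> //; rewrite (split_c' _ lev) split_c ati same.
    rewrite ci p0; set S := \sum_(v | _) _; nia.
  exists (set_at i e r); split=> //; rewrite (split_c' _ lev) split_c ati same.
  rewrite ci q0; move: rw; rewrite -/(w e); set S := \sum_(v | _) _; nia.
case=> [[e [he emu]] min]; split.
  have [e' [he' le]] := up e he; exists e'; split=> //.
  apply/eqP; rewrite eq_le -{1}emu le /=.
  by have [e1 [he1 le1]] := down e' he'; apply: le_trans le1; rewrite lerD2r min.
move=> e' he'; have [e1 [he1 le1]] := down e' he'.
by apply: le_trans le1; rewrite lerD2r min.
Qed.

End Reflect.
End SubDim.

(** * Mutation of Laurent monomials *)

Section Monomials.
Variables (m : nat) (F : fieldType).
Implicit Types (u : 'I_m -> F) (a b : 'I_m -> int).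

Definition monomial u a : F := \prod_v u v ^ a v.

Lemma monomialD u a b : (forall v, u v != 0) ->
  monomial u (fun v => a v + b v) = monomial u a * monomial u b.
Proof. by move=> u0; rewrite -big_split; apply: eq_bigr => v _ /=; rewrite expfzDr. Qed.

Lemma monomialN u a : monomial u (fun v => - a v) = (monomial u a)^-1.
Proof. by rewrite -prodfV; apply: eq_bigr => v _; rewrite invr_expz. Qed.

Lemma monomialZ u a (c : int) :
  monomial u (fun v => c * a v) = monomial u a ^ c.
Proof.
rewrite /monomial; elim/big_rec2: _ => [|v x y _ ->]; first by rewrite exp1rz.
by rewrite expfzMl exprz_exp (mulrC c).
Qed.

Lemma monomial_nat u (b : 'I_m -> nat) :
  monomial u (fun v => (b v)%:Z) = \prod_v u v ^+ b v.
Proof. by []. Qed.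

Lemma monomial_delta u j (c : int) : monomial u (fun v => if v == j then c else 0) = u j ^ c.
Proof.
rewrite /monomial (bigD1 j) //= eqxx big1 ?mulr1 // => v /negPf->.
by rewrite expr0z.
Qed.

Lemma eq_monomial u a b : a =1 b -> monomial u a = monomial u b.
Proof. by move=> ab; apply: eq_bigr => v _; rewrite ab. Qed.

(** Only the variable [j] changes in a mutation at [j]. *)
Lemma monomial_change u u' a j : (forall v, u v != 0) ->
  (forall v, v != j -> u' v = u v) ->
  monomial u' a = monomial u a * u j ^ (- a j) * u' j ^ a j.
Proof.
move=> u0 uu'; rewrite /monomial (bigD1 j) //= [in RHS](bigD1 j) //=.
rewrite (eq_bigr (fun v => u v ^ a v)) => [|v vj]; last by rewrite uu'.
rewrite [u j ^ a j * _]mulrC -!mulrA (mulrA (u j ^ a j)) -expfzDr // subrr expr0z mul1r.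
by rewrite mulrC.
Qed.

End Monomials.

(** What is needed to know that no mutation divides by zero: the exchange
    relations are free of subtraction. *)
Record positive_cone (F : fieldType) (pos : F -> Prop) : Prop := PositiveCone {
  pos_add : forall x y, pos x -> pos y -> pos (x + y);
  pos_mul : forall x y, pos x -> pos y -> pos (x * y);
  pos_inv : forall x, pos x -> pos x^-1;
  pos_neq0 : forall x, pos x -> x != 0 }.

Section Mutation.
Variables (m : nat) (F : fieldType).
Variable pos : F -> Prop.
Hypothesis hpos : positive_cone pos.
Implicit Types (S : seed m F) (B : quiver m).

Definition no_2cycle B : Prop := forall v w, B v w = 0%N \/ B w v = 0%N.

Lemma no_2cycle_loop B v : no_2cycle B -> B v v = 0%N.
Proof. by move=> h; case: (h v v). Qed.

Lemma mutate_quiver_out B r v : no_2cycle B -> mutate_quiver r B r v = B v r.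
Proof.
move=> h; rewrite /mutate_quiver /delete_2cycles /reverse_at /add_paths eqxx orbT /=.
have := no_2cycle_loop r h; have := h v r; nia.
Qed.

Lemma mutate_quiver_in B r v : no_2cycle B -> mutate_quiver r B v r = B r v.
Proof.
move=> h; rewrite /mutate_quiver /delete_2cycles /reverse_at /add_paths eqxx orbT /=.
have := no_2cycle_loop r h; have := h v r; nia.
Qed.

Lemma mutate_quiver_away B r v w : v != r -> w != r ->
  mutate_quiver r B v w = ((B v w + B v r * B r w) - (B w v + B w r * B r v))%N.
Proof.
move=> /negPf vr /negPf wr.
by rewrite /mutate_quiver /delete_2cycles /reverse_at /add_paths vr wr.
Qed.

Lemma no_2cycle_mutate B r : no_2cycle B -> no_2cycle (mutate_quiver r B).
Proof.
move=> h v w; rewrite /mutate_quiver /delete_2cycles.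
by move: (reverse_at _ _ v w) (reverse_at _ _ w v) => x y; lia.
Qed.

Definition good_seed S : Prop := (forall v, pos (S.2 v)) /\ no_2cycle S.1.

Definition incoming S r : F := \prod_v S.2 v ^+ S.1 v r.
Definition outgoing S r : F := \prod_v S.2 v ^+ S.1 r v.

Lemma pos_one x : pos x -> pos 1.
Proof.
move=> hx; rewrite -(divff (pos_neq0 hpos hx)).
by apply: (pos_mul hpos) => //; apply: (pos_inv hpos).
Qed.

Lemma pos_exp x j : pos x -> pos (x ^+ j).
Proof.
move=> hx; elim: j => [|j IH]; first by rewrite expr0; apply: pos_one hx.
by rewrite exprS; apply: (pos_mul hpos).
Qed.

Lemma pos_prod (u : 'I_m -> F) (b : 'I_m -> nat) (r : 'I_m) :
  (forall v, pos (u v)) -> pos (\prod_v u v ^+ b v).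
Proof.
move=> hu; apply: big_ind; [exact: pos_one (hu r)|exact: (pos_mul hpos)|].
by move=> v _; apply: pos_exp.
Qed.

Lemma good_seed_mutate S r : good_seed S -> good_seed (mutate_seed r S).
Proof.
move=> [hp h2]; split; last exact: no_2cycle_mutate.
move=> v /=; case: eqP => // _; apply: (pos_mul hpos); last by apply: (pos_inv hpos).
by apply: (pos_add hpos); apply: pos_prod.
Qed.

Lemma mutate_var S r :
  (mutate_seed r S).2 r = (incoming S r + outgoing S r) / S.2 r.
Proof. by rewrite /= eqxx. Qed.

Lemma mutate_var_away S r v : v != r -> (mutate_seed r S).2 v = S.2 v.
Proof. by move=> /negPf vr; rewrite /= vr. Qed.

Section Values.
Variables (n : nat) (iota : 'I_n -> 'I_m).
Hypothesis iota_inj : injective iota.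

Definition net S (v : 'I_m) (s : 'I_n) : int := (S.1 (iota s) v)%:Z - (S.1 v (iota s))%:Z.
Definition yhat S (s : 'I_n) : F := monomial S.2 (fun v => net S v s).

Section OneMutation.
Variables (S : seed m F) (i : 'I_n).
Hypothesis gS : good_seed S.
Local Notation S' := (mutate_seed (iota i) S).
Local Notation A := (incoming S (iota i)).
Local Notation B := (outgoing S (iota i)).

Let u0 v : S.2 v != 0.
Proof. by case: gS => hp _; apply: (pos_neq0 hpos). Qed.
Let u0' : S'.2 (iota i) != 0.
Proof. by case: (good_seed_mutate (iota i) gS) => hp _; apply: (pos_neq0 hpos). Qed.
Let posA : pos A. Proof. by case: gS => hp _; apply: (pos_prod _ (iota i)). Qed.
Let posB : pos B. Proof. by case: gS => hp _; apply: (pos_prod _ (iota i)). Qed.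
Let A0 : A != 0. Proof. exact: (pos_neq0 hpos). Qed.
Let B0 : B != 0. Proof. exact: (pos_neq0 hpos). Qed.
Let AB0 : A + B != 0. Proof. by apply: (pos_neq0 hpos); apply: (pos_add hpos). Qed.

Let exch : S'.2 (iota i) = (A + B) / S.2 (iota i). Proof. exact: mutate_var. Qed.

Let loop : S.1 (iota i) (iota i) = 0%N.
Proof. by case: gS => _ /no_2cycle_loop->. Qed.

Lemma yhat_ratio : yhat S i = B / A.
Proof. by rewrite /yhat /net monomialD // monomialN. Qed.

Lemma yhat_neq0 : yhat S i != 0.
Proof. by rewrite yhat_ratio mulf_neq0 ?invr_eq0. Qed.

Lemma yhat_add1 : 1 + yhat S i = (A + B) / A.
Proof. by rewrite yhat_ratio; field. Qed.

Lemma yhat_add1_neq0 : 1 + yhat S i != 0.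
Proof. by rewrite yhat_add1 mulf_neq0 ?invr_eq0. Qed.

Lemma net_mutate_self v : net S' v i = - net S v i.
Proof.
case: gS => _ h; rewrite /net /= mutate_quiver_out // mutate_quiver_in //; lia.
Qed.

Lemma net_mutate v s : s != i -> v != iota i -> S.1 (iota i) (iota s) = 0%N ->
  net S' v s = net S v s + (S.1 (iota s) (iota i) * S.1 (iota i) v)%N%:Z.
Proof.
case: gS => _ h si vi hz; rewrite /net /= !mutate_quiver_away ?(inj_eq iota_inj) // hz.
by have := h (iota s) v; lia.
Qed.

Lemma yhat_mutate_self : yhat S' i = (yhat S i)^-1.
Proof.
rewrite /yhat (monomial_change _ u0 (fun v => @mutate_var_away S (iota i) v)).
rewrite {2 3}/net /= !mutate_quiver_out //; try by case: gS.
rewrite loop subrr oppr0 !expr0z !mulr1 -monomialN; apply: eq_monomial => v.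
exact: net_mutate_self.
Qed.

(** Mutation of coefficients, in the direction of the arrows [s -> i]; the arrows
    added for the paths [s -> i -> v] contribute the numerator
    [outgoing S (iota i)]. *)
Lemma yhat_mutate s : s != i -> S.1 (iota i) (iota s) = 0%N ->
  yhat S' s = yhat S s / (1 + (yhat S i)^-1) ^+ S.1 (iota s) (iota i).
Proof.
move=> si hz; set b := S.1 (iota s) (iota i).
have h2 : no_2cycle S.1 by case: gS.
have neti : net S' (iota i) s = - b%:Z.
  by rewrite /net /= mutate_quiver_in // mutate_quiver_out // hz; lia.
rewrite {1}/yhat (monomial_change _ u0 (fun v => @mutate_var_away S (iota i) v)) neti.
have -> : monomial S.2 (fun v => net S' v s) =
    yhat S s * B ^+ b * S.2 (iota i) ^ (- (2 * b%:Z)).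
  have -> : B ^+ b = monomial S.2 (fun v => b%:Z * (S.1 (iota i) v)%:Z).
    by rewrite monomialZ.
  rewrite -monomial_delta -!monomialD //; apply: eq_monomial => v /=.
  have [->|vi] := eqVneq v (iota i); last by rewrite net_mutate // addr0 PoszM.
  by rewrite neti loop /net hz -/b; lia.
rewrite exch yhat_ratio invf_div.
have -> : 1 + A / B = (A + B) / B by rewrite -{1}(divff B0) -mulrDl addrC.
have -> : S.2 (iota i) ^ (- (2 * b%:Z)) = (S.2 (iota i) ^+ b * S.2 (iota i) ^+ b)^-1.
  by rewrite -exprD -exprnN; congr (GRing.inv _); congr (GRing.exp _ _); lia.
rewrite opprK -exprnN -exprnP !expr_div_n.
have e1 : S.2 (iota i) ^+ b != 0 by rewrite expf_neq0.
have e2 : (A + B) ^+ b != 0 by rewrite expf_neq0.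
have e3 : B ^+ b != 0 by rewrite expf_neq0.
by field; rewrite e1 e2 e3.
Qed.

(** With [1 + yhat S i] equal to the quotient of the exchange polynomial by
    [incoming S (iota i)], this is the exchange relation raised to the power
    [di]. *)
Lemma monomial_mutate (H H' : 'I_m -> int) (di : nat) :
  H (iota i) = - di%:Z -> H' (iota i) = di%:Z ->
  (forall v, v != iota i -> H' v = H v - (di * S.1 v (iota i))%N%:Z) ->
  monomial S'.2 H' = monomial S.2 H * (1 + yhat S i) ^+ di.
Proof.
move=> Hi H'i H'v.
rewrite (monomial_change _ u0 (fun v => @mutate_var_away S (iota i) v)) H'i.
have -> : monomial S.2 H' = monomial S.2 H / A ^+ di * S.2 (iota i) ^ (2 * di%:Z).
  have -> : (A ^+ di)^-1 = monomial S.2 (fun v => - (di%:Z * (S.1 v (iota i))%:Z)).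
    by rewrite monomialN monomialZ.
  rewrite -monomial_delta -!monomialD //; apply: eq_monomial => v /=.
  have [->|vi] := eqVneq v (iota i); last by rewrite H'v // addr0 PoszM.
  by rewrite Hi H'i loop; lia.
rewrite exch yhat_add1.
have -> : S.2 (iota i) ^ (2 * di%:Z) = S.2 (iota i) ^+ di * S.2 (iota i) ^+ di.
  by rewrite -exprD exprnP; congr (exprz _ _); lia.
have e1 : S.2 (iota i) ^+ di != 0 by rewrite expf_neq0.
have e3 : A ^+ di != 0 by rewrite expf_neq0.
by rewrite -exprnN -exprnP !expr_div_n; field; rewrite e1 e3.
Qed.

Lemma monomial_base (H : 'I_m -> int) :
  H (iota i) = -1 -> (forall v, v != iota i -> H v = (S.1 v (iota i))%:Z) ->
  monomial S.2 H * (1 + yhat S i) = S'.2 (iota i).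
Proof.
move=> Hi Hv; rewrite exch yhat_add1.
have -> : monomial S.2 H = A * S.2 (iota i) ^ (-1).
  rewrite -[A]monomial_nat -monomial_delta -monomialD //; apply: eq_monomial => v /=.
  have [->|vi] := eqVneq v (iota i); last by rewrite Hv // addr0.
  by rewrite Hi loop.
by rewrite exprN1; field; rewrite A0 u0.
Qed.

End OneMutation.
End Values.
End Mutation.

(** * The value of a representation at a seed *)

Section Main.
Variables (k : closedFieldType) (chi : forall I : finType, kset k I -> int).
Hypothesis hchi : euler_characteristic chi.
Variables (n m : nat) (F : fieldType).
Variable pos : F -> Prop.
Hypothesis hpos : positive_cone pos.
Variable iota : 'I_n -> 'I_m.
Hypothesis iota_inj : injective iota.
Implicit Types (S : seed m F) (d : 'I_n -> nat).

Definition compatible S (E : 'I_n -> 'I_n -> bool) d : Prop :=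
  forall r s, (0 < d r)%N -> (0 < d s)%N -> S.1 (iota r) (iota s) = E r s.

Definition supported (E : 'I_n -> 'I_n -> bool) d (M : forall u v, 'M[k]_(d u, d v)) :=
  forall u v, ~~ E u v -> M u v = 0.

(** On the support these are the exponents of the term [e = 0] in the
    Caldero-Chapoton formula.  Elsewhere they normalize to 0 the least exponent
    of the variable [v] over the dimension vectors of subrepresentations: a
    cluster variable is not divisible by a frozen variable. *)
Definition is_exponent S d (M : forall u v, 'M[k]_(d u, d v)) (H : 'I_m -> int) : Prop :=
  (forall r, (0 < d r)%N ->
     H (iota r) = - (d r)%:Z + \sum_s (d s)%:Z * (S.1 (iota r) (iota s))%:Z) /\
  (forall v, (forall r, (0 < d r)%N -> v != iota r) -> is_min_on M (net iota S v) (- H v)).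

Lemma sum_in_arrows (E : 'I_n -> 'I_n -> bool) i (f : 'I_n -> nat) :
  (\sum_(s < #|[set u | E u i]|) f (enum_val s) = \sum_v E v i * f v)%N.
Proof.
rewrite -(big_enum_val f) big_mkcond; apply: eq_bigr => v _.
by rewrite inE; case: (E v i); rewrite ?mul1n.
Qed.

Section Step.
Variables (S : seed m F) (i : 'I_n) (E : 'I_n -> 'I_n -> bool).
Variables (d : 'I_n -> nat) (M : forall u v, 'M[k]_(d u, d v)) (H : 'I_m -> int).
Hypothesis gS : good_seed pos S.
Hypothesis Eii : E i i = false.
Hypothesis Eout : forall v, (0 < d v)%N -> E i v = false.
Hypothesis di : (0 < d i)%N.
Hypothesis hC : compatible S E d.
Hypothesis hH : is_exponent S M H.
Local Notation S' := (mutate_seed (iota i) S).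

Lemma exponent_base : (forall v, d v = (v == i)) ->
  H (iota i) = -1 /\ forall v, v != iota i -> H v = (S.1 v (iota i))%:Z.
Proof.
have [_ h2] := gS; case: hH => H1 H2 dv; split.
  rewrite H1 // dv eqxx (bigD1 i) //= dv eqxx mul1r no_2cycle_loop // big1 //.
  by move=> s /negPf si; rewrite dv si mul0r.
move=> v vi; have [|[e [he emu]] min] := H2 v.
  by move=> r; rewrite dv; case: eqP => // ->.
have sumE e' : subdim M e' ->
    \sum_v0 (e' v0)%:Z * net iota S v v0 = (e' i)%:Z * net iota S v i.
  move=> he'; rewrite (bigD1 i) //= big1 ?addr0 // => s /negPf si.
  by have := subdim_le s he'; rewrite dv si leqn0 => /eqP->; rewrite mul0r.
have := min _ (subdim0 M); have := min _ (subdim_full M).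
rewrite !sumE; [|exact: subdim0|exact: subdim_full].
rewrite sumE // in emu; have := subdim_le i he; rewrite !dv eqxx.
move: emu; rewrite /net; case: (e i) => [|[|//]]; have := h2 (iota i) v; lia.
Qed.

Variables (d' : 'I_n -> nat) (M' : forall u v, 'M[k]_(d' u, d' v)).
Local Notation us := (fun s : 'I_#|[set u | E u i]| => enum_val s).
Variables (th : forall v, 'M[k]_(d' v, d v)) (ps : forall v, 'M[k]_(d v, d' v)).
Variable kap : 'M[k]_(d' i, (\sum_s d (us s))%N).
Hypothesis R : @reflection k n i _ us d M d' M' th ps kap.
Hypothesis us_i : forall s, us s != i.
Hypothesis M_in : forall u, (forall s, us s != u) -> M u i = 0.
Hypothesis M_out : forall v, M i v = 0.
Hypothesis d'v : forall v, v != i -> d' v = d v.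
Hypothesis d'i : (d' i + d i = \sum_v E v i * d v)%N.

Let hz s : (0 < d s)%N -> S.1 (iota i) (iota s) = 0%N.
Proof. by move=> ds; rewrite hC // Eout. Qed.

(** The value at [i] is the one required at a vertex that has become a source;
    the other values absorb the denominator [incoming S (iota i) ^+ d i] of
    [(1 + yhat S i) ^+ d i]. *)
Definition mutate_exponent v : int :=
  if v == iota i then (d i)%:Z else H v - (d i * S.1 v (iota i))%N%:Z.

Lemma compatible_reflect : compatible S' (reflect_rel i E) d'.
Proof.
have [_ h2] := gS; move=> r s; rewrite /reflect_rel.
have [->|si] := eqVneq s i.
  move=> dr _ /=; rewrite mutate_quiver_in //; have [->|ri] := eqVneq r i.
    by rewrite no_2cycle_loop.
  by rewrite hz // -d'v.
have [->|ri] := eqVneq r i => dr ds /=.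
  by rewrite mutate_quiver_out // hC // -?d'v.
rewrite d'v // in dr; rewrite d'v // in ds.
rewrite mutate_quiver_away ?(inj_eq iota_inj) // !hz // !muln0 !addn0 -hC //.
by have := h2 (iota r) (iota s); lia.
Qed.

(** For [v] off both supports this is [is_min_on_reflect].  If [i] leaves the
    support, the functional attached to [i] is nonpositive, and its minimum is
    its value on the whole representation. *)
Lemma exponent_reflect : is_exponent S' M' mutate_exponent.
Proof.
have [_ h2] := gS; case: (hH) => H1 H2.
have Ei v : (0 < d v)%N -> S.1 (iota v) (iota i) = E v i by move=> dv; rewrite hC.
have sumE : \sum_(s | s != i) (d s)%:Z * (S.1 (iota s) (iota i))%:Z = (d' i)%:Z + (d i)%:Z.
  rewrite -PoszD d'i [in RHS](bigD1 i) //= Eii mul0n add0n Posz_sum; apply: eq_bigr => s si.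
  case: (posnP (d s)) => ds; first by rewrite ds muln0 mul0r.
  by rewrite Ei // PoszM mulrC.
split.
  move=> r; have [->|ri] := eqVneq r i => dr.
    rewrite /mutate_exponent eqxx (bigD1 i) //= no_2cycle_loop; last exact: no_2cycle_mutate.
    rewrite mulr0 add0r (eq_bigr (fun s => (d s)%:Z * (S.1 (iota s) (iota i))%:Z)).
      by rewrite sumE; lia.
    by move=> s si; rewrite d'v // mutate_quiver_out.
  rewrite /mutate_exponent (inj_eq iota_inj) (negPf ri).
  have dr' : (0 < d r)%N by rewrite -d'v.
  rewrite H1 // (bigD1 i) //= [in RHS](bigD1 i) //= mutate_quiver_in // hz // mulr0 add0r.
  rewrite d'v //.
  rewrite (eq_bigr (fun s => (d' s)%:Z *
    (mutate_quiver (iota i) S.1 (iota r) (iota s))%:Z)).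
    by rewrite PoszM; ring.
  move=> s si; rewrite d'v //; case: (posnP (d s)) => ds; first by rewrite ds !mul0r.
  rewrite mutate_quiver_away ?(inj_eq iota_inj) // !hz // !muln0 !addn0.
  by congr (_ * _%:Z); have := h2 (iota r) (iota s); lia.
move=> v hv; rewrite /mutate_exponent; have [ev|vi] := eqVneq v (iota i); first subst v.
  have d'i0 : d' i = 0%N.
    apply/eqP; rewrite -leqn0 leqNgt; apply/negP=> /hv; by rewrite eqxx.
  have netE e : subdim M' e -> \sum_s (e s)%:Z * net iota S' (iota i) s
      = - \sum_(s | s != i) (e s)%:Z * (S.1 (iota s) (iota i))%:Z.
    move=> he; rewrite (bigD1 i) //= [e i](_ : _ = 0%N) ?mul0r ?add0r; last first.
      by apply/eqP; rewrite -leqn0 -d'i0; apply: subdim_le he.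
    rewrite -sumrN; apply: eq_bigr => s si.
    case: (posnP (d s)) => ds.
      by have := subdim_le s he; rewrite d'v // ds leqn0 => /eqP->; rewrite !mul0r oppr0.
    by rewrite /net /= mutate_quiver_in // mutate_quiver_out // hz // sub0r mulrN.
  split.
    exists d'; split; first exact: subdim_full.
    rewrite netE; last exact: subdim_full.
    rewrite (eq_bigr (fun s => (d s)%:Z * (S.1 (iota s) (iota i))%:Z)) => [|s si].
      by rewrite sumE d'i0 add0r.
    by rewrite d'v.
  move=> e he; rewrite netE // lerN2.
  have -> : (d i)%:Z = \sum_(s | s != i) (d s)%:Z * (S.1 (iota s) (iota i))%:Z.
    by rewrite sumE d'i0 add0r.
  apply: ler_sum => s si; apply: ler_wpM2r => //.
  by rewrite lez_nat -d'v //; apply: subdim_le he.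
have hmin : is_min_on M (net iota S v) (- H v).
  apply: H2 => r dr; have [->//|ri] := eqVneq r i.
  by apply: hv; rewrite d'v.
rewrite opprB addrC.
have := @is_min_on_reflect k n i _ us d M us_i M_in M_out d' M' th ps kap R
  (fun v => E v i) (net iota S v) (net iota S' v) (S.1 (iota i) v) (S.1 v (iota i)).
apply=> //.
- by move=> f; exact: sum_in_arrows.
- by rewrite /= Eii.
- exact: (net_mutate_self hpos iota i gS).
move=> s si ds; rewrite -Ei // (net_mutate hpos) // hz //.
Qed.

Lemma value_reflect :
  monomial S.2 H * fpoly chi M (yhat iota S) =
  monomial S'.2 mutate_exponent * fpoly chi M' (yhat iota S').
Proof.
case: R => thps psth Ma Mo Mo0 Mi kf kk.
have y0 := yhat_neq0 hpos iota i gS.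
have y1 := yhat_add1_neq0 hpos iota i gS.
rewrite (@fpoly_reflect _ _ hchi _ _ i _ us d M us_i M_in M_out d' M' th ps kap
  thps psth Ma Mo Mo0 Mi kf kk (fun v => E v i) (sum_in_arrows E i)
  (yhat iota S) (yhat iota S')) //.
- rewrite mulrA; congr (_ * _); apply/esym.
  have [H1 _] := hH; apply: (monomial_mutate hpos gS).
  + rewrite H1 // big1 ?addr0 // => s _; case: (posnP (d s)) => ds; first by rewrite ds mul0r.
    by rewrite hz // mulr0.
  + by rewrite /mutate_exponent eqxx.
  by move=> v /negPf vi; rewrite /mutate_exponent vi.
- exact: (yhat_mutate_self hpos iota i gS).
move=> v vi dv; rewrite (yhat_mutate hpos iota_inj gS) ?hz //.
by rewrite hC.
Qed.

End Step.

(** Choosing [i] of minimal height in the support makes it free of arrows to the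
    support.  The natural number [N] bounds the Euler form with [y], shifted to
    be nonnegative, and decreases at each reflection. *)
Lemma is_seed_value N q y E d (M : forall u v, 'M[k]_(d u, d v)) S H :
  acyclic E -> dominant E y -> tits E d = q -> trivial_idempotents M -> supported E M ->
  good_seed pos S -> compatible S E d -> is_exponent S M H ->
  pairing_form E y d + form_bound q y < N%:Z ->
  exists (rs : seq 'I_n) (r : 'I_n),
    (foldl (fun S r => mutate_seed r S) S (map iota rs)).2 (iota r) =
    monomial S.2 H * fpoly chi M (yhat iota S).
Proof.
elim: N => [|N IH] in E d M S H *.
  move=> _ hy <- _ _ _ _ _; have := pairing_form_bound d hy.
  by set x := _ + _; lia.
move=> hE hy hq hM sM gS hC hH lt.
have Eirr := acyclic_irr hE; have [h hh] := hE.
have [v0 dv0] : exists v, (0 < d v)%N by case: hM.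
case: (@arg_minnP _ v0 (fun v => 0 < d v)%N h dv0) => i di imin.
have Eout v : (0 < d v)%N -> E i v = false.
  by move=> dv; apply/negP=> /hh; rewrite ltnNge imin.
pose us (s : 'I_#|[set u | E u i]|) : 'I_n := enum_val s.
have usE s : E (us s) i by have := enum_valP s; rewrite inE.
have us_i s : us s != i by apply/eqP=> e; have := usE s; rewrite e Eirr.
have M_in u : (forall s, us s != u) -> M u i = 0.
  move=> hu; apply: sM; apply/negP=> Eu.
  have uA : u \in [set u | E u i] by rewrite inE.
  by have := hu (enum_rank_in uA u); rewrite /us enum_rankK_in ?eqxx.
have M_out v : M i v = 0.
  case: (posnP (d v)) => dv; last by apply: sM; rewrite Eout.
  suff h0 p (A : 'M[k]_(d i, p)) : p = 0%N -> A = 0 by apply: h0.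
  by move=> p0; subst p; rewrite thinmx0.
have [dv|full] := sink_dichotomy us_i M_in M_out hM di.
  exists [:: i], i; rewrite /= (fpoly_simple hchi _ M_out dv).
  have [Hi Hv] := exponent_base gS (Eirr i) di hH dv.
  by rewrite (monomial_base hpos gS Hi Hv).
have us_inj : injective us by exact: enum_val_inj.
have [d' [M' [th [ps [kap [R d'v d'i]]]]]] := reflection_exists us_inj us_i full.
rewrite (sum_in_arrows E i d) in d'i.
rewrite (value_reflect gS Eout di hC hH R us_i M_in M_out) //.
have [|||||||||rs [r e]] := IH (reflect_rel i E) d' M' (mutate_seed (iota i) S)
    (mutate_exponent S i d H).
- exact: acyclic_reflect.
- exact: dominant_reflect.
- by rewrite -hq; apply: tits_reflect.
- exact: (trivial_idempotents_reflection us_i M_in M_out full R d'v di hM).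
- move=> u v; case: R => thps psth Ma Mo Mo0 Mi _ _; rewrite /reflect_rel.
  have [->|vi] := eqVneq v i; first by rewrite Mi.
  have [->|ui] := eqVneq u i => nE.
    by apply: Mo0 => s; apply: contraNneq nE => <-.
  by rewrite -[M' u v]mulmx1 -(thps v vi) mulmxA Ma // sM // mulmx0 mul0mx.
- exact: (good_seed_mutate hpos).
- exact: (compatible_reflect gS (Eirr i) Eout di hC d'v d'i).
- exact: (exponent_reflect gS (Eirr i) Eout di hC hH R us_i M_in M_out d'v d'i).
- have := pairing_form_reflect (Eirr i) Eout d'v d'i hy di.
  by move: lt; set x := pairing_form _ _ d; set x' := pairing_form _ _ d'; lia.
by exists (i :: rs), r.
Qed.

End Main.

(** * Orientations of Dynkin diagrams *)

Section Dynkin.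
Local Open Scope nat_scope.

Definition arrows n (Q : quiver n) : 'I_n -> 'I_n -> bool := fun u v => 0 < Q u v.

Lemma sum_at n a (g : nat -> nat) : \sum_(q < n) (q == a :> nat) * g q <= g a.
Proof.
case: (ltnP a n) => an.
  rewrite (bigD1 (Ordinal an)) //= eqxx mul1n big1 ?addn0 // => q qa.
  by case: eqP => // e; case/eqP: qa; apply: val_inj.
rewrite big1 // => q _; case: eqP => // e.
by have := ltn_ord q; rewrite e ltnNge an.
Qed.

Lemma sum_pred_at n a (P : pred nat) (g : nat -> nat) :
  \sum_(q < n) (P q && (q == a :> nat)) * g q <= P a * g a.
Proof.
apply: leq_trans (sum_at n a (fun q => P q * g q)); apply: leq_sum => q _.
by case: eqP => [->|]; rewrite ?andbF // andbT mul1n.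
Qed.

Lemma chain_sum n m p (g : nat -> nat) :
  \sum_(q < n) chain_adj m p q * g q <= (p.+1 < m) * g p.+1 + (0 < p < m) * g p.-1.
Proof.
apply: (@leq_trans (\sum_(q < n) ((q < m) && (q == p.+1 :> nat)) * g q +
  \sum_(q < n) ((0 < p < m) && (q == p.-1 :> nat)) * g q)).
  rewrite -big_split; apply: leq_sum => q _ /=; rewrite -mulnDl leq_mul2r; apply/orP; right.
  rewrite /chain_adj; case: (ltnP p m) => //= pm; case: (ltnP q m) => //= qm.
  have [->|_] := eqVneq (q : nat) p.+1; first by rewrite /=; case: (_ && _).
  by case: eqP => //= e; rewrite e /= eqxx.
apply: leq_add; first exact: (sum_pred_at n p.+1 (fun q => q < m)).
exact: (sum_pred_at n p.-1 (fun=> 0 < p < m)).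
Qed.

Lemma leg_sum n v w p (g : nat -> nat) :
  \sum_(q < n) leg_adj v w p q * g q <= (p == v) * g w + (p == w) * g v.
Proof.
apply: (@leq_trans (\sum_(q < n) ((p == v) && (q == w :> nat)) * g q +
  \sum_(q < n) ((p == w) && (q == v :> nat)) * g q)).
  rewrite -big_split; apply: leq_sum => q _ /=; rewrite -mulnDl leq_mul2r; apply/orP; right.
  by rewrite /leg_adj; do 2!case: (_ && _).
apply: leq_add; first exact: (sum_pred_at n w (fun=> p == v)).
exact: (sum_pred_at n v (fun=> p == w)).
Qed.

Lemma tree_sum n m v w p (g : nat -> nat) :
  \sum_(q < n) (chain_adj m p q || leg_adj v w p q) * g q <=
  ((p.+1 < m) * g p.+1 + (0 < p < m) * g p.-1) + ((p == v) * g w + (p == w) * g v).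
Proof.
apply: leq_trans (leq_add (chain_sum n m p g) (leg_sum n v w p g)).
rewrite -big_split; apply: leq_sum => q _ /=; rewrite -mulnDl leq_mul2r; apply/orP; right.
by case: (chain_adj _ _ _); case: (leg_adj _ _ _ _).
Qed.

(** Up to a factor, [y p] is the coefficient of the simple coroot [p] in the sum
    of the positive coroots, on which the Cartan matrix takes the value 2
    everywhere. *)
Lemma dynkin_adj_dominant n adj : dynkin_adj n adj ->
  exists y : nat -> nat, forall p, p < n ->
    0 < y p /\ \sum_(q < n) adj p q * y q < 2 * y p.
Proof.
case=> [n1|n4|n68].
- pose y p := p.+1 * (n - p).
  exists y => p pn; split; first by rewrite muln_gt0 subn_gt0.
  apply: (leq_ltn_trans (chain_sum n n p y)); rewrite /y.
  case: p pn => [|p] pn /=; first by case: (ltnP 1 n) => h; rewrite ?mul0n ?mul1n; nia.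
  by rewrite pn mul1n; case: (ltnP p.+2 n) => h; rewrite ?mul0n ?mul1n; nia.
- have {n4} [t ->] : exists t, n = t.+4 by exists (n - 4); lia.
  have -> : t.+4 - 3 = t.+1 by lia.
  pose y p := if p <= t.+1 then 2 * (p.+1 * (2 * t + 6 - p)) else t.+4 * t.+3.
  exists y => p pn; split.
    by rewrite /y; case: (leqP p t.+1) => h; rewrite !muln_gt0; lia.
  apply: (leq_ltn_trans (tree_sum t.+4 t.+3 t.+1 t.+3 p y)).
  have yle q : q <= t.+1 -> y q = 2 * (q.+1 * (2 * t + 6 - q)) by rewrite /y => ->.
  have ygt q : t.+1 < q -> y q = t.+4 * t.+3 by move=> h; rewrite /y ifN // -ltnNge.
  have [pe|pe] := eqVneq p t.+3.
    have -> : p.+1 < t.+3 = false by lia.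
    have -> : 0 < p < t.+3 = false by lia.
    have -> : p == t.+1 = false by lia.
    rewrite pe /= !mul0n !mul1n (ygt t.+3) ?(yle t.+1) //.
    have -> : 2 * t + 6 - t.+1 = t + 5 by lia.
    by nia.
  have [pe3|pe3] := eqVneq p t.+1.
    have -> : p.+1 < t.+3 = true by lia.
    have -> : 0 < p < t.+3 = true by lia.
    rewrite pe3 /= !mul0n !mul1n (ygt t.+2) ?(ygt t.+3) ?(yle t.+1) ?(yle t) //.
    have -> : 2 * t + 6 - t.+1 = t + 5 by lia.
    have -> : 2 * t + 6 - t = t + 6 by lia.
    by nia.
  have [pe2|pe2] := eqVneq p t.+2.
    have -> : p.+1 < t.+3 = false by lia.
    have -> : 0 < p < t.+3 = true by lia.
    rewrite pe2 /= !mul0n !mul1n (ygt t.+2) ?(yle t.+1) //.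
    have -> : 2 * t + 6 - t.+1 = t + 5 by lia.
    by nia.
  have ple : p <= t by lia.
  rewrite !mul0n (yle p) ?(yle p.+1) ?(yle p.-1); try lia.
  rewrite (_ : p.+1 < t.+3) ?mul1n; last lia.
  case: p {pn pe pe2 pe3} ple => [|p] ple /=; first by rewrite mul0n; nia.
  rewrite (_ : p.+1 < t.+3) ?mul1n ?addn0; last lia.
  have [s ->] : exists s, t = p.+1 + s by exists (t - p.+1); lia.
  have -> : 2 * (p.+1 + s) + 6 - p.+2 = p + 2 * s + 6 by lia.
  have -> : 2 * (p.+1 + s) + 6 - p.+1 = p + 2 * s + 7 by lia.
  have -> : 2 * (p.+1 + s) + 6 - p = p + 2 * s + 8 by lia.
  by nia.
have: [|| n == 6, n == 7 | n == 8] by lia.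
pose y6 := [:: 16; 30; 42; 30; 16; 22].
pose y7 := [:: 34; 66; 96; 75; 52; 27; 49].
pose y8 := [:: 92; 182; 270; 220; 168; 114; 58; 136].
case/or3P=> /eqP->.
(* the last entry is the value at the vertex off the chain *)
- exists (nth 0 y6) => p pn; split; first by do 6?[case: p pn => // p pn].
  by apply: (leq_ltn_trans (tree_sum 6 5 2 5 p (nth 0 y6))); do 6?[case: p pn => // p pn].
- exists (nth 0 y7) => p pn; split; first by do 7?[case: p pn => // p pn].
  by apply: (leq_ltn_trans (tree_sum 7 6 2 6 p (nth 0 y7))); do 7?[case: p pn => // p pn].
- exists (nth 0 y8) => p pn; split; first by do 8?[case: p pn => // p pn].
by apply: (leq_ltn_trans (tree_sum 8 7 2 7 p (nth 0 y8))); do 8?[case: p pn => // p pn].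
Qed.

(** The height is read off along the chain, where it changes by 1 at each edge;
    the leaf [w] is not on the chain and can be placed afterwards. *)
Lemma tree_height m a w (e : nat -> nat -> bool) : a < m -> m <= w ->
  (forall p q, e p q -> chain_adj m p q || leg_adj a w p q) ->
  (forall p q, e p q -> ~~ e q p) ->
  exists h : nat -> nat, forall p q, e p q -> h q < h p.
Proof.
move=> am mw adj asym.
pose hc p := m.+1 + 2 * (\sum_(q < p) e q.+1 q) - p.
have hcS p : p.+1 < m -> hc p.+1 = hc p + 2 * e p.+1 p - 1 /\ 0 < hc p.
  by move=> pm; rewrite /hc big_ord_recr /=; split; lia.
have hca : 0 < hc a by rewrite /hc; lia.
exists (fun p => if p == w then (if e w a then (hc a).+1 else (hc a).-1) else hc p).
move=> p q epq; case/orP: (adj p q epq).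
  case/and3P=> pm qm /orP[/eqP qp|/eqP pq].
    rewrite !ifN; try by apply/eqP; lia.
    subst q; have [-> h0] := hcS p qm; rewrite (negPf (asym _ _ epq)); lia.
  rewrite !ifN; try by apply/eqP; lia.
  subst p; have [-> h0] := hcS q pm; rewrite epq; lia.
have aw : (a == w) = false by lia.
case/orP=> /andP[/eqP pe /eqP qe]; subst p q.
  rewrite eqxx aw.
  by rewrite (negPf (asym _ _ epq)) prednK.
by rewrite eqxx aw epq.
Qed.

Lemma dynkin_adj_height n adj (e : nat -> nat -> bool) : dynkin_adj n adj ->
  (forall p q, e p q -> adj p q) -> (forall p q, e p q -> ~~ e q p) ->
  exists h : nat -> nat, forall p q, e p q -> h q < h p.
Proof.
case=> [n1|n4|n68] adjE asym.
- by apply: (@tree_height n 0 n) => // p q /adjE->.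
- by apply: (@tree_height n.-1 (n - 3) n.-1) => //; lia.
by apply: (@tree_height n.-1 2 n.-1) => //; lia.
Qed.

Lemma dynkin_arrows n (Q : quiver n) : dynkin Q ->
  [/\ acyclic (arrows Q), exists y, dominant (arrows Q) y
    & forall u v, Q u v = arrows Q u v].
Proof.
case=> adj [s [hadj [g sK gK] QE]].
have Qle u v : Q u v + Q v u <= 1 by rewrite QE leq_b1.
have QA u v : Q u v = arrows Q u v by rewrite /arrows; move: (Qle u v); lia.
have adjE u v : (arrows Q u v + arrows Q v u = adj (s u) (s v)) by rewrite -!QA.
split=> //.
  pose e p q := [exists u, [exists v, [&& s u == p :> nat, s v == q :> nat & arrows Q u v]]].
  have eP u v : e (s u) (s v) = arrows Q u v.
    apply/existsP/idP => [[u' /existsP[v' /and3P[/eqP/val_inj/(can_inj sK)-> ]]]|h].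
      by move=> /eqP/val_inj/(can_inj sK)->.
    by exists u; apply/existsP; exists v; rewrite !eqxx.
  have [||h hE] := @dynkin_adj_height n adj e hadj.
  - move=> p q /existsP[u /existsP[v /and3P[/eqP <- /eqP <- uv]]].
    by move: (adjE u v); rewrite uv; case: (adj _ _).
  - move=> p q /existsP[u /existsP[v /and3P[/eqP <- /eqP <- uv]]].
    by rewrite eP; move: (Qle u v); rewrite !QA uv; case: (arrows Q v u).
  by exists (fun u => h (s u)) => u v uv; apply: hE; rewrite eP.
have [y hy] := dynkin_adj_dominant hadj.
exists (fun v => y (s v)); split=> [v|i]; first by case: (hy _ (ltn_ord (s v))).
have [_] := hy _ (ltn_ord (s i)); rewrite (reindex s) /=; last by exists g => ? _.
by congr (_ < _); apply: eq_bigr => v _; rewrite addnC adjE.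
Qed.

End Dynkin.

(** * Indecomposable representations and positive fractions *)

Section Rep.
Variables (k : closedFieldType) (n : nat) (Q : quiver n).
Hypothesis Q1 : forall u v, Q u v = arrows Q u v.

(** There is at most one arrow between two vertices, so a representation is a
    family of matrices, with 0 where there is no arrow. *)
Definition arrow_mx (V : rep k Q) u v : 'M[k]_(rdim V u, rdim V v) :=
  if @idP (0 < Q u v)%N is ReflectT h then act V (Ordinal h) else 0.

Lemma arrow_mxE (V : rep k Q) u v (a : 'I_(Q u v)) : arrow_mx V u v = act V a.
Proof.
have Quv : (0 < Q u v)%N by case: (Q u v) a => [[]|].
rewrite /arrow_mx; case: {-}_ / idP => // h; congr act; apply: val_inj => /=.
have Q_le1 : (Q u v <= 1)%N by rewrite Q1 leq_b1.
by have := leq_trans (ltn_ord a) Q_le1; case: (val a).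
Qed.

Lemma arrow_mx_supported (V : rep k Q) : supported (arrows Q) (arrow_mx V).
Proof.
move=> u v nE; rewrite /arrow_mx; case: {-}_ / idP => // h.
by rewrite /arrows h in nE.
Qed.

Lemma quiver_gr_sub_gr (V : rep k Q) e x :
  quiver_gr V e x <-> sub_gr (arrow_mx V) x.
Proof.
split=> -[hx sx]; split=> // u v.
  by rewrite /arrow_mx; case: {-}_ / idP => // _; rewrite mulmx0 sub0mx.
by move=> a; rewrite -arrow_mxE.
Qed.

Section Split.
Variables (V : rep k Q) (f : forall v, 'M[k]_(rdim V v)).
Hypothesis homf : forall u v (a : 'I_(Q u v)), act V a *m f v = f u *m act V a.
Hypothesis ff : forall v, f v *m f v = f v.

Lemma base_retract v : row_base (f v) *m col_base (f v) = 1%:M.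
Proof.
have : col_base (f v) *m row_base (f v) *m (col_base (f v) *m row_base (f v)) =
  col_base (f v) *m row_base (f v) by rewrite mulmx_base ff.
move: (row_base_free (f v)) (col_base_full (f v)).
move: (row_base (f v)) (col_base (f v)) => b c bf cf h.
apply: (row_free_inj bf); apply: (row_full_inj cf).
by rewrite mul1mx -h !mulmxA.
Qed.

Lemma mul_col_base v : f v *m col_base (f v) = col_base (f v).
Proof.
have := base_retract v; have := mulmx_base (f v).
move: (row_base (f v)) (col_base (f v)) => b c e bc.
by rewrite -[X in X *m c = _]e -mulmxA bc mulmx1.
Qed.

Lemma mul_row_base v : row_base (f v) *m f v = row_base (f v).
Proof.
have := base_retract v; have := mulmx_base (f v).
move: (row_base (f v)) (col_base (f v)) => b c e bc.
by rewrite -[X in b *m X = _]e mulmxA bc mul1mx.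
Qed.

Definition image_rep : rep k Q := @Rep k n Q (fun v => \rank (f v))
  (fun u v a => row_base (f u) *m act V a *m col_base (f v)).

Lemma act_col_base u v (a : 'I_(Q u v)) :
  act V a *m col_base (f v) = col_base (f u) *m act image_rep a.
Proof.
have := mulmx_base (f u); have := mul_col_base v; rewrite /=.
move: (row_base (f u)) (col_base (f u)) (col_base (f v)) => b c c' fc cb.
by rewrite !mulmxA cb -homf -mulmxA fc.
Qed.

Lemma row_base_act u v (a : 'I_(Q u v)) :
  row_base (f u) *m act V a = act image_rep a *m row_base (f v).
Proof.
have := mulmx_base (f v); have := mul_row_base u; rewrite /=.
move: (row_base (f u)) (col_base (f v)) (row_base (f v)) => b c b' bf cb.
by rewrite -!mulmxA cb homf mulmxA bf.
Qed.
End Split.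

(** An idempotent endomorphism [f] decomposes [V] into the images of [f] and
    [1 - f]. *)
Lemma indecomposable_trivial_idempotents (V : rep k Q) :
  indecomposable V -> trivial_idempotents (arrow_mx V).
Proof.
case=> nz indec; split.
  case: (pickP (fun v => 0 < rdim V v)%N) => [v hv|h]; first by exists v.
  have d0 v : rdim V v = 0%N by have := h v; case: (rdim V v).
  have e0 p q (A B : 'M[k]_(p, q)) : p = 0%N -> A = B.
    by move=> p0; subst p; rewrite [A]flatmx0 [B]flatmx0.
  case: nz; exists (fun=> 0), (fun=> 0); split.
  - by move=> u v a; rewrite mulmx0 mul0mx.
  - by move=> u v a; rewrite mulmx0 mul0mx.
  - by move=> v; apply: e0.
  by move=> v; apply: e0.
move=> f hf ff; pose g v := 1%:M - f v.
have homf u v (a : 'I_(Q u v)) : act V a *m f v = f u *m act V a.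
  by rewrite -arrow_mxE.
have homg u v (a : 'I_(Q u v)) : act V a *m g v = g u *m act V a.
  by rewrite /g mulmxBr mulmxBl mul1mx mulmx1 homf.
have gg v : g v *m g v = g v.
  by rewrite /g mulmxBl mul1mx mulmxBr mulmx1 ff subrr subr0.
have fg v : f v *m g v = 0 by rewrite /g mulmxBr mulmx1 ff subrr.
have gf v : g v *m f v = 0 by rewrite /g mulmxBl mul1mx ff subrr.
have orth (f1 f2 : forall v, 'M[k]_(rdim V v)) v : (forall v, f1 v *m f2 v = 0) ->
    row_base (f1 v) *m col_base (f2 v) = 0.
  move=> h; have : col_base (f1 v) *m row_base (f1 v) *m
      (col_base (f2 v) *m row_base (f2 v)) = 0.
    by rewrite !mulmx_base.
  move: (row_base_free (f2 v)) (col_base_full (f1 v)).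
  move: (row_base (f1 v)) (col_base (f1 v)) (row_base (f2 v)) (col_base (f2 v)).
  move=> b c b' c' b'f cf {}h; apply: (row_free_inj b'f); apply: (row_full_inj cf).
  by rewrite mul0mx mulmx0 -h !mulmxA.
have iso : rep_iso V (rep_sum (image_rep f) (image_rep g)).
  exists (fun v => row_mx (col_base (f v)) (col_base (g v))),
    (fun v => col_mx (row_base (f v)) (row_base (g v))); split.
  - move=> u v a; rewrite mul_mx_row /= mul_row_block !mulmx0 addr0 add0r.
    by rewrite !(act_col_base _ _ a).
  - move=> u v a; rewrite /= mul_block_col mul_col_mx !mul0mx addr0 add0r.
    congr col_mx; apply/esym.
      exact: (row_base_act homf ff).
    exact: (row_base_act homg gg).
  - by move=> v; rewrite mul_row_col !mulmx_base /g addrC subrK.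
  move=> v; rewrite mul_col_row !base_retract // !orth //.
  by rewrite -scalar_mx_block.
have zero (f1 : forall v, 'M[k]_(rdim V v)) : rep_iso (image_rep f1) (rep_zero k Q) ->
    forall v, f1 v = 0.
  case=> [F [G [_ _ FG _]]] v; apply/eqP; rewrite -mxrank_eq0.
  have := congr1 (fun A : 'M_(\rank (f1 v)) => \rank A) (FG v).
  rewrite /= mxrank1 => <-; rewrite -leqn0.
  by apply: leq_trans (mxrankM_maxl _ _) _; apply: leq_trans (rank_leq_col _) _.
case: (indec _ _ iso) => [/zero|/zero g0]; [by left|right => v].
by apply/esym/eqP; rewrite -subr_eq0; apply/eqP; apply: g0.
Qed.

End Rep.

Section Fractions.
Variable N : nat.
Local Notation P := {mpoly rat[N]}.

(** The point (1,...,1) serves as a witness that a subtraction-free expression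
    in the variables does not vanish. *)
Definition positive_fraction (x : {fraction P}) : Prop :=
  exists p q : P, [/\ 0 < p.@[fun=> 1], 0 < q.@[fun=> 1] & x = tofrac p / tofrac q].

Lemma positive_fraction_cone : positive_cone positive_fraction.
Proof.
have nz (p : P) : 0 < p.@[fun=> 1] -> tofrac p != 0.
  move=> hp; rewrite tofrac_eq0; apply: contraTneq hp => ->.
  by rewrite meval0 ltxx.
split.
- move=> _ _ [p [q [hp hq ->]]] [p' [q' [hp' hq' ->]]].
  exists (p * q' + p' * q), (q * q').
  rewrite !mevalD !mevalM addr_gt0 ?mulr_gt0 //; split=> //.
  by rewrite tofracD !tofracM addf_div ?nz.
- move=> _ _ [p [q [hp hq ->]]] [p' [q' [hp' hq' ->]]].
  exists (p * p'), (q * q').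
  rewrite !mevalM ?mulr_gt0 //; split=> //.
  by rewrite !tofracM mulf_div.
- by move=> _ [p [q [hp hq ->]]]; exists q, p; rewrite invf_div.
by move=> _ [p [q [hp hq ->]]]; rewrite mulf_neq0 ?invr_eq0 ?nz.
Qed.

Lemma positive_fraction_var v : positive_fraction (tofrac ('X_v : P)).
Proof.
exists 'X_v, 1; rewrite mevalXU meval1 !ltr01; split=> //.
by rewrite tofrac1 divr1.
Qed.
End Fractions.

(** * The biframed seed *)

Lemma monomial_sum m (F : fieldType) (u : 'I_m -> F) n (a : 'I_n -> 'I_m -> int) :
  (forall v, u v != 0) ->
  \prod_s monomial u (a s) = monomial u (fun v => \sum_s a s v).
Proof.
move=> u0; rewrite /monomial exchange_big; apply: eq_bigr => v _ /=.
rewrite (big_morph (fun c => u v ^ c) (id1 := 1) (op1 := *%R)) //.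
by move=> b c; rewrite expfzDr.
Qed.

Section Biframed.
Variables (n : nat) (Q : quiver n).

Let splitE p q : (forall j : 'I_p, split (lshift q j) = inl j) *
  (forall j : 'I_q, split (rshift p j) = inr j).
Proof. by split=> j; [exact: (unsplitK (inl j))|exact: (unsplitK (inr j))]. Qed.

Lemma biframed_xx i j : biframed Q (xv i) (xv j) = Q i j.
Proof. by rewrite /biframed /xv !splitE. Qed.
Lemma biframed_xy i j : biframed Q (xv i) (yv j) = (i == j).
Proof. by rewrite /biframed /xv /yv /zv !splitE. Qed.
Lemma biframed_yx i j : biframed Q (yv j) (xv i) = 0%N.
Proof. by rewrite /biframed /xv /yv /zv !splitE. Qed.
Lemma biframed_zx i j : biframed Q (zv j) (xv i) = (j == i).
Proof. by rewrite /biframed /xv /yv /zv !splitE. Qed.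
Lemma biframed_xz i j : biframed Q (xv i) (zv j) = 0%N.
Proof. by rewrite /biframed /xv /yv /zv !splitE. Qed.

Variant vertex_spec : 'I_(n + n + n) -> Type :=
| XVertex r : vertex_spec (xv r)
| YVertex r : vertex_spec (yv r)
| ZVertex r : vertex_spec (zv r).

Lemma vertexP v : vertex_spec v.
Proof.
case: (split_ordP v) => [v' ->|r ->]; last exact: ZVertex.
by case: (split_ordP v') => [r ->|r ->]; [exact: XVertex|exact: YVertex].
Qed.

Lemma xv_inj : injective (@xv n).
Proof. by move=> i j /lshift_inj/lshift_inj. Qed.

Lemma yv_neq_xv i j : yv i != xv j :> 'I_(n + n + n).
Proof. by rewrite (inj_eq (@lshift_inj _ _)) eq_rlshift. Qed.

Lemma zv_neq_xv i j : zv i != xv j :> 'I_(n + n + n).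
Proof. by rewrite eq_rlshift. Qed.

Hypothesis Q1 : forall u v, Q u v = arrows Q u v.
Hypothesis Qacyclic : acyclic (arrows Q).

Lemma no_2cycle_biframed : no_2cycle (biframed Q).
Proof.
case: Qacyclic => h hE u v.
have Qh i j : Q i j = 0%N \/ Q j i = 0%N.
  rewrite !Q1; case ij: (arrows Q i j); last by left.
  right; case ji: (arrows Q j i) => //.
  by have := ltn_trans (hE _ _ ij) (hE _ _ ji); rewrite ltnn.
rewrite /biframed; case: (split u) => u'; case: (split v) => v'; auto.
by case: (split u') => i; case: (split v') => j; auto.
Qed.

Variables (k : closedFieldType) (d : 'I_n -> nat) (M : forall u v, 'M[k]_(d u, d v)).
Hypothesis sM : supported (arrows Q) M.

(** The exponents of the term [e = 0] of the cluster character, for all the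
    vertices at once. *)
Definition initial_exponent (v : 'I_(n + n + n)) : int :=
  - (\sum_r (v == xv r) * d r)%N%:Z + \sum_s (d s)%:Z * (biframed Q v (xv s))%:Z.

Lemma initial_is_exponent : is_exponent (@xv n) (biframed_seed Q) M initial_exponent.
Proof.
case: Qacyclic => h hE; split.
  move=> r _; rewrite /initial_exponent; congr (- _ + _).
  rewrite (bigD1 r) //= eqxx mul1n big1 ?addn0 // => s sr.
  by rewrite (inj_eq xv_inj) eq_sym (negPf sr).
(* the vertices of height less than [t] carry the subrepresentation that
   reaches the minimum *)
have below t v : (forall s, (0 < d s)%N -> (0 < biframed Q v (xv s))%N -> (h s < t)%N) ->
    (forall s, (0 < d s)%N -> (0 < biframed Q (xv s) v)%N -> (t <= h s)%N) ->
    is_min_on M (net (@xv n) (biframed_seed Q) v)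
      (- \sum_s (d s)%:Z * (biframed Q v (xv s))%:Z).
  move=> lo hi; split.
    exists (fun s => if (h s < t)%N then d s else 0%N); split.
      exists (fun s => if (h s < t)%N then 1%:M else 0); split=> [u w|u]; last first.
        by case: (h u < t)%N; rewrite ?mxrank1 ?mxrank0.
      case: ltnP => hu; last by rewrite mul0mx sub0mx.
      case: ltnP => hw; first exact: submx1.
      rewrite sM ?mulmx0 ?sub0mx //; apply/negP=> /hE; by rewrite ltnNge (leq_trans (ltnW hu)).
    rewrite -sumrN; apply: eq_bigr => s _; rewrite /net /=.
    case: (posnP (d s)) => ds; first by rewrite ds; case: ifP; rewrite !mul0r oppr0.
    case: ltnP => hs.
      have -> : biframed Q (xv s) v = 0%N.
        by apply/eqP; rewrite -leqn0 leqNgt; apply/negP=> /(hi s ds); rewrite leqNgt hs.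
      by rewrite sub0r mulrN.
    have -> : biframed Q v (xv s) = 0%N.
      by apply/eqP; rewrite -leqn0 leqNgt; apply/negP=> /(lo s ds); rewrite ltnNge hs.
    by rewrite mul0r mulr0 oppr0.
  move=> e he; rewrite -sumrN; apply: ler_sum => s _; rewrite /net /=.
  have := subdim_le s he; nia.
move=> v hv; rewrite /initial_exponent.
have -> : (\sum_r (v == xv r) * d r = 0)%N.
  apply: big1 => r _; case: (posnP (d r)) => [->|/hv/negPf->//]; exact: muln0.
rewrite oppr0 add0r; case: (vertexP v) => r.
- apply: (below (h r)) => s _; rewrite biframed_xx; first exact: hE.
  by move/hE/ltnW.
- by apply: (below 0%N) => s _; rewrite ?biframed_yx.
apply: (below (\sum_v h v).+1) => s _; rewrite ?biframed_xz // => _.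
by rewrite ltnS (bigD1 s) //= leq_addr.
Qed.

Lemma initial_var_neq0 v : init_var v != 0 :> ratfun n.
Proof. exact: pos_neq0 (positive_fraction_cone _) _ (positive_fraction_var v). Qed.

Lemma sum_delta (f : 'I_n -> int) r : \sum_s f s * (s == r)%:Z = f r.
Proof.
rewrite (bigD1 r) //= eqxx mulr1 big1 ?addr0 // => s /negPf->.
by rewrite mulr0.
Qed.

(** The two sides agree vertex by vertex: the Euler form with [alpha r] counts
    the arrows at [r], and the only arrows at [yv r] and [zv r] join them to
    [xv r]. *)
Lemma character_term (e : 'I_n -> nat) : (forall r, e r <= d r)%N ->
  monomial (@init_var n) initial_exponent * \prod_r yhat (@xv n) (biframed_seed Q) r ^+ e r =
  \prod_(r < n)
      (init_var (xv r) ^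
         (- euler_form Q (fun i => (e i)%:Z) (alpha r)
          - euler_form Q (alpha r) (fun i => (d i)%:Z - (e i)%:Z))
       * init_var (yv r) ^+ e r
       * init_var (zv r) ^+ (d r - e r)).
Proof.
move=> ed.
have -> : \prod_r yhat (@xv n) (biframed_seed Q) r ^+ e r =
    monomial (@init_var n) (fun v => \sum_s (e s)%:Z * net (@xv n) (biframed_seed Q) v s).
  rewrite -monomial_sum; last exact: initial_var_neq0.
  by apply: eq_bigr => s _; rewrite /yhat monomialZ.
rewrite -monomialD; last exact: initial_var_neq0.
rewrite /monomial big_split_ord /= big_split_ord /= -!big_split /=.
apply: eq_bigr => r _; rewrite -/(xv r) -/(yv r) -/(zv r).
congr (_ ^ _ * _ * _).
- rewrite /initial_exponent.
  have -> : (\sum_r0 (xv r == xv r0) * d r0 = d r)%N.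
    rewrite (bigD1 r) //= eqxx mul1n big1 ?addn0 // => s sr.
    by rewrite (inj_eq xv_inj) eq_sym (negPf sr).
  rewrite /net /= /euler_form /alpha.
  have -> : \sum_i (e i)%:Z * (i == r)%:Z = (e r)%:Z by rewrite sum_delta.
  have -> : \sum_i (i == r)%:Z * ((d i)%:Z - (e i)%:Z) = (d r)%:Z - (e r)%:Z.
    rewrite -(sum_delta (fun i => (d i)%:Z - (e i)%:Z)).
    by apply: eq_bigr => i _; rewrite mulrC.
  have -> : \sum_i \sum_j (Q i j)%:Z * (e i)%:Z * (j == r)%:Z = \sum_s (e s)%:Z * (Q s r)%:Z.
    by apply: eq_bigr => i _; rewrite sum_delta mulrC.
  have -> : \sum_i \sum_j (Q i j)%:Z * (i == r)%:Z * ((d j)%:Z - (e j)%:Z) =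
      \sum_s (d s)%:Z * (Q r s)%:Z - \sum_s (e s)%:Z * (Q r s)%:Z.
    rewrite exchange_big -sumrB; apply: eq_bigr => j _ /=.
    rewrite -mulrBl -(sum_delta (fun i => ((d j)%:Z - (e j)%:Z) * (Q i j)%:Z) r).
    by apply: eq_bigr => i _; ring.
  have -> : \sum_s (e s)%:Z * ((biframed Q (xv s) (xv r))%:Z - (biframed Q (xv r) (xv s))%:Z)
      = \sum_s (e s)%:Z * (Q s r)%:Z - \sum_s (e s)%:Z * (Q r s)%:Z.
    by rewrite -sumrB; apply: eq_bigr => s _; rewrite !biframed_xx mulrBr.
  have -> : \sum_s (d s)%:Z * (biframed Q (xv r) (xv s))%:Z = \sum_s (d s)%:Z * (Q r s)%:Z.
    by apply: eq_bigr => s _; rewrite biframed_xx.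
  by ring.
- rewrite /initial_exponent /net /= big1 => [|s _]; last by rewrite (negPf (yv_neq_xv _ _)).
  rewrite big1 => [|s _]; last by rewrite biframed_yx mulr0.
  rewrite oppr0 !add0r (eq_bigr (fun s => (e s)%:Z * (s == r)%:Z)) => [|s _].
    by rewrite sum_delta.
  by rewrite biframed_xy biframed_yx subr0.
rewrite /initial_exponent /net /= big1 => [|s _]; last by rewrite (negPf (zv_neq_xv _ _)).
rewrite oppr0 add0r (eq_bigr (fun s => (d s)%:Z * (s == r)%:Z)) => [|s _]; last first.
  by rewrite biframed_zx eq_sym.
rewrite sum_delta (eq_bigr (fun s => - ((e s)%:Z * (s == r)%:Z))) => [|s _]; last first.
  by rewrite biframed_zx biframed_xz sub0r mulrN eq_sym.
by rewrite sumrN sum_delta subzn.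
Qed.

End Biframed.

Theorem theoremC (k : closedFieldType) (n : nat) (Q : quiver n)
    (hQ : dynkin Q)
    (chi : forall I : finType, kset k I -> int)
    (hchi : euler_characteristic chi)
    (V : cluster_indec k Q) (hV : rigid V) :
  cluster_variable n (biframed_seed Q) (cluster_character chi V).
Proof.
case: V {hV} => [V indV|i] /=; last by exists [::], (xv i); split=> //=; exact: ltn_ord.
have [Eac [y Edom] Q1] := dynkin_arrows hQ.
pose M := arrow_mx V.
have seed_ok : good_seed (@positive_fraction (n + n + n)) (biframed_seed Q).
  split=> [v|]; first exact: positive_fraction_var.
  exact: no_2cycle_biframed.
have compat : compatible (@xv n) (biframed_seed Q) (arrows Q) (rdim V).
  by move=> r s _ _; rewrite /= biframed_xx.
(* the nonnegative quantity that decreases *)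
pose b := pairing_form (arrows Q) y (rdim V) + form_bound (tits (arrows Q) (rdim V)) y.
have [rs [r e]] := is_seed_value hchi (positive_fraction_cone _) (@xv_inj n) (N := `|b|.+1)
  Eac Edom erefl (indecomposable_trivial_idempotents Q1 indV) (arrow_mx_supported V)
  seed_ok compat (initial_is_exponent Eac (arrow_mx_supported V)) ltac:(lia).
exists (map (@xv n) rs), (xv r); split.
- by apply/allP => _ /mapP[s _ ->]; exact: (ltn_ord s).
- exact: (ltn_ord r).
rewrite e /fpoly mulr_sumr; apply: eq_bigr => f _ /=.
rewrite (chi_ext chi (quiver_gr_sub_gr Q1 (V := V) (e := fun v => f v))).
rewrite mulrCA; congr (_ * _).
by rewrite (character_term _ (e := fun v => f v)) // => v; exact: leq_ord.
Qed.
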